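(* Let $G$ be a finite group, $V$ a finite-dimensional ${\mathbb Q}$-vector space, and $\rho\colon G\hookrightarrow \operatorname{Aut}(V)$ a faithful irreducible rational representation. Then there exist a finite Galois extension of number fields $L/K$, an abelian variety $A$ defined over $K$, an isomorphism ${\rm Gal}(L/K)\to G$, and a ${\rm Gal}(L/K)$-stable subspace $W$ of $A(L)\otimes{\mathbb Q}$ such that, transporting the ${\rm Gal}(L/K)$-action to a $G$-action via this isomorphism, $W$ is isomorphic to $V$ as a ${\mathbb Q}[G]$-module.
   Context: For a Galois extension $L/K$ of number fields and an abelian variety $A/K$, the group ${\rm Gal}(L/K)$ acts on $A(L)$, making $A(L)\otimes{\mathbb Q}$ a ${\mathbb Q}[{\rm Gal}(L/K)]$-module. *)

(* Defs.v *)
From HB Require Import structures.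
From mathcomp Require Import all_boot all_order all_algebra all_fingroup.
From mathcomp Require Import all_solvable all_field all_character.
From mathcomp Require Import boolp mpoly ring.

Set Implicit Arguments.
Unset Strict Implicit.
Unset Printing Implicit Defensive.

Import GRing.Theory Num.Theory.
Local Open Scope ring_scope.
Local Open Scope quotient_scope.

(* The tensor product of an abelian group M with rat is built as the          *)
(* localisation of M at the nonzero integers: (m, d) stands for               *)
(* m (x) 1/(d+1), and two fractions are equal when they agree up to torsion.  *)
(* Lemmas tensDl, tensDr and tens_univ establish its universal property.      *)
Section TensorRat.
Variable M : zmodType.

Definition tensQ_eq (x y : M * nat) : bool :=
  `[< exists k : nat, (x.1 *+ y.2.+1) *+ k.+1 = (y.1 *+ x.2.+1) *+ k.+1 >].

Lemma tensQ_eq_refl : reflexive tensQ_eq.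
Proof. by move=> x; apply/asboolP; exists 0%N. Qed.

Lemma tensQ_eq_sym : ssrbool.symmetric tensQ_eq.
Proof.
by move=> x y; apply/asboolP/asboolP => -[k Hk]; exists k; rewrite Hk.
Qed.

Lemma tensQ_eq_trans : transitive tensQ_eq.
Proof.
move=> y x z /asboolP[k Hk] /asboolP[l Hl]; apply/asboolP.
exists (y.2.+1 * (k.+1 * l.+1)).-1; rewrite prednK ?muln_gt0 // -!mulrnA.
have -> : (z.2.+1 * (y.2.+1 * (k.+1 * l.+1)) =
           (y.2.+1 * k.+1) * (z.2.+1 * l.+1))%N by ring.
have -> : (x.2.+1 * (y.2.+1 * (k.+1 * l.+1)) =
           (y.2.+1 * l.+1) * (x.2.+1 * k.+1))%N by ring.
rewrite mulrnA [x.1 *+ _]mulrnA Hk [RHS]mulrnA [z.1 *+ _]mulrnA -Hl -!mulrnA.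
by congr (_ *+ _); ring.
Qed.

Canonical tensQ_equiv :=
  EquivRel tensQ_eq tensQ_eq_refl tensQ_eq_sym tensQ_eq_trans.

Definition tensQ := {eq_quot tensQ_equiv}.
HB.instance Definition _ := Choice.on tensQ.

(* [fracQ m d] is m (x) 1/d, for d > 0. *)
Definition fracQ (m : M) (d : nat) : tensQ := \pi_({eq_quot tensQ_equiv}) (m, d.-1).

Lemma fracQP m m' d d' : (0 < d)%N -> (0 < d')%N ->
  fracQ m d = fracQ m' d' <->
  exists2 k, (0 < k)%N & (m *+ d') *+ k = (m' *+ d) *+ k.
Proof.
case: d d' => [//|d] [//|d'] _ _; split.
  by move/eqmodP/asboolP => -[k Hk]; exists k.+1.
by case=> -[//|k] _ Hk; apply/eqmodP/asboolP; exists k.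
Qed.

Definition numQ (x : tensQ) : M := (generic_quotient.repr x).1.
Definition denQ (x : tensQ) : nat := (generic_quotient.repr x).2.+1.

Lemma fracQK x : fracQ (numQ x) (denQ x) = x.
Proof. by rewrite /fracQ /numQ /denQ /= -surjective_pairing reprK. Qed.

Lemma num_denQ m d (x := fracQ m d) : (0 < d)%N ->
  exists2 k, (0 < k)%N & (numQ x *+ d) *+ k = (m *+ denQ x) *+ k.
Proof. by move=> d0; apply/fracQP => //; apply: fracQK. Qed.

Lemma tensQ_ind (P : tensQ -> Prop) :
  (forall m d, (0 < d)%N -> P (fracQ m d)) -> forall x, P x.
Proof. by move=> HP x; rewrite -(fracQK x); apply: HP. Qed.

Lemma fracQMn m d k : (0 < d)%N -> (0 < k)%N ->
  fracQ (m *+ k) (d * k) = fracQ m d.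
Proof.
move=> d0 k0; apply/fracQP; rewrite ?muln_gt0 ?d0 //; exists 1%N => //.
by rewrite -!mulrnA; congr (_ *+ _); ring.
Qed.

Lemma tensQ_ind2 (P : tensQ -> tensQ -> Prop) :
  (forall m m' d, (0 < d)%N -> P (fracQ m d) (fracQ m' d)) ->
  forall x y, P x y.
Proof.
move=> HP; apply: tensQ_ind => m d d0; apply: tensQ_ind => m' d' d'0.
rewrite -(fracQMn m d0 d'0) -(fracQMn m' d'0 d0) [(d' * d)%N]mulnC.
by apply: HP; rewrite muln_gt0 d0.
Qed.

Definition addQ x y :=
  fracQ (numQ x *+ denQ y + numQ y *+ denQ x) (denQ x * denQ y).
Definition oppQ x := fracQ (- numQ x) (denQ x).
Definition scaleQ (q : rat) x :=
  fracQ (numQ x *~ numq q) (denQ x * `|denq q|).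

Lemma addQE m m' d : (0 < d)%N ->
  addQ (fracQ m d) (fracQ m' d) = fracQ (m + m') d.
Proof.
move=> d0; rewrite /addQ; set x := fracQ m d; set y := fracQ m' d.
have [k k0 Hk] := num_denQ m d0.
have [l l0 Hl] := num_denQ m' d0.
apply/fracQP => //; exists (k * l)%N; first by rewrite muln_gt0 k0.
rewrite !mulrnDl -!mulrnA.
have -> : (denQ y * (d * (k * l)) = d * k * (denQ y * l))%N by ring.
have -> : (denQ x * (d * (k * l)) = d * l * (denQ x * k))%N by ring.
rewrite mulrnA [numQ x *+ _]mulrnA Hk [numQ y *+ _]mulrnA.
rewrite [numQ y *+ _]mulrnA Hl -!mulrnA.
by congr (_ *+ _ + _ *+ _); ring.
Qed.

Lemma oppQE m d : (0 < d)%N -> oppQ (fracQ m d) = fracQ (- m) d.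
Proof.
move=> d0; rewrite /oppQ; set x := fracQ m d.
have [k k0 Hk] := num_denQ m d0.
by apply/fracQP => //; exists k => //; rewrite !mulNrn Hk.
Qed.

Lemma scaleQE (q : rat) (a : int) (b : nat) m d :
    (0 < b)%N -> (0 < d)%N -> q = a%:~R / b%:R ->
  scaleQ q (fracQ m d) = fracQ (m *~ a) (d * b).
Proof.
move=> b0 d0 qE; rewrite /scaleQ; set x := fracQ m d.
have [k k0 Hk] := num_denQ m d0.
have qN : (0 < `|denq q|)%N by rewrite absz_gt0 denq_neq0.
have aqE : numq q * b%:Z = a * `|denq q|%:Z.
  have : (numq q)%:~R / (denq q)%:~R = a%:~R / b%:R :> rat by rewrite divq_num_den.
  rewrite gtz0_abs ?denq_gt0 // => /eqP.
  rewrite eqr_div ?intr_eq0 ?denq_neq0 ?pnatr_eq0 -?lt0n //.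
  by rewrite -[b%:R]/((b%:Z)%:~R) -!intrM eqr_int => /eqP.
apply/fracQP; rewrite ?muln_gt0 ?d0 ?b0 ?qN //; exists k => //.
have -> : (numQ x *~ numq q) *+ (d * b) *+ k =
          (numQ x *+ d *+ k) *~ (numq q * b%:Z).
  by rewrite !pmulrn -!mulrzA PoszM; congr (_ *~ _); ring.
rewrite Hk aqE !pmulrn -!mulrzA PoszM; congr (_ *~ _); ring.
Qed.

Lemma addQA : associative addQ.
Proof.
move=> x y z; move: x y; apply: tensQ_ind2 => m m' d d0; move: z; apply: tensQ_ind => n e e0.
rewrite -(fracQMn m d0 e0) -(fracQMn m' d0 e0) -(fracQMn n e0 d0) [(e * d)%N]mulnC.
by rewrite !addQE ?muln_gt0 ?d0 ?e0 // addrA.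
Qed.

Lemma addQC : commutative addQ.
Proof. by apply: tensQ_ind2 => m m' d d0; rewrite !addQE // addrC. Qed.

Lemma frac0Q d : (0 < d)%N -> fracQ 0 d = fracQ 0 1.
Proof. by move=> d0; apply/fracQP => //; exists 1%N; rewrite // !mul0rn. Qed.

Lemma add0Q : left_id (fracQ 0 1) addQ.
Proof. by apply: tensQ_ind => m d d0; rewrite -(frac0Q d0) addQE // add0r. Qed.

Lemma addNQ : left_inverse (fracQ 0 1) oppQ addQ.
Proof.
by apply: tensQ_ind => m d d0; rewrite oppQE // addQE // addNr frac0Q.
Qed.

HB.instance Definition _ := GRing.isZmodule.Build tensQ addQA addQC add0Q addNQ.

Lemma rat_fracP (q : rat) : exists (a : int) (b : nat), (0 < b)%N /\ q = a%:~R / b%:R.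
Proof.
exists (numq q), `|denq q|%N; rewrite absz_gt0 denq_neq0; split=> //.
by rewrite -[_%:R]/((`|denq q|%:Z)%:~R) gtz0_abs ?denq_gt0 // divq_num_den.
Qed.

Lemma scaleQA p q x : scaleQ p (scaleQ q x) = scaleQ (p * q) x.
Proof.
move: x; apply: tensQ_ind => m d d0.
have [a [b [b0 pE]]] := rat_fracP p; have [a' [b' [b'0 qE]]] := rat_fracP q.
rewrite (scaleQE _ b'0 d0 qE) (scaleQE _ b0 _ pE) ?muln_gt0 ?d0 //.
rewrite (@scaleQE _ (a' * a) (b' * b)) ?muln_gt0 ?b0 ?b'0 //.
  by rewrite mulrzA mulnA.
by rewrite pE qE mulrC mulf_div intrM natrM.
Qed.

Lemma scale1Q : left_id 1 scaleQ.
Proof.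
apply: tensQ_ind => m d d0; rewrite (@scaleQE _ 1 1) ?divr1 //.
by rewrite mulr1z muln1.
Qed.

Lemma scaleQDr : right_distributive scaleQ +%R.
Proof.
move=> q; apply: tensQ_ind2 => m m' d d0; have [a [b [b0 qE]]] := rat_fracP q.
rewrite [_ + _]addQE // !(scaleQE _ b0 d0 qE) [RHS]addQE ?muln_gt0 ?d0 //.
by rewrite mulrzDl.
Qed.

Lemma scaleQDl x : {morph scaleQ^~ x : p q / p + q}.
Proof.
move=> p q; move: x; apply: tensQ_ind => m d d0.
have [a [b [b0 pE]]] := rat_fracP p; have [a' [b' [b'0 qE]]] := rat_fracP q.
have nz n : (0 < n)%N -> n%:R != 0 :> rat by rewrite pnatr_eq0 lt0n.
have bb0 : (0 < b * b')%N by rewrite muln_gt0 b0.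
rewrite (@scaleQE (p + q) (a * b'%:Z + a' * b%:Z) (b * b')) //; last first.
  by rewrite pE qE addf_div ?nz // !intrD !intrM natrM.
rewrite (@scaleQE p (a * b'%:Z) (b * b')) //; last first.
  rewrite pE intrM natrM -[(b'%:Z)%:~R]/(b'%:R : rat) -mulf_div divff ?nz //.
  by rewrite mulr1.
rewrite (@scaleQE q (a' * b%:Z) (b * b')) //; last first.
  rewrite qE intrM mulnC natrM -[(b%:Z)%:~R]/(b%:R : rat) -mulf_div divff ?nz //.
  by rewrite mulr1.
by rewrite [RHS]addQE -?mulrzDr // muln_gt0 d0.
Qed.

HB.instance Definition _ :=
  GRing.Zmodule_isLmodule.Build rat tensQ scaleQA scale1Q scaleQDr scaleQDl.

Definition tens (m : M) (q : rat) : tensQ := q *: fracQ m 1.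

Lemma tensDl m m' q : tens (m + m') q = tens m q + tens m' q.
Proof. by rewrite -scalerDr [X in _ = q *: X]addQE. Qed.

Lemma tensDr m p q : tens m (p + q) = tens m p + tens m q.
Proof. exact: scalerDl. Qed.

Lemma fracQE m d : (0 < d)%N -> fracQ m d = tens m d%:R^-1.
Proof.
move=> d0; rewrite [RHS](@scaleQE _ 1 d) ?div1r //.
by rewrite mulr1z mul1n.
Qed.

Lemma tens_univ (U : zmodType) (b : M -> rat -> U) :
    (forall m m' q, b (m + m') q = b m q + b m' q) ->
    (forall m p q, b m (p + q) = b m p + b m q) ->
  exists! g : tensQ -> U,
    (forall x y, g (x + y) = g x + g y) /\ (forall m q, g (tens m q) = b m q).
Proof.
move=> bDl bDr.
have b0r m : b m 0 = 0 by apply: (addrI (b m 0)); rewrite -bDr !addr0.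
have b0l q : b 0 q = 0 by apply: (addrI (b 0 q)); rewrite -bDl !addr0.
have bNl m q : b (- m) q = - b m q.
  by apply: (addrI (b m q)); rewrite -bDl !subrr b0l.
have bMnl m q k : b (m *+ k) q = b m q *+ k.
  by elim: k => [|k IH]; rewrite ?mulr0n // !mulrS bDl IH.
have bMnr m q k : b m (q *+ k) = b m q *+ k.
  by elim: k => [|k IH]; rewrite ?mulr0n // !mulrS bDr IH.
have bMz m q a : b (m *~ a) q = b m (a%:~R * q).
  case: a => k; first by rewrite -!pmulrn bMnl -bMnr mulr_natl.
  rewrite NegzE !mulrNz bNl -!pmulrn bMnl mulNr mulr_natl -bMnr.
  by apply: (addrI (b m (q *+ k.+1))); rewrite -bDr !subrr b0r.
have nz n : (0 < n)%N -> n%:R != 0 :> rat by rewrite pnatr_eq0 lt0n.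
pose g x := b (numQ x) (denQ x)%:R^-1.
have gE m d : (0 < d)%N -> g (fracQ m d) = b m d%:R^-1.
  move=> d0; rewrite /g; set x := fracQ m d.
  have [k k0 Hk] := num_denQ m d0.
  have e : (denQ x)%:R^-1 = (d * k)%:R * (denQ x * (d * k))%:R^-1 :> rat.
    by rewrite [(denQ x * _)%:R]natrM invfM mulrCA divff ?mulr1 // nz // muln_gt0 d0.
  have e' : d%:R^-1 = (denQ x * k)%:R * (denQ x * (d * k))%:R^-1 :> rat.
    rewrite mulnCA [(d * _)%:R]natrM invfM mulrCA divff ?mulr1 // nz //.
    by rewrite muln_gt0 k0.
  by rewrite e e' !mulr_natl !bMnr -!bMnl !mulrnA Hk.
exists g; split; first split.
- by apply: tensQ_ind2 => m m' d d0; rewrite [_ + _]addQE // !gE.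
- move=> m q; have [a [c [c0 qE]]] := rat_fracP q.
  by rewrite /tens [_ *: _](@scaleQE q a c m 1 c0 isT qE) mul1n gE // bMz -qE.
move=> h [_ hE]; apply/funext => x; move: x; apply: tensQ_ind => m d d0.
by rewrite gE // fracQE // hE.
Qed.

End TensorRat.

Section TensorRatMap.
Variables (M N : zmodType) (h : {additive M -> N}).

Definition tensQ_map (x : tensQ M) : tensQ N := fracQ (h (numQ x)) (denQ x).

Lemma tensQ_mapE m d : (0 < d)%N -> tensQ_map (fracQ m d) = fracQ (h m) d.
Proof.
move=> d0; rewrite /tensQ_map; set x := fracQ m d.
have [k k0 Hk] := num_denQ m d0.
by apply/fracQP => //; exists k => //; rewrite -!(raddfMn h) -/x Hk.
Qed.

Lemma tensQ_map_linear : linear tensQ_map.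
Proof.
move=> q x y; have addE := @tensQ_ind2 M (fun x y =>
  tensQ_map (x + y) = tensQ_map x + tensQ_map y).
rewrite addE => [|m m' d d0]; last first.
  by rewrite [_ + _]addQE // !tensQ_mapE // raddfD [RHS]addQE.
congr (_ + _); move: x; apply: tensQ_ind => m d d0; have [a [b [b0 qE]]] := rat_fracP q.
rewrite [_ *: _](scaleQE m b0 d0 qE) !tensQ_mapE ?muln_gt0 ?d0 //.
by rewrite [RHS](scaleQE _ b0 d0 qE) raddfMz.
Qed.

HB.instance Definition _ :=
  GRing.isLinear.Build rat (tensQ M) (tensQ N) *:%R tensQ_map tensQ_map_linear.

Lemma tensQ_map_tens m q : tensQ_map (tens m q) = tens (h m) q.
Proof. by rewrite linearZ /= tensQ_mapE. Qed.

End TensorRatMap.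

(* Number fields are K : fieldExtType rat, i.e. finite extensions of the      *)
(* rationals; an extension field of K is a field F with a morphism i : K -> F. *)

Section Evaluation.
Variables (K F : fieldType) (i : {rmorphism K -> F}).

(* The value at x of a polynomial, or of a tuple of polynomials, over K. *)
Definition peval n (x : 'rV[F]_n) (p : {mpoly K[n]}) : F := mmap i (x 0) p.
Definition tpeval n m (c : 'rV[{mpoly K[n]}]_m) (x : 'rV[F]_n) : 'rV[F]_m :=
  map_mx (peval x) c.

(* Every point of projective space has exactly one vector of homogeneous      *)
(* coordinates whose first nonzero entry is 1.                                *)
Definition proj_normal n (x : 'rV[F]_n) : bool :=
  [exists k, (x 0 k == 1) && [forall j : 'I_n, (j < k)%N ==> (x 0 j == 0)]].

End Evaluation.

(* A closed subvariety of projective N-space over K, given by homogeneous     *)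
(* equations. Since K is perfect, the (reduced) closed subvarieties defined   *)
(* over K are exactly the zero sets of polynomials with coefficients in K.    *)
Record projSet (K : fieldExtType rat) := ProjSet {
  ps_amb : nat;
  ps_eqs : seq {mpoly K[ps_amb.+1]};
  _ : all (fun p => p \is homog mdeg) ps_eqs
}.

Section Points.
Variables (K : fieldExtType rat) (X : projSet K).
Variables (F : fieldType) (i : {rmorphism K -> F}).

Definition pointb (x : 'rV[F]_(ps_amb X).+1) : bool :=
  proj_normal x && all (fun p => peval i x p == 0) (ps_eqs X).
(* The set X(F) of F-rational points. *)
Definition point := {x : 'rV[F]_(ps_amb X).+1 | pointb x}.

(* A regular map to X is given by finitely many tuples s of polynomials; it   *)
(* sends x to y when every tuple of s that does not vanish at x takes there a *)
(* value proportional to y, and at least one does not vanish.                 *)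
Definition maps_to n (s : seq 'rV[{mpoly K[n]}]_(ps_amb X).+1)
    (x : 'rV[F]_n) (y : point) : bool :=
  has (fun c => tpeval i c x != 0) s &&
  all (fun c => (tpeval i c x <= val y)%MS) s.

Lemma maps_to_inj n s (x : 'rV[F]_n) y z : maps_to s x y -> maps_to s x z -> y = z.
Proof.
case/andP=> /hasP[c cs cx] /allP/(_ c cs) cy /andP[_ /allP/(_ c cs) cz].
have [a aE] := sub_rVP cy; have [b bE] := sub_rVP cz.
have a0 : a != 0 by apply: contra_neq cx => a0; rewrite aE a0 scale0r.
have b0 : b != 0 by apply: contra_neq cx => b0; rewrite bE b0 scale0r.
have yzE j : a * val y 0 j = b * val z 0 j.
  by have := congr1 (fun u : 'rV_ _ => u 0 j) (etrans (esym aE) bE); rewrite !mxE.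
have [/andP[/existsP[k /andP[/eqP yk /forallP yl]] _]
      /andP[/existsP[l /andP[/eqP zl /forallP zk]] _]] := (valP y, valP z).
have kl : k = l.
  apply: ord_inj; apply/eqP; rewrite eqn_leq; apply/andP; split; rewrite leqNgt; apply/negP => lt.
    have := yzE l; rewrite (eqP (implyP (yl l) lt)) zl mulr0 mulr1 => /esym/eqP.
    by rewrite (negPf b0).
  have := yzE k; rewrite (eqP (implyP (zk k) lt)) yk mulr0 mulr1 => /eqP.
  by rewrite (negPf a0).
have ab : a = b by have := yzE k; rewrite yk kl zl !mulr1.
apply: val_inj; apply/rowP => j; apply: (mulfI a0); rewrite yzE ab //.
Qed.

End Points.

Section BaseChange.
Variables (K : fieldExtType rat) (X : projSet K) (F F' : fieldType).
Variables (i : {rmorphism K -> F}) (i' : {rmorphism K -> F'}).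
Variables (h : {rmorphism F -> F'}) (hi : h \o i =1 i').

Lemma map_peval n (x : 'rV[F]_n) p : peval i' (map_mx h x) p = h (peval i x p).
Proof.
rewrite /peval /mmap rmorph_sum; apply: eq_bigr => m _ /=.
rewrite rmorphM -[h (i _)]/((h \o i) _) hi /mmap1 rmorph_prod; congr (_ * _).
by apply: eq_bigr => j _; rewrite rmorphXn mxE.
Qed.

Lemma map_tpeval n m (c : 'rV[{mpoly K[n]}]_m) (x : 'rV[F]_n) :
  tpeval i' c (map_mx h x) = map_mx h (tpeval i c x).
Proof. by apply/rowP => j; rewrite !mxE map_peval. Qed.

Lemma point_map_subproof (x : point X i) : pointb i' (map_mx h (val x)).
Proof.
have /andP[/existsP[k /andP[/eqP xk /forallP xl]] /allP xX] := valP x.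
apply/andP; split; last first.
  by apply/allP => p /xX /eqP px; rewrite map_peval px rmorph0.
apply/existsP; exists k; rewrite mxE xk rmorph1 eqxx /=.
apply/forallP => j; apply/implyP => jk.
by rewrite mxE (eqP (implyP (xl j) jk)) rmorph0.
Qed.

Definition point_map (x : point X i) : point X i' := Sub _ (point_map_subproof x).

Lemma maps_to_map n s (x : 'rV[F]_n) (y : point X i) :
  maps_to s x y -> maps_to s (map_mx h x) (point_map y).
Proof.
case/andP=> /hasP[c cs cx] /allP cy; apply/andP; split.
  by apply/hasP; exists c; rewrite // map_tpeval map_mx_eq0.
by apply/allP => b /cy; rewrite map_tpeval /= map_submx.
Qed.

End BaseChange.

(* Irreducibility (apart from nonemptiness) of the Zariski topology on the    *)
(* geometric points.                                                          *)
Definition geom_irreducible (K : fieldExtType rat) (X : projSet K) : Prop :=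
  forall (Om : closedFieldType) (j : {rmorphism K -> Om}) (d e : nat)
         (f g : {mpoly Om[(ps_amb X).+1]}),
    f \is d.-homog -> g \is e.-homog ->
    (forall x : point X j, (f * g).@[val x 0] = 0) ->
  (forall x : point X j, f.@[val x 0] = 0) \/
  (forall x : point X j, g.@[val x 0] = 0).

Definition bihomog (K : fieldType) n (a b : nat) (p : {mpoly K[n + n]}) : bool :=
  all (fun m : 'X_{1..n + n} => (\sum_(k < n) m (lshift n k) == a)%N &&
                                (\sum_(k < n) m (rshift n k) == b)%N) (msupp p).

(* A geometrically irreducible projective variety with a rational point and   *)
(* regular maps gd_opp and gd_add, which are required to be defined at all    *)
(* points over all extension fields.                                          *)
Record groupData (K : fieldExtType rat) := GroupData {
  gd_set :> projSet K;
  gd_irr : geom_irreducible gd_set;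
  gd_zero : point gd_set (idfun : {rmorphism K -> K});
  gd_opp : seq 'rV[{mpoly K[(ps_amb gd_set).+1]}]_(ps_amb gd_set).+1;
  gd_add : seq 'rV[{mpoly K[(ps_amb gd_set).+1 + (ps_amb gd_set).+1]}]_(ps_amb gd_set).+1;
  gd_opp_homog : forall c, c \in gd_opp ->
    exists d, forall k, c 0 k \is d.-homog;
  gd_add_homog : forall c, c \in gd_add ->
    exists a b, forall k, bihomog a b (c 0 k);
  gd_oppP : forall (F : fieldType) (i : {rmorphism K -> F}) (x : point gd_set i),
    exists y : point gd_set i, maps_to gd_opp (val x) y;
  gd_addP : forall (F : fieldType) (i : {rmorphism K -> F}) (x y : point gd_set i),
    exists z : point gd_set i, maps_to gd_add (row_mx (val x) (val y)) z
}.

Section GroupOps.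
Variables (K : fieldExtType rat) (A : groupData K).
Variables (F : fieldType) (i : {rmorphism K -> F}).

Definition pt_zero : point A i :=
  point_map (i := idfun) (h := i) (fun=> erefl) (gd_zero A).
Definition pt_opp (x : point A i) : point A i := xchoose (gd_oppP x).
Definition pt_add (x y : point A i) : point A i := xchoose (gd_addP x y).

Lemma pt_addP x y : maps_to (gd_add A) (row_mx (val x) (val y)) (pt_add x y).
Proof. exact: (xchooseP (gd_addP x y)). Qed.

End GroupOps.

(* Abelian varieties are projective, and a geometrically irreducible group    *)
(* variety over a field of characteristic 0 is smooth. Commutativity is       *)
(* automatic for projective group varieties. Since the varieties are reduced, *)
(* the group axioms may be checked on points.                                 *)
Record abelianVariety (K : fieldExtType rat) := AbelianVariety {
  av_data :> groupData K;
  av_addA : forall (F : fieldType) (i : {rmorphism K -> F}),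
    associative (@pt_add K av_data F i);
  av_addC : forall (F : fieldType) (i : {rmorphism K -> F}),
    commutative (@pt_add K av_data F i);
  av_add0 : forall (F : fieldType) (i : {rmorphism K -> F}),
    left_id (pt_zero av_data i) (@pt_add K av_data F i);
  av_addN : forall (F : fieldType) (i : {rmorphism K -> F}),
    left_inverse (pt_zero av_data i) (@pt_opp K av_data F i) (@pt_add K av_data F i)
}.

Definition av_point (K : fieldExtType rat) (A : abelianVariety K)
  (F : fieldType) (i : {rmorphism K -> F}) : Type := point A i.

Section AvPoint.
Variables (K : fieldExtType rat) (A : abelianVariety K).
Variables (F : fieldType) (i : {rmorphism K -> F}).
HB.instance Definition _ := Choice.on (av_point A i).
HB.instance Definition _ := GRing.isZmodule.Build (av_point A i)
  (@av_addA K A F i) (@av_addC K A F i) (@av_add0 K A F i) (@av_addN K A F i).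
End AvPoint.

(* The group A(L) of L-rational points, with the action of Gal(L/K) on        *)
(* coordinates. In mathcomp (s * t)%g maps a to t (s a), so this is a right    *)
(* action, like the action of a matrix representation on row vectors.         *)
Section GaloisAction.
Variables (K : fieldExtType rat) (L : splittingFieldType K).
Variable A : abelianVariety K.

Definition mordell_weil := av_point A (in_alg L).
HB.instance Definition _ := GRing.Zmodule.on mordell_weil.

Variable s : gal_of {:L}.

Lemma gal_fix_base : s \o in_alg L =1 in_alg L.
Proof. by move=> k /=; rewrite linearZ rmorph1. Qed.

Definition gal_point (x : mordell_weil) : mordell_weil :=
  point_map gal_fix_base x.

Lemma gal_point_is_zmod_morphism : zmod_morphism gal_point.
Proof.
have D x y : gal_point (x + y) = gal_point x + gal_point y.
  apply: maps_to_inj (pt_addP _ _).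
  have := maps_to_map gal_fix_base (pt_addP (x : point A _) y).
  by rewrite map_row_mx.
move=> x y; apply: (addIr (gal_point y)); apply: etrans (esym (D _ _)) _.
by rewrite [RHS]subrK; congr gal_point; apply: subrK.
Qed.

HB.instance Definition _ := GRing.isZmodMorphism.Build mordell_weil mordell_weil
  gal_point gal_point_is_zmod_morphism.

(* The induced Q-linear action on A(L) (x) Q. *)
Definition gal_tensQ : tensQ mordell_weil -> tensQ mordell_weil :=
  tensQ_map gal_point.

Lemma gal_tensQE x q : gal_tensQ (tens x q) = tens (gal_point x) q.
Proof. exact: tensQ_map_tens. Qed.

End GaloisAction.

(* Main.v *)
(* By v |-> (v g^-1)_g the module V embeds in Q[G]^n, so it is enough to find  *)
(* A, L/K and Z-independent points of A(L) indexed by G x {1..n} that         *)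
(* Gal(L/K) = G permutes by translation of the first index. We take for A the *)
(* elliptic curve x^2 + y^2 = 1 + x^2 y^2 / 4 in Edwards form. A polynomial f *)
(* over Q of large prime degree m is chosen such that its Galois group is S_m *)
(* and each root r gives a point P_r with x = 6 r and y in Q(r). L is the     *)
(* splitting field of f, and K the fixed field of a copy of G in S_m.         *)
(* If sum_r N_r P_r = 0, applying the transposition (r s) and subtracting     *)
(* gives (N_r - N_s) (P_r - P_s) = 0. But P_r - P_s is not a torsion point    *)
(* unless r = s or r = -s, because twice it lies in the kernel of reduction   *)
(* modulo 3. So once N vanishes at one root it vanishes at all of them.       *)

Require Import Defs.
From HB Require Import structures.
From mathcomp Require Import all_boot all_order all_algebra all_fingroup.
From mathcomp Require Import all_solvable all_field all_character.
From mathcomp Require Import boolp mpoly zify ring lra.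
Import Order.TTheory GRing.Theory Num.Theory.
Set Implicit Arguments.
Unset Strict Implicit.
Unset Printing Implicit Defensive.

(** It suffices to find independent points [P (g, j)] that Gal(L/K) = G permutes by right
    translation of [g]: they span a free Q[G]-module into which the representation embeds
    ([orbit_map_inj], [orbit_map_equivariant]). The points live on one Edwards curve over Q and come
    from the roots of [sp_f k], of prime degree m with Galois group S_m; a root u gives a point with
    abscissa 6u and ordinate in Q(u).

    The full symmetric group is used twice. For m large it contains a copy of G acting by
    translations on the roots, whose fixed field is K ([gal_label_isom]). It also forces
    independence: a transposition turns a relation between the points into a torsion relation for
    one difference ([relation_swap], [points_free]). Such a torsion relation is excluded at 3: both
    points reduce to (0, 1) or (0, -1), so twice their difference lies in the kernel of reduction,
    which has no torsion ([formal_nontorsion], [torsion_diff]).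

    The group is S_m by [symmetric_galois_group]: [sp_f k] is irreducible by Eisenstein at 2
    ([sp_irr]), so the group is transitive, and complex conjugation is a transposition because
    exactly two roots are not real. Sign changes supply m - 2 real roots ([sp_real_roots]), and a
    violation of Laguerre's inequality supplies a nonreal one ([sp_nonreal]).

    That the curve is an abelian variety is checked by hand: irreducibility in [ed_irr], an addition
    defined everywhere by two formulas in [law12_neq0], and associativity in [qsum_assoc]. *)

(** * Permutation groups of prime degree, and Laguerre's inequality *)

Section TransitivePrimeDegree.
Variables (m : nat) (G : {group 'S_m}).

Lemma tperm_of_support (s : 'S_m) : s != 1%g -> (#|[set i | s i != i]| <= 2)%N ->
  exists a b, a != b /\ s = tperm a b.
Proof.
move=> s1 le2.
have [a sa] : exists a, s a != a.
  apply/existsP; apply: contraR s1 => /existsPn H; apply/eqP/permP => i.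
  by rewrite perm1; apply/eqP; have := H i; rewrite negbK.
exists a, (s a); rewrite eq_sym sa; split=> //.
have ssa : s (s a) != s a by rewrite (inj_eq perm_inj).
have supp : [set i | s i != i] = [set a; s a].
  apply/esym/eqP; rewrite eqEcard cards2 eq_sym sa le2 andbT.
  by apply/subsetP => i; rewrite !inE => /orP[] /eqP->.
have out i : i != a -> i != s a -> s i = i.
  move=> ia isa; apply/eqP; apply: contraT => si.
  have : i \in [set i | s i != i] by rewrite inE.
  by rewrite supp !inE (negPf ia) (negPf isa).
apply/permP => i; case: tpermP => [->|->|/eqP ia /eqP isa] //; last exact: out.
have : s (s a) \in [set i | s i != i] by rewrite inE (inj_eq perm_inj).
by rewrite supp !inE (negPf ssa) orbF => /eqP.
Qed.

(** Conjugation makes [R] an equivalence relation, and transitivity makes its classes equinumerous.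
    Their size divides the prime [m] and exceeds 1, so there is a single class: all transpositions
    lie in [G], and they generate. *)
Lemma transitive_prime_tperm : prime m ->
    (forall i j, exists2 s, s \in G & s i = j) ->
    (exists a b, a != b /\ tperm a b \in G) ->
  forall s : 'S_m, s \in G.
Proof.
move=> pm tr [a [b [ab abG]]].
pose R i j := tperm i j \in G.
have Rr i : R i i by rewrite /R tperm1 group1.
have Rs i j : R i j = R j i by rewrite /R tpermC.
have Rt i j k : R i j -> R j k -> R i k.
  rewrite /R => ij jk; have [->|ik] := eqVneq i k; first exact: Rr.
  have [ij'|ij'] := eqVneq i j; first by rewrite ij'.
  have : (tperm i j ^ tperm j k)%g \in G by rewrite groupJ.
  by rewrite tpermJ tpermL tpermD // eq_sym.
have Req : {in [set: 'I_m] & &, equivalence_rel R}.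
  move=> i j k _ _ _; split=> // ij; apply/idP/idP => h; last exact: Rt ij h.
  by apply: Rt h; rewrite Rs.
have RJ s i j : s \in G -> R (s i) (s j) = R i j.
  by move=> sG; rewrite /R -tpermJ memJ_norm // (subsetP (normG G)).
have part := equivalence_partitionP Req.
have size_cl i : #|[set j | R i j]| = #|[set j | R a j]|.
  have [s sG <-] := tr a i.
  rewrite -[RHS](card_imset _ (@perm_inj _ s)); apply: eq_card => j.
  rewrite inE; apply/idP/imsetP => [h|[k]].
    by exists ((s^-1)%g j); rewrite ?permKV // inE -(RJ s) // permKV.
  by rewrite inE => h ->; rewrite RJ.
have /card_uniform_partition : {in equivalence_partition R [set: 'I_m], forall A : {set 'I_m}, #|A| = #|[set j | R a j]|}.
  move=> A /imsetP[i _ ->]; rewrite -(size_cl i); apply: eq_card => j.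
  by rewrite !inE.
move=> /(_ _ part); rewrite cardsT card_ord => mE.
have : (#|[set j | R a j]| %| m)%N by rewrite [X in (_ %| X)%N]mE dvdn_mull.
have lt1 : (1 < #|[set j | R a j]|)%N.
  rewrite (cardD1 a) inE Rr (cardD1 b) !inE eq_sym ab /=.
  by rewrite /R abG.
case/primeP: pm => _ /[apply] /orP[] /eqP cE; first by rewrite cE in lt1.
have all_a : [set j | R a j] = [set: 'I_m].
  by apply/eqP; rewrite eqEcard subsetT /= cardsT card_ord cE leqnn.
have all_t i j : tperm i j \in G.
  have Ra k : R a k by have := in_setT k; rewrite -all_a inE.
  by apply: (Rt i a j) => //; rewrite Rs.
move=> s; have [ts -> _] := prod_tpermP s.
by apply: group_prod => t _; apply: all_t.
Qed.

End TransitivePrimeDegree.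

Local Open Scope ring_scope.

(** Induction on the roots: a new factor X - z replaces the expression by (x - z)^2 times the old
    one plus p(x)^2. The reality of p(x) is carried along to make that square nonnegative. *)
Lemma laguerre (s : seq algC) (x : algC) : all (fun z => z \is Num.real) s -> x \is Num.real ->
  let p := \prod_(z <- s) ('X - z%:P) in
  0 <= p^`().[x] ^+ 2 - p.[x] * p^`()^`().[x].
Proof.
move=> sR xR /=; set p := \prod_(z <- s) _.
suff [] : 0 <= p^`().[x] ^+ 2 - p.[x] * p^`()^`().[x] /\ p.[x] \is Num.real by [].
rewrite {}/p; elim: s sR => [_|z s IH /= /andP[zR /IH{IH}[]]].
  by rewrite big_nil -polyC1 derivC deriv0 !hornerC mulr0 expr0n subrr lexx rpred1.
rewrite big_cons; set p := \prod_(z <- s) _ => IH pR.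
have xzR : x - z \is Num.real by rewrite rpredB.
split; last by rewrite hornerM !hornerE rpredM.
have d1 : (('X - z%:P) * p)^`() = p + ('X - z%:P) * p^`().
  by rewrite derivM derivXsubC mul1r.
have d2 : (p + ('X - z%:P) * p^`())^`() = p^`() *+ 2 + ('X - z%:P) * p^`()^`().
  by rewrite derivD derivM derivXsubC mul1r addrA -mulr2n.
rewrite d1 d2 !(hornerD, hornerM, hornerMn, hornerN, hornerX, hornerC).
rewrite (_ : _ - _ = (x - z) ^+ 2 * (p^`().[x] ^+ 2 - p.[x] * p^`()^`().[x]) + p.[x] ^+ 2); last by ring.
by apply: addr_ge0; [apply: mulr_ge0 => // |]; apply: real_exprn_even_ge0.
Qed.

(** * The group law on quadruples of coordinates *)

Notation quad F := (F * F * F * F)%type.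

Section QuadOps.
Variable R : comNzRingType.
Implicit Types (p q : quad R).

Definition q0 : quad R := (0, 0, 0, 0).
Definition qO : quad R := (0, 1, 1, 0).

(* In the coordinates (2 x : 2 y : 2 : x y) on x^2 + y^2 = 1 + x^2 y^2 / 4,   *)
(* qtau is (x, y) |-> (2 / x, 2 / y), the translation by a point at infinity, *)
(* and law1, law2 are Edwards' addition and its conjugate under it; they have *)
(* no common exceptional pair of points.                                      *)
Definition qtau p : quad R := let: (x, y, z, t) := p in (y, x, t, z).
Definition qopp p : quad R := let: (x, y, z, t) := p in (- x, y, z, - t).

Definition law1 p q : quad R :=
  let: (x, y, z, t) := p in let: (x', y', z', t') := q in
  let a := x * y' + y * x' in let b := y * y' - x * x' in
  let c := z * z' + t * t' in let d := z * z' - t * t' in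
  (2 * a * d, 2 * b * c, 2 * c * d, a * b).
Definition law2 p q := qtau (law1 (qtau p) q).

Definition eqn1 p : R := let: (x, y, z, t) := p in x ^+ 2 + y ^+ 2 - (z ^+ 2 + t ^+ 2).
Definition eqn2 p : R := let: (x, y, z, t) := p in x * y - 2 * z * t.

End QuadOps.
Arguments q0 {R}.
Arguments qO {R}.

Section EdwardsQuads.
Variable F : fieldType.
Implicit Types (p q r s t w : quad F) (k l : F).

Definition qscale k p : quad F :=
  let: (x, y, z, t) := p in (k * x, k * y, k * z, k * t).
(** All 2x2 minors vanish. Since [q0] is parallel to everything, transitivity holds only through a
    nonzero middle term. *)
Definition qpar p q : Prop :=
  let: (x, y, z, t) := p in let: (x', y', z', t') := q in
  [/\ [/\ x * y' = x' * y, x * z' = x' * z & x * t' = x' * t],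
      y * z' = y' * z, y * t' = y' * t & z * t' = z' * t].

Definition eqnE p : Prop :=
  let: (x, y, z, t) := p in x ^+ 2 + y ^+ 2 = z ^+ 2 + t ^+ 2 /\ x * y = 2 * z * t.
Definition onE p := p != q0 /\ eqnE p.

Definition affq (x y : F) : quad F := (2 * x, 2 * y, 2, x * y).

(** Addition as a relation between homogeneous representatives: either law may vanish at the pair,
    but not both. This is what [maps_to] says for the family [ed_add]. *)
Definition qsum p q r : Prop :=
  [/\ onE r, qpar (law1 p q) r, qpar (law2 p q) r &
      law1 p q != q0 \/ law2 p q != q0].

Lemma quadI (x y z t x' y' z' t' : F) :
  x = x' -> y = y' -> z = z' -> t = t' -> (x, y, z, t) = (x', y', z', t').
Proof. by move=> -> -> -> ->. Qed.

Lemma qscale1 p : qscale 1 p = p.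
Proof. by case: p => [[[x y] z] t] /=; rewrite !mul1r. Qed.

Lemma qscale_eq0 k p : k != 0 -> (qscale k p == q0) = (p == q0).
Proof.
by case: p => [[[x y] z] t] k0; rewrite /= -!pair_eqE /= -!pair_eqE /= -!pair_eqE /= !mulf_eq0 (negPf k0).
Qed.

Lemma qtauK : involutive (@qtau F). Proof. by case=> [[[x y] z] t]. Qed.

Lemma qtau_eq0 p : (qtau p == q0) = (p == q0).
Proof. by rewrite -[X in qtau p == X]/(qtau (q0 : quad F)) (inj_eq (inv_inj qtauK)). Qed.

Lemma qpar_refl p : qpar p p.
Proof. by case: p => [[[x y] z] t] /=. Qed.

Lemma qpar_sym p q : qpar p q -> qpar q p.
Proof.
by case: p q => [[[x y] z] t] [[[x' y'] z'] t'] /= [[-> -> ->] -> -> ->].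
Qed.

Lemma qpar_scale k p q : k != 0 -> qpar (qscale k p) q <-> qpar p q.
Proof.
case: p q => [[[x y] z] t] [[[x' y'] z'] t'] k0 /=.
have E u v u' v' : k * u * v' = u' * (k * v) <-> u * v' = u' * v.
  by rewrite -mulrA [u' * _]mulrCA; split=> [/(mulfI k0)|->].
by split=> -[[/E h1 /E h2 /E h3] /E h4 /E h5 /E h6].
Qed.

Lemma qpar_scaler k p : qpar (qscale k p) p.
Proof. by case: p => [[[x y] z] t] /=; do !split; ring. Qed.

Lemma qparP p q : q != q0 -> qpar p q -> exists k, p = qscale k q.
Proof.
case: p q => [[[x y] z] t] [[[x' y'] z'] t'] qn [[h1 h2 h3] h4 h5 h6].
have [x0|x0] := eqVneq x' 0; last first.
  by exists (x / x') => /=; apply: quadI; apply: (mulfI x0); rewrite -?h1 -?h2 -?h3; field.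
have [y0|y0] := eqVneq y' 0; last first.
  by exists (y / y') => /=; apply: quadI; apply: (mulfI y0); rewrite -?h4 -?h5 1?mulrC ?h1; field.
have [z0|z0] := eqVneq z' 0; last first.
  exists (z / z') => /=; apply: quadI; apply: (mulfI z0); rewrite -?h6; try by field.
    by rewrite mulrC h2; field.
  by rewrite mulrC h4; field.
have t0 : t' != 0.
  by apply: contraNneq qn => ->; rewrite x0 y0 z0.
exists (t / t') => /=; apply: quadI; apply: (mulfI t0); try by field.
- by rewrite mulrC h3; field.
- by rewrite mulrC h5; field.
- by rewrite mulrC h6; field.
Qed.

Lemma qparP0 p q : p != q0 -> q != q0 -> qpar p q ->
  exists2 k, k != 0 & p = qscale k q.
Proof.
move=> p0 q0 /(qparP q0)[k kE]; exists k => //.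
by apply: contra_neq p0 => k0; rewrite kE k0; case: (q) => [[[x y] z] t] /=; rewrite !mul0r.
Qed.

Lemma qpar_trans q p r : q != q0 -> qpar p q -> qpar q r -> qpar p r.
Proof.
move=> qn /(qparP qn)[k ->] qr; have [->|k0] := eqVneq k 0; last exact/qpar_scale.
by case: (q) r {qn qr} => [[[x y] z] t] [[[x' y'] z'] t'] /=; do !split; ring.
Qed.

Lemma onE_scale k p : k != 0 -> onE (qscale k p) <-> onE p.
Proof.
move=> k0; rewrite /onE qscale_eq0 //; case: p => [[[x y] z] t] /=.
have k2 : k ^+ 2 != 0 by rewrite expf_neq0.
split=> -[pn [e1 e2]]; split=> //; split.
- by apply: (mulfI k2); rewrite !mulrDr -!exprMn.
- by apply: (mulfI k2); transitivity (k * x * (k * y)); [ring | rewrite e2; ring].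
- by rewrite !exprMn -!mulrDr e1.
- by transitivity (k ^+ 2 * (x * y)); [ring | rewrite e2; ring].
Qed.

Lemma qtau_onE p : onE p -> onE (qtau p).
Proof.
case=> pn pE; split; first by rewrite qtau_eq0.
case: p pE {pn} => [[[x y] z] t] /= [e1 e2]; split; first by rewrite addrC e1 addrC.
by rewrite mulrC e2; ring.
Qed.

Lemma qopp_onE p : onE p -> onE (qopp p).
Proof.
case=> pn pE; split; last first.
  case: p pE {pn} => [[[x y] z] t] /= [e1 e2]; split; first by rewrite !sqrrN.
  by rewrite mulNr e2; ring.
apply: contra_neq pn; case: p {pE} => [[[x y] z] t] [] /eqP.
by rewrite oppr_eq0 => /eqP-> -> -> /eqP; rewrite oppr_eq0 => /eqP->.
Qed.

Lemma qpar_tau p q : qpar (qtau p) (qtau q) <-> qpar p q.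
Proof.
have H p' q' : qpar p' q' -> qpar (qtau p') (qtau q').
  case: p' q' => [[[x y] z] t] [[[x' y'] z'] t'] /= [[h1 h2 h3] h4 h5 h6].
  by do !split; rewrite // mulrC -?h1 -?h6 mulrC.
by split=> /H //; rewrite !qtauK.
Qed.

Lemma qscale_tau k p : qtau (qscale k p) = qscale k (qtau p).
Proof. by case: p => [[[x y] z] t]. Qed.

Lemma law1_scale k l p q : law1 (qscale k p) (qscale l q) = qscale ((k * l) ^+ 2) (law1 p q).
Proof.
by case: p q => [[[x y] z] t] [[[x' y'] z'] t'] /=; apply: quadI; ring.
Qed.

Lemma law2_scale k l p q : law2 (qscale k p) (qscale l q) = qscale ((k * l) ^+ 2) (law2 p q).
Proof. by rewrite /law2 qscale_tau law1_scale qscale_tau. Qed.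

Lemma law1C p q : law1 p q = law1 q p.
Proof.
by case: p q => [[[x y] z] t] [[[x' y'] z'] t'] /=; apply: quadI; ring.
Qed.

Lemma law2C p q : law2 p q = qscale (- 1) (law2 q p).
Proof.
by case: p q => [[[x y] z] t] [[[x' y'] z'] t'] /=; apply: quadI; ring.
Qed.

Lemma qsum_scale k l p q r : k != 0 -> l != 0 ->
  qsum (qscale k p) (qscale l q) r <-> qsum p q r.
Proof.
move=> k0 l0; have kl : (k * l) ^+ 2 != 0 by rewrite expf_neq0 // mulf_neq0.
rewrite /qsum law1_scale law2_scale !qscale_eq0 //.
by split=> -[? /(qpar_scale _ _ kl) ? /(qpar_scale _ _ kl) ? ?]; split.
Qed.

Lemma qsum_scaler k p q r : k != 0 -> qsum p q (qscale k r) <-> qsum p q r.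
Proof.
move=> k0; rewrite /qsum; split=> -[/(onE_scale _ k0) h1 h2 h3 h4]; split=> //;
  by apply: qpar_sym; apply/(qpar_scale _ _ k0); apply: qpar_sym.
Qed.

Lemma qsumC p q r : qsum p q r -> qsum q p r.
Proof.
have n1 : -1 != 0 :> F by rewrite oppr_eq0 oner_eq0.
case=> h1 h2 h3 h4; split; rewrite ?[law1 q p]law1C ?[law2 q p]law2C ?qscale_eq0 //.
exact/qpar_scale.
Qed.

(** Applying [qtau] to the first argument exchanges the two laws up to [qtau] on the result, as it
    should for a translation. *)
Lemma qsum_tau p q r : qsum p q r -> qsum (qtau p) q (qtau r).
Proof.
case=> h1 h2 h3 h4; split; first exact: qtau_onE.
- by apply/qpar_tau; rewrite qtauK -/(law2 p q).
- by rewrite /law2 qtauK; apply/qpar_tau.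
- by rewrite /law2 qtauK qtau_eq0 -[law1 (qtau p) q]qtauK qtau_eq0; case: h4; [right | left].
Qed.

Hypotheses (h2 : 2 != 0 :> F) (h3 : 3 != 0 :> F).

(* The two equations and the S-polynomial completing them to a Groebner basis. *)
Lemma eqnE_gb (x y z t : F) : eqnE (x, y, z, t) ->
  [/\ x * y = 2 * z * t, x ^+ 2 = z ^+ 2 + t ^+ 2 - y ^+ 2 &
      y ^+ 3 = y * z ^+ 2 + y * t ^+ 2 - 2 * x * z * t].
Proof.
move=> [e1 e2]; have e3 : x ^+ 2 = z ^+ 2 + t ^+ 2 - y ^+ 2 by rewrite -e1 addrK.
split=> //; transitivity (y * (z ^+ 2 + t ^+ 2 - x ^+ 2)); first by rewrite -e1; ring.
by transitivity (y * z ^+ 2 + y * t ^+ 2 - x * (x * y)); [ring | rewrite e2; ring].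
Qed.

Lemma onE_zt (z t x y : F) : onE (x, y, z, t) -> ~ (z = 0 /\ t = 0).
Proof.
move=> [pn [e1 e2]] [z0 t0]; move: e1 e2; rewrite z0 t0 expr0n addr0 mulr0 => e1 /eqP.
rewrite mulf_eq0 => /orP[] /eqP h; move: e1; rewrite h expr0n ?add0r ?addr0 => /eqP.
  by rewrite expf_eq0 /= => /eqP y0; move: pn; rewrite h z0 t0 y0 eqxx.
by rewrite expf_eq0 /= => /eqP x0; move: pn; rewrite h z0 t0 x0 eqxx.
Qed.

Lemma onE_xy (x y z t : F) : onE (x, y, z, t) -> ~ (x = 0 /\ y = 0).
Proof.
move=> [pn [e1 e2]] [x0 y0]; move/eqP: e2; move: e1.
rewrite x0 y0 expr0n addr0 mulr0 => e1; rewrite eq_sym -mulrA mulf_eq0 (negPf h2) /= mulf_eq0.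
case/orP=> /eqP h; move: e1; rewrite h expr0n ?add0r ?addr0 => /esym/eqP;
  rewrite expf_eq0 /= => /eqP h'; move: pn; by rewrite x0 y0 h h' eqxx.
Qed.

(** Under both equalities the square of the second equation reads z^4 = 4 z^4, so z = t = 0 outside
    characteristic 3, against [onE_zt]. *)
Lemma onE_diag (x y z t : F) : onE (x, y, z, t) -> x ^+ 2 = y ^+ 2 -> z ^+ 2 <> t ^+ 2.
Proof.
move=> pE; have [_ [e1 e2]] := pE => xy zt.
have xz : x ^+ 2 = z ^+ 2.
  by apply: (mulfI h2); rewrite !mulr_natl !mulr2n {2}xy e1 -zt.
have : (x * y) ^+ 2 = (2 * z * t) ^+ 2 by rewrite e2.
rewrite !exprMn -xy -zt xz => e.
have z0 : z = 0.
  have : 3 * z ^+ 4 = 0 by transitivity (2 ^+ 2 * z ^+ 2 * z ^+ 2 - z ^+ 2 * z ^+ 2); [ring | rewrite -e subrr].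
  by move/eqP; rewrite mulf_eq0 (negPf h3) expf_eq0 => /eqP.
apply: (onE_zt pE); split=> //; apply/eqP.
by rewrite -sqrf_eq0 -zt z0 expr0n.
Qed.

Lemma law1_eq0 (x y z t x' y' z' t' : F) : law1 (x, y, z, t) (x', y', z', t') = q0 ->
  (x * y' + y * x' = 0 /\ z * z' + t * t' = 0) \/
  (y * y' - x * x' = 0 /\ z * z' - t * t' = 0).
Proof.
move=> /= [] /eqP; rewrite !mulf_eq0 !(negPf h2) /= => h1 /eqP; rewrite !mulf_eq0 (negPf h2) /= => h2' /eqP.
rewrite !mulf_eq0 (negPf h2) /= => h3' /eqP; rewrite mulf_eq0 => h4.
have [hc|hc] := eqVneq (z * z' + t * t') 0; last first.
  move: h2' h3'; rewrite (negPf hc) orbF /= => /eqP hb /eqP hd.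
  by right.
have [ha|ha] := eqVneq (x * y' + y * x') 0; first by left.
by move: h1 h4; rewrite (negPf ha) /= => /eqP hd /eqP hb; right.
Qed.

(** By [law1_eq0], a common zero satisfies four bilinear equations. In the two unmixed cases they
    force equal squares, against [onE_diag]; in the two mixed cases z^2 + t^2 = 0 at both points, so
    that x and y are nonzero there while some of their products vanish. *)
Lemma law12_neq0 p q : onE p -> onE q -> law1 p q != q0 \/ law2 p q != q0.
Proof.
case: p q => [[[x y] z] t] [[[x' y'] z'] t'] pE qE.
have [l1|] := eqVneq (law1 _ _) q0; [right | by left].
apply/eqP => l2.
have {}l2 : law1 (y, x, t, z) (x', y', z', t') = q0.
  by apply/eqP; rewrite -qtau_eq0; apply/eqP.
have P0 := onE_xy pE; have Q0 := onE_xy qE; have P1 := onE_zt pE; have Q1 := onE_zt qE.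
have Pd := onE_diag pE; have Qd := onE_diag qE.
have [[_ [ep _]] [_ [eq _]]] := (pE, qE).
(* As a linear system in [c, d] this has determinant a^2 - b^2 up to sign, and symmetrically in
   [a, b]; in [fac'] the determinants are sums of two squares. *)
have fac (a b c d : F) : a * c + b * d = 0 -> a * d + b * c = 0 ->
    [\/ a = 0 /\ b = 0, c = 0 /\ d = 0 | a ^+ 2 = b ^+ 2 /\ c ^+ 2 = d ^+ 2].
  move=> e1 e2.
  have /eqP : (a ^+ 2 - b ^+ 2) * c = 0.
    by transitivity (a * (a * c + b * d) - b * (a * d + b * c)); [ring | rewrite e1 e2; ring].
  have /eqP : (a ^+ 2 - b ^+ 2) * d = 0.
    by transitivity (a * (a * d + b * c) - b * (a * c + b * d)); [ring | rewrite e1 e2; ring].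
  have /eqP : (c ^+ 2 - d ^+ 2) * a = 0.
    by transitivity (c * (a * c + b * d) - d * (a * d + b * c)); [ring | rewrite e1 e2; ring].
  have /eqP : (c ^+ 2 - d ^+ 2) * b = 0.
    by transitivity (c * (a * d + b * c) - d * (a * c + b * d)); [ring | rewrite e1 e2; ring].
  rewrite !mulf_eq0; have [/eqP ab|ab /=] := boolP (a ^+ 2 - b ^+ 2 == 0); last first.
    by move=> _ _ /eqP-> /eqP->; constructor 2.
  have [/eqP cd|cd /=] := boolP (c ^+ 2 - d ^+ 2 == 0).
    by move=> _ _ _ _; constructor 3; split; apply/eqP; rewrite -subr_eq0; apply/eqP.
  by move=> /eqP-> /eqP->; constructor 1.
have fac' (a b c d : F) : a * c + b * d = 0 -> a * d = b * c ->
    [\/ a = 0 /\ b = 0, c = 0 /\ d = 0 | a ^+ 2 + b ^+ 2 = 0 /\ c ^+ 2 + d ^+ 2 = 0].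
  move=> e1 e2.
  have /eqP : (a ^+ 2 + b ^+ 2) * c = 0.
    by transitivity (a * (a * c + b * d) - b * (a * d - b * c)); [ring | rewrite e1 e2; ring].
  have /eqP : (a ^+ 2 + b ^+ 2) * d = 0.
    by transitivity (a * (a * d - b * c) + b * (a * c + b * d)); [ring | rewrite e1 e2; ring].
  have /eqP : (c ^+ 2 + d ^+ 2) * a = 0.
    by transitivity (c * (a * c + b * d) + d * (a * d - b * c)); [ring | rewrite e1 e2; ring].
  rewrite !mulf_eq0; have [/eqP ab|ab /=] := boolP (a ^+ 2 + b ^+ 2 == 0); last first.
    by move=> _ /eqP-> /eqP->; constructor 2.
  have [/eqP cd|cd /=] := boolP (c ^+ 2 + d ^+ 2 == 0).
    by move=> _ _ _; constructor 3.
  move=> /eqP a0 _ _; move: ab; rewrite a0 expr0n add0r => /eqP.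
  by rewrite expf_eq0 => /eqP b0; constructor 1.
have pm (a b : F) : b + a = 0 -> b - a = 0 -> a = 0 /\ b = 0.
  move=> e1 e2; have b0 : b = 0 by apply: (mulfI h2); transitivity ((b + a) + (b - a)); [ring | rewrite e1 e2; ring].
  by split=> //; move: e1; rewrite b0 add0r.
have nz (a b c d : F) : onE (a, b, c, d) -> c ^+ 2 + d ^+ 2 = 0 -> a != 0 /\ b != 0.
  move=> rE cd; have [_ [_ e]] := rE; apply/andP; rewrite -negb_or -mulf_eq0 e -mulrA mulf_eq0 (negPf h2) /= mulf_eq0.
  apply/negP => /orP[] /eqP h; move: cd; rewrite h expr0n ?add0r ?addr0 => /eqP;
    by rewrite expf_eq0 /= => /eqP h'; apply: (onE_zt rE).
case: (law1_eq0 l1) (law1_eq0 l2) => -[e1 e2] [[e3 e4]|[e3 e4]].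
- case: (fac x y y' x' e1) => [|//|[? ?]|[xy _]]; [by rewrite addrC | exact: Q0 |].
  by case: (fac z t z' t' e2) => [|//|//|[zt _]]; [rewrite addrC | apply: Pd xy zt].
- case: (fac' z t z' t' e2) => [|//|//|[zt zt']]; first by apply/eqP; rewrite eq_sym -subr_eq0 e4.
  have [x0 _] := nz _ _ _ _ pE zt; have [_ y0] := nz _ _ _ _ qE zt'.
  have [_ /eqP] : y * x' = 0 /\ x * y' = 0 by apply: pm.
  by rewrite mulf_eq0 (negPf x0) (negPf y0).
- case: (fac' z t z' (- t')) => [||//|[? /eqP]|[zt]]; rewrite ?mulrN ?e2 //.
  + by apply/eqP; rewrite eq_sym -subr_eq0 opprK e4.
  + by rewrite oppr_eq0 => /eqP ?; apply: Q1.
  rewrite sqrrN => zt'; have [x0 _] := nz _ _ _ _ pE zt; have [x'0 _] := nz _ _ _ _ qE zt'.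
  have [/eqP] : x * x' = 0 /\ y * y' = 0 by apply: pm; rewrite // addrC.
  by rewrite mulf_eq0 (negPf x0) (negPf x'0).
- case: (fac x y y' (- x')) => [||//|[? /eqP]|[xy _]]; rewrite ?mulrN //.
  + by rewrite addrC e1.
  + by rewrite oppr_eq0 => /eqP ?; apply: Q0.
  case: (fac z t z' (- t')) => [||//|[? /eqP]|[zt _]]; rewrite ?mulrN ?e2 //.
  + by rewrite addrC e4.
  + by rewrite oppr_eq0 => /eqP ?; apply: Q1.
  exact: Pd xy zt.
Qed.

Lemma law1_eqn p q : eqnE p -> eqnE q -> eqnE (law1 p q).
Proof.
case: p q => [[[x y] z] t] [[[x' y'] z'] t'] /eqnE_gb[a1 a2 a3] /eqnE_gb[b1 b2 b3].
(* The second equation is an identity in a, b, c, d of [law1]; the first holds only modulo the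
   equations of the two points, by comparison of normal forms. *)
split; last by ring.
ring: a1 a2 a3 b1 b2 b3.
Qed.

Lemma law2_eqn p q : eqnE p -> eqnE q -> eqnE (law2 p q).
Proof.
have T r : eqnE r -> eqnE (qtau r).
  case: r => [[[x y] z] t] /= [e1 e2]; split; first by rewrite addrC e1 addrC.
  by rewrite mulrC e2; ring.
by move=> pE qE; apply/T/law1_eqn => //; apply: T.
Qed.

Lemma law12_par p q : eqnE p -> eqnE q -> qpar (law1 p q) (law2 p q).
Proof.
case: p q => [[[x y] z] t] [[[x' y'] z'] t'] /eqnE_gb[a1 a2 a3] /eqnE_gb[b1 b2 b3].
by rewrite /=; do !split; ring: a1 a2 a3 b1 b2 b3.
Qed.

Lemma qsum_ex p q : onE p -> onE q -> exists r, qsum p q r.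
Proof.
move=> pE qE; have [[_ pe] [_ qe]] := (pE, qE); have := law12_neq0 pE qE.
have [l1 [//|l2]|l1 l12] := eqVneq (law1 p q) q0.
  exists (law2 p q); split; last by right.
  - by split=> //; apply: law2_eqn.
  - exact: law12_par.
  - exact: qpar_refl.
exists (law1 p q); split=> //.
- by split=> //; apply: law1_eqn.
- exact: qpar_refl.
- by apply/qpar_sym/law12_par.
- by left.
Qed.

Lemma qsumO p : onE p -> qsum qO p p.
Proof.
move=> pE; have [_ pe] := pE; split=> //; last first.
- apply: law12_neq0 => //; split; last by split; ring.
  by apply/eqP => -[_ /eqP]; rewrite oner_eq0.
- case: p {pE} pe => [[[x y] z] t] /eqnE_gb[a1 a2 a3].
  by rewrite /=; do !split; ring: a1 a2 a3.
- case: p {pE} pe => [[[x y] z] t] /eqnE_gb[a1 a2 a3].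
  by rewrite /=; do !split; ring: a1 a2 a3.
Qed.

Lemma onE_O : onE qO.
Proof. by split; [apply/eqP => -[_ /eqP]; rewrite oner_eq0 | split; ring]. Qed.

Lemma qsumN p : onE p -> qsum (qopp p) p qO.
Proof.
move=> pE; have [_ pe] := pE; split; first exact: onE_O.
- case: p {pE} pe => [[[x y] z] t] /eqnE_gb[a1 a2 a3].
  by rewrite /=; do !split; ring: a1 a2 a3.
- case: p {pE} pe => [[[x y] z] t] /eqnE_gb[a1 a2 a3].
  by rewrite /=; do !split; ring: a1 a2 a3.
- by apply: law12_neq0 => //; apply: qopp_onE.
Qed.

(** Sums are determined only up to scaling, so all the intermediate representatives are quantified
    universally. *)
Definition qassoc p q w := forall r t s s',
  qsum p q r -> qsum r w s -> qsum q w t -> qsum p t s' -> qpar s s'.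

Lemma qassoc_sym p q w : qassoc p q w -> qassoc w q p.
Proof.
move=> H r t s s' rE sE tE s'E.
by apply/qpar_sym/(H t r); apply: qsumC.
Qed.

Lemma qassoc_tau1 p q w : qassoc (qtau p) q w -> qassoc p q w.
Proof.
move=> H r t s s' rE sE tE s'E; apply/qpar_tau.
by apply: (H (qtau r) t) => //; apply: qsum_tau.
Qed.

(** Both inner sums use [law1]; [qsum_assoc] reduces to this situation. Each choice of outer laws is
    a polynomial identity modulo the equations of the three points. *)
Lemma qassoc_laws (i j : bool) p q w : eqnE p -> eqnE q -> eqnE w ->
  qpar ((if i then @law1 F else @law2 F) (law1 p q) w) ((if j then @law1 F else @law2 F) p (law1 q w)).
Proof.
case: p q w => [[[x y] z] t] [[[x' y'] z'] t'] [[[x2 y2] z2] t2].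
move=> /eqnE_gb[a1 a2 a3] /eqnE_gb[b1 b2 b3] /eqnE_gb[c1 c2 c3].
by case: i j => [] []; rewrite /=; do !split; ring: a1 a2 a3 b1 b2 b3 c1 c2 c3.
Qed.

Lemma qsumP p q r : qsum p q r -> law1 p q != q0 ->
  exists2 k, k != 0 & r = qscale k (law1 p q).
Proof. by case=> -[rn _] /qpar_sym r1 _ _ l1; apply: qparP0. Qed.

Lemma qsum_law p q r : qsum p q r ->
  exists2 i : bool, (if i then @law1 F else @law2 F) p q != q0 &
    qpar ((if i then @law1 F else @law2 F) p q) r.
Proof. by case=> _ l1 l2 [n|n]; [exists true | exists false]. Qed.

(** If [law1] vanishes at an inner pair, [law2] does not, which means that [law1] is nonzero once
    the outer point of that pair is replaced by its image under [qtau]. By [qsum_tau] this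
    replacement only translates both sides. *)
Lemma qsum_assoc p q w : onE p -> onE q -> onE w -> qassoc p q w.
Proof.
have main p' q' w' : onE p' -> onE q' -> onE w' ->
    law1 p' q' != q0 -> law1 q' w' != q0 -> qassoc p' q' w'.
  move=> [_ pE] [_ qE] [_ wE] n1 n2 r t s s' rE sE tE s'E.
  have [k k0 rk] := qsumP rE n1; have [l l0 tl] := qsumP tE n2.
  move: sE; rewrite rk -[w']qscale1 => /(qsum_scale _ _ _ k0 (oner_neq0 _)) /qsum_law[i ni si].
  move: s'E; rewrite tl -[p']qscale1 => /(qsum_scale _ _ _ (oner_neq0 _) l0) /qsum_law[j nj s'j].
  apply: (qpar_trans ni (qpar_sym si)); apply: (qpar_trans nj) s'j.
  exact: qassoc_laws.
have main2 p' q' w' : onE p' -> onE q' -> onE w' -> law1 p' q' != q0 -> qassoc p' q' w'.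
  move=> pE qE wE n1; have := law12_neq0 wE qE; rewrite law1C.
  have [_ [//|n2]|n2 _] := eqVneq (law1 q' w') q0; last exact: main.
  apply/qassoc_sym/qassoc_tau1/qassoc_sym/main => //; first exact: qtau_onE.
  by rewrite law1C -qtau_eq0.
move=> pE qE wE; have [n1|n2] := law12_neq0 pE qE; first exact: main2.
apply/qassoc_tau1/main2 => //; first exact: qtau_onE.
by rewrite -qtau_eq0.
Qed.

End EdwardsQuads.

(** * The Edwards curve as an abelian variety *)

Section QuadRows.
Variable R : nzRingType.
Definition rowq (p : quad R) : 'rV[R]_4 :=
  \row_j nth 0 [:: p.1.1.1; p.1.1.2; p.1.2; p.2] j.
Definition quadr (u : 'rV[R]_4) : quad R :=
  (u 0 (inord 0), u 0 (inord 1), u 0 (inord 2), u 0 (inord 3)).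

Lemma rowqK : cancel rowq quadr.
Proof. by case=> [[[x y] z] t]; rewrite /quadr !mxE !inordK. Qed.

Lemma quadrK : cancel quadr rowq.
Proof.
move=> u; apply/rowP => j; rewrite mxE.
by case: j => -[|[|[|[|//]]]] lt /=; congr (u 0 _); apply: val_inj; rewrite /= inordK.
Qed.

Lemma rowq_eq0 p : (rowq p == 0) = (p == (0, 0, 0, 0)).
Proof.
rewrite -(inj_eq (can_inj rowqK)); congr (_ == _).
by apply/rowP => j; rewrite !mxE; case: j => -[|[|[|[|//]]]].
Qed.

End QuadRows.

Definition qmap (R S : Type) (f : R -> S) (p : R * R * R * R) : S * S * S * S :=
  let: (x, y, z, t) := p in (f x, f y, f z, f t).

Lemma rowq_map (R S : nzRingType) (f : {rmorphism R -> S}) (p : quad R) :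
  rowq (qmap f p) = map_mx f (rowq p).
Proof.
case: p => [[[x y] z] t]; apply/rowP => j; rewrite !mxE.
by case: j => -[|[|[|[|//]]]].
Qed.

Lemma qmap_law1 (R S : comNzRingType) (f : {rmorphism R -> S}) (p q : quad R) :
  qmap f (law1 p q) = law1 (qmap f p) (qmap f q).
Proof.
case: p q => [[[x y] z] t] [[[x' y'] z'] t'] /=.
by rewrite !(rmorphM, rmorphB, rmorphD, rmorph1).
Qed.

Lemma qmap_tau (R S : comNzRingType) (f : R -> S) (p : quad R) :
  qmap f (qtau p) = qtau (qmap f p).
Proof. by case: p => [[[x y] z] t]. Qed.

Lemma qmap_law2 (R S : comNzRingType) (f : {rmorphism R -> S}) (p q : quad R) :
  qmap f (law2 p q) = law2 (qmap f p) (qmap f q).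
Proof. by rewrite /law2 !(qmap_tau f) qmap_law1 qmap_tau. Qed.

Lemma rowq_scale (F : fieldType) (k : F) (p : quad F) : rowq (qscale k p) = k *: rowq p.
Proof.
case: p => [[[x y] z] t]; apply/rowP => j; rewrite !mxE.
by case: j => -[|[|[|[|//]]]].
Qed.

Lemma qpar_sub (F : fieldType) (p q : quad F) : q != q0 ->
  qpar p q <-> (rowq p <= rowq q)%MS.
Proof.
move=> qn; split=> [/(qparP qn)[k ->]|/sub_rVP[k]].
  by rewrite rowq_scale scalemx_sub.
by rewrite -rowq_scale => /(can_inj (@rowqK _)) ->; apply: qpar_scaler.
Qed.

(** * Bihomogeneous polynomials *)

Section BihomogClosed.
Variables (K : fieldType) (n : nat).
Implicit Types p q : {mpoly K[n + n]}.

Lemma bihomogP a b p :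
  reflect (forall m, m \in msupp p -> (\sum_(k < n) m (lshift n k) = a)%N /\
                       (\sum_(k < n) m (rshift n k) = b)%N) (bihomog a b p).
Proof.
apply: (iffP allP) => H m /H; first by case/andP=> /eqP-> /eqP->.
by case=> -> ->; rewrite !eqxx.
Qed.

Lemma bihomogD a b p q : bihomog a b p -> bihomog a b q -> bihomog a b (p + q).
Proof.
move=> /bihomogP Hp /bihomogP Hq; apply/bihomogP => m /msuppD_le.
by rewrite mem_cat => /orP[/Hp|/Hq].
Qed.

Lemma bihomogN a b p : bihomog a b p -> bihomog a b (- p).
Proof.
by move=> /bihomogP Hp; apply/bihomogP => m; rewrite (perm_mem (msuppN p)) => /Hp.
Qed.

Lemma bihomogM a b c d p q : bihomog a b p -> bihomog c d q ->
  bihomog (a + c) (b + d) (p * q).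
Proof.
move=> /bihomogP Hp /bihomogP Hq; apply/bihomogP => m /msuppM_le/allpairsP.
case=> -[m1 m2] [/Hp[<- <-] /Hq[<- <-] ->]; rewrite -!big_split /=.
by split; apply: eq_bigr => k _; rewrite mnmDE.
Qed.

Lemma bihomog_nat k : bihomog 0 0 (k%:R : {mpoly K[n + n]}).
Proof.
have H1 : bihomog 0 0 (1 : {mpoly K[n + n]}).
  by apply/bihomogP => m; rewrite msupp1 inE => /eqP->; rewrite !big1 // => i _; rewrite mnm0E.
have H0 : bihomog 0 0 (0 : {mpoly K[n + n]}) by apply/bihomogP => m; rewrite msupp0.
by elim: k => [//|k IH]; rewrite mulrS; apply: bihomogD.
Qed.

Lemma bihomogXl i : bihomog 1 0 ('X_(lshift n i) : {mpoly K[n + n]}).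
Proof.
apply/bihomogP => m; rewrite msuppX inE => /eqP->; split.
  rewrite (bigD1 i) //= mnm1E eqxx big1 // => j ji; rewrite mnm1E (inj_eq (@lshift_inj _ _)).
  by rewrite eq_sym (negPf ji).
by rewrite big1 // => j _; rewrite mnm1E eq_lrshift.
Qed.

Lemma bihomogXr i : bihomog 0 1 ('X_(rshift n i) : {mpoly K[n + n]}).
Proof.
apply/bihomogP => m; rewrite msuppX inE => /eqP->; split; last first.
  rewrite (bigD1 i) //= mnm1E eqxx big1 // => j ji; rewrite mnm1E (inj_eq (@rshift_inj _ _)).
  by rewrite eq_sym (negPf ji).
by rewrite big1 // => j _; rewrite mnm1E eq_rlshift.
Qed.

End BihomogClosed.

(** * The curve as a projective set and its points over extension fields *)

Section EdwardsCurve.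
Variable K : fieldExtType rat.

Definition edX (j : nat) : {mpoly K[4]} := 'X_(inord j).
Definition edq : quad {mpoly K[4]} := (edX 0, edX 1, edX 2, edX 3).
Definition edL : quad {mpoly K[4 + 4]} :=
  ('X_(lshift 4 (inord 0)), 'X_(lshift 4 (inord 1)), 'X_(lshift 4 (inord 2)), 'X_(lshift 4 (inord 3))).
Definition edR : quad {mpoly K[4 + 4]} :=
  ('X_(rshift 4 (inord 0)), 'X_(rshift 4 (inord 1)), 'X_(rshift 4 (inord 2)), 'X_(rshift 4 (inord 3))).

Lemma ed_eqs_homog : all (fun p => p \is homog mdeg) [:: eqn1 edq; eqn2 edq].
Proof.
have X j : edX j \is 1.-homog by rewrite dhomogX /= mdeg1.
have X2 j k : edX j * edX k \is 2.-homog by apply: (@dhomogM _ _ _ 1 _ 1).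
rewrite /= andbT; apply/andP; split; apply: (@homogE _ _ _ 2).
  by rewrite !expr2 !rpredB ?rpredD // rpredB.
by rewrite rpredB // -mulrA mulr_natl rpredMn.
Qed.

Definition ed_set : projSet K := ProjSet ed_eqs_homog.

Section Points.
Variables (F : fieldType) (i : {rmorphism K -> F}).

Lemma charK n : n.+1%:R != 0 :> F.
Proof.
rewrite -(rmorph_nat i) fmorph_eq0 -(rmorph_nat (in_alg K)) fmorph_eq0.
by rewrite pnatr_eq0.
Qed.

Lemma pevalE n (x : 'rV[F]_n) p : peval i x p = mmap i (x 0) p.
Proof. by []. Qed.

Lemma pevalX n (x : 'rV[F]_n) j : peval i x 'X_j = x 0 j.
Proof. by rewrite /peval mmapX mmap1U. Qed.

Lemma peval_q (u : 'rV[F]_4) : qmap (peval i u) edq = quadr u.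
Proof. by rewrite /edq /edX /= !pevalX. Qed.

Lemma peval_eqn1 (u : 'rV[F]_4) : peval i u (eqn1 edq) = eqn1 (quadr u).
Proof.
by rewrite pevalE /= !(rmorphB, rmorphD, rmorphXn) /= -!pevalE !pevalX.
Qed.

Lemma peval_eqn2 (u : 'rV[F]_4) : peval i u (eqn2 edq) = eqn2 (quadr u).
Proof.
by rewrite pevalE /= !(rmorphB, rmorphM, rmorph_nat) /= -!pevalE !pevalX.
Qed.

Lemma ed_onE (x : point ed_set i) : onE (quadr (val x)).
Proof.
have /andP[/existsP[k /andP[/eqP xk _]] /=] := valP x.
rewrite peval_eqn1 peval_eqn2 andbT => /andP[e1 e2]; split.
  apply/eqP => e; have : rowq (quadr (val x)) = 0 by apply/eqP; rewrite rowq_eq0 e.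
  by rewrite quadrK => x0; move: xk; rewrite x0 mxE => /esym/eqP; rewrite oner_eq0.
move: e1 e2; case: (quadr _) => [[[a b] c] d] /=.
by rewrite !subr_eq0 => /eqP -> /eqP ->.
Qed.

Lemma ed_pointP (p : quad F) : onE p -> exists x : point ed_set i, qpar (quadr (val x)) p.
Proof.
move=> pE; have [pn _] := pE.
have /existsP[k0 k0P] : [exists k, rowq p 0 k != 0].
  rewrite -negb_forall; apply: contra pn => /forallP H; rewrite -[_ == _]rowq_eq0.
  by apply/eqP/rowP => j; rewrite (eqP (H j)) mxE.
pose k := [arg min_(l < k0 | rowq p 0 l != 0) (l : nat)].
have [kn kmin] : rowq p 0 k != 0 /\ forall l, rowq p 0 l != 0 -> (k <= l)%N.
  by rewrite /k; case: arg_minnP.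
pose c := (rowq p 0 k)^-1; have c0 : c != 0 by rewrite invr_eq0.
pose u := rowq (qscale c p).
have uP : @pointb _ ed_set F i u.
  apply/andP; split.
    apply/existsP; exists k; rewrite /u rowq_scale mxE mulVf // eqxx /=.
    apply/forallP => j; apply/implyP; rewrite ltnNge mxE; apply: contraR => n.
    by apply: kmin; apply: contra_neq n => ->; rewrite mulr0.
  have /(onE_scale _ c0)[_] := pE.
  rewrite /= peval_eqn1 peval_eqn2 /u rowqK; case: (qscale c p) => [[[x y] z] t] /= [-> ->].
  by rewrite !subrr !eqxx.
exists (Sub u uP : point ed_set i); rewrite SubK /u rowqK; exact: qpar_scaler.
Qed.

(** Both points are images of [val y] under the regular map given by the coordinates themselves, so
    [maps_to_inj] identifies them. *)
Lemma ed_point_inj (x y : point ed_set i) : qpar (quadr (val x)) (quadr (val y)) -> x = y.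
Proof.
move=> xy; have [xn _] := ed_onE x; have [yn _] := ed_onE y.
pose s := [:: rowq edq].
have E u : tpeval i (rowq edq) u = u.
  by apply/rowP => j; rewrite mxE -[u in RHS]quadrK -(peval_q u) !mxE; case: j => -[|[|[|[|//]]]].
have yy : @maps_to _ ed_set F i _ s (val y) y.
  rewrite /maps_to /= E orbF andbT submx_refl andbT.
  by rewrite -[val y]quadrK rowq_eq0.
apply: (maps_to_inj _ yy); rewrite /maps_to /= E orbF andbT.
rewrite -{1}[val y]quadrK rowq_eq0 yn /= -[val y]quadrK -[val x]quadrK.
by apply/qpar_sub => //; apply: qpar_sym.
Qed.

End Points.

(** * Geometric irreducibility *)

Section Irreducible.
Variables (Om : closedFieldType) (j : {rmorphism K -> Om}).

Let n4 : 4 != 0 :> Om. Proof. exact: (charK j 3). Qed.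

Definition aff (x y : Om) := x ^+ 2 * y ^+ 2 + 4 = 4 * x ^+ 2 + 4 * y ^+ 2.

Lemma affE x y : aff x y -> (4 - x ^+ 2) * y ^+ 2 = 4 - 4 * x ^+ 2.
Proof. by move=> C; rewrite mulrBl -(addrK 4 (x ^+ 2 * _)) C; ring. Qed.

Lemma aff_neq0 x y : aff x y -> 4 - x ^+ 2 != 0.
Proof.
move=> /affE e; apply/eqP => x4.
have : 12 = 0 :> Om.
  transitivity (4 * (4 - x ^+ 2) - (4 - 4 * x ^+ 2)); first by ring.
  by rewrite -e x4; ring.
by apply/eqP; apply: (charK j 11).
Qed.

Lemma aff_ex x : 4 - x ^+ 2 != 0 -> exists y, aff x y.
Proof.
move=> x4; have [c cE] : exists c, c = (4 - 4 * x ^+ 2) / (4 - x ^+ 2) by eexists.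
have /closed_rootP[y] : size ('X^2 - c%:P) != 1 by rewrite size_XnsubC.
rewrite /root hornerD hornerN hornerXn hornerC subr_eq0 => /eqP yE; exists y; apply/eqP; rewrite -subr_eq0; apply/eqP.
transitivity (4 - 4 * x ^+ 2 - (4 - x ^+ 2) * y ^+ 2); first by ring.
by rewrite yE cE; field.
Qed.

(* On the affine curve, [phi] is a polynomial a(x) + b(x) y up to a power of *)
(* the nonvanishing function 4 - x^2.                                         *)
Definition reducible_to_deg1 (phi : Om -> Om -> Om) :=
  exists N (a b : {poly Om}), forall x y, aff x y ->
    (4 - x ^+ 2) ^+ N * phi x y = a.[x] + b.[x] * y.

Lemma red_poly (a : {poly Om}) : reducible_to_deg1 (fun x _ => a.[x]).
Proof. by exists 0%N, a, 0 => x y _; rewrite mul1r horner0 mul0r addr0. Qed.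

Lemma red_y : reducible_to_deg1 (fun _ y => y).
Proof. by exists 0%N, 0, 1 => x y _; rewrite horner0 hornerC add0r !mul1r. Qed.

Definition ydenom : {poly Om} := 4%:P - 'X^2.
Definition ynum : {poly Om} := 4%:P - 4%:P * 'X^2.
Lemma ydenomE x : ydenom.[x] = 4 - x ^+ 2. Proof. by rewrite /ydenom !hornerE. Qed.
Lemma ynumE x : ynum.[x] = 4 - 4 * x ^+ 2. Proof. by rewrite /ynum !hornerE. Qed.

Lemma redD phi psi : reducible_to_deg1 phi -> reducible_to_deg1 psi ->
  reducible_to_deg1 (fun x y => phi x y + psi x y).
Proof.
case=> N [a [b ab]] [M [c [d cd]]].
exists (N + M)%N, (ydenom ^+ M * a + ydenom ^+ N * c), (ydenom ^+ M * b + ydenom ^+ N * d) => x y C.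
rewrite !(hornerD, hornerM) !horner_exp ydenomE.
transitivity ((4 - x ^+ 2) ^+ M * (a.[x] + b.[x] * y) + (4 - x ^+ 2) ^+ N * (c.[x] + d.[x] * y)).
  by rewrite -ab // -cd // exprD; ring.
by ring.
Qed.

Lemma redM phi psi : reducible_to_deg1 phi -> reducible_to_deg1 psi ->
  reducible_to_deg1 (fun x y => phi x y * psi x y).
Proof.
case=> N [a [b ab]] [M [c [d cd]]].
exists (N + M).+1, (ydenom * a * c + b * d * ynum), (ydenom * (a * d + b * c)) => x y C.
transitivity ((4 - x ^+ 2) * ((4 - x ^+ 2) ^+ N * phi x y) * ((4 - x ^+ 2) ^+ M * psi x y)).
  by rewrite exprS exprD; ring.
rewrite ab // cd // !(ydenomE, ynumE, hornerD, hornerM) -(affE C); ring.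
Qed.

Lemma red_meval (phi : 'I_4 -> Om -> Om -> Om) (f : {mpoly Om[4]}) :
    (forall k, reducible_to_deg1 (phi k)) ->
  reducible_to_deg1 (fun x y => f.@[fun k => phi k x y]).
Proof.
move=> H; have redc c : reducible_to_deg1 (fun _ _ => c).
  by have := red_poly c%:P; congr reducible_to_deg1; apply/funext => x; rewrite hornerC.
have ext phi1 phi2 : (forall x y, phi1 x y = phi2 x y) ->
    reducible_to_deg1 phi1 -> reducible_to_deg1 phi2.
  by move=> e; congr reducible_to_deg1; apply/funext => x; apply/funext.
elim/mpolyind: f => [|c m p _ _ IH].
  by apply: (ext _ _ _ (redc 0)) => x y; rewrite meval0.
apply: (ext (fun x y => c * \prod_(k < 4) phi k x y ^+ m k + p.@[fun k => phi k x y])).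
  by move=> x y; rewrite mevalD mevalZ mevalX.
apply: redD => //; apply: redM => //.
elim: (index_enum _) => [|k r IHr].
  by apply: (ext _ _ _ (redc 1)) => x y; rewrite big_nil.
apply: (ext (fun x y => phi k x y ^+ m k * \prod_(k <- r) phi k x y ^+ m k)).
  by move=> x y; rewrite big_cons.
apply: redM => //; elim: (m k) => [|l IHl].
  exact: (ext _ _ _ (redc 1)).
by apply: (ext _ _ _ (redM (H k) IHl)) => x y; rewrite exprS.
Qed.

(** [nu] is the norm of a + b y down to rational functions of x, times 4 - x^2. If it is zero then a
    = b = 0: otherwise the root 2 would have odd multiplicity in a^2 (4 - x^2) and even multiplicity
    in b^2 (4 - 4 x^2). *)
Lemma red_dichotomy phi : reducible_to_deg1 phi ->
  (forall x y, aff x y -> phi x y = 0) \/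
  exists2 nu : {poly Om}, nu != 0 & forall x y, aff x y -> phi x y = 0 -> root nu x.
Proof.
case=> N [a [b ab]].
pose nu := a ^+ 2 * ydenom - b ^+ 2 * ynum.
have [nu0|nun] := eqVneq nu 0; last first.
  right; exists nu => // x y C phi0; rewrite /root hornerD hornerN !hornerM ynumE ydenomE -(affE C).
  have := ab _ _ C; rewrite phi0 mulr0 => /esym/eqP; rewrite addr_eq0 => /eqP ->.
  by apply/eqP; ring.
left=> x y C; apply: (mulfI (expf_neq0 N (aff_neq0 C))); rewrite ab // mulr0.
have n2 : (2 : Om) != 0 by apply: (charK j 1).
have r2 : ydenom = ('X - 2%:P) * (- ('X + 2%:P)).
  by rewrite /ydenom (_ : 4 = 2 * 2); [rewrite polyCM; ring | ring].
have e : a ^+ 2 * ydenom = b ^+ 2 * ynum by apply/eqP; rewrite -subr_eq0 -/nu nu0.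
have w0 : ydenom != 0.
  apply/eqP => /(congr1 (horner^~ 0)); rewrite ydenomE horner0 expr0n subr0.
  exact/eqP.
have v2 : ~~ root ynum 2.
  rewrite /root ynumE (_ : 4 - 4 * 2 ^+ 2 = - 12); last by ring.
  by rewrite oppr_eq0 (charK j 11).
have v0 : ynum != 0 by apply: contraNneq v2 => ->; apply: root0.
have [a0|an] := eqVneq a 0.
  move: e; rewrite a0 expr0n mul0r => /esym/eqP; rewrite mulf_eq0 (negPf v0) orbF expf_eq0 /=.
  by move=> /eqP ->; rewrite !horner0 mul0r addr0.
have [b0|bn] := eqVneq b 0.
  by move: e; rewrite b0 expr0n mul0r => /eqP; rewrite mulf_eq0 (negPf w0) orbF expf_eq0 /= (negPf an).
have l0 : - ('X + 2%:P) != 0 :> {poly Om} by apply: contra_neq w0 => h; rewrite r2 h mulr0.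
have X0 : 'X - 2%:P != 0 :> {poly Om} by rewrite polyXsubC_eq0.
have m1 : mup 2 ('X - 2%:P : {poly Om}) = 1%N by have := mup_XsubCX 1 (2 : Om) 2; rewrite eqxx expr1.
have m0 : mup 2 (- ('X + 2%:P) : {poly Om}) = 0%N.
  by apply: mupNroot; rewrite rootN /root hornerD hornerX hornerC (_ : 2 + 2 = 4); [exact: n4 | ring].
have eL : mup 2 (a ^+ 2 * ydenom) = (mup 2 a).*2.+1.
  by rewrite mupM ?expf_neq0 // expr2 mupM // r2 mupM // m1 m0 addnn addn1.
have eR : mup 2 (b ^+ 2 * ynum) = (mup 2 b).*2.
  by rewrite mupMl // expr2 mupM // addnn.
by have := congr1 odd eL; rewrite e eR /= !odd_double.
Qed.

Lemma meval_homog d (f : {mpoly Om[4]}) (c : Om) (u v : 'I_4 -> Om) : f \is d.-homog ->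
  (forall k, v k = c * u k) -> f.@[v] = c ^+ d * f.@[u].
Proof.
move=> /dhomogP fd uv; rewrite !mevalE mulr_sumr [LHS]big_seq [RHS]big_seq; apply: eq_bigr => m /fd /= md.
rewrite mulrCA; congr (_ * _); rewrite -md mdegE -prodrXr -big_split /=.
by apply: eq_bigr => k _; rewrite uv exprMn.
Qed.

Lemma affq_onE x y : aff x y -> onE (affq x y).
Proof.
move=> C; have {}C : x ^+ 2 * y ^+ 2 = 4 * x ^+ 2 + 4 * y ^+ 2 - 4 by rewrite -C addrK.
split; last by split; ring: C.
by apply/eqP => -[_ _ /eqP]; rewrite (negPf (charK j 1)).
Qed.

(** The last two coordinates cannot both vanish and [qtau] exchanges them, so the affine chart and
    its translate cover the curve. *)
Lemma onE_affq (p : quad Om) : onE p -> exists k x y, [/\ k != 0, aff x y &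
  p = qscale k (affq x y) \/ p = qscale k (qtau (affq x y))].
Proof.
have n2 := charK j 1.
have main a b c d : onE (a, b, c, d) -> c != 0 -> exists k x y, [/\ k != 0, aff x y &
    (a, b, c, d) = qscale k (affq x y)].
  move=> [_ [e1 e2]] c0; exists (c / 2), (a / c), (b / c); split.
  - by rewrite mulf_neq0 ?invr_eq0.
  - have dE : d = a * b / (2 * c) by rewrite e2; field; rewrite c0.
    rewrite /aff; apply: (mulfI (expf_neq0 4 c0)); move: e1; rewrite dE => e1.
    have {}e1 : 4 * c ^+ 2 * (a ^+ 2 + b ^+ 2) = 4 * c ^+ 4 + a ^+ 2 * b ^+ 2.
      by rewrite e1; field; rewrite c0.
    transitivity (4 * c ^+ 4 + a ^+ 2 * b ^+ 2); first by field; rewrite c0.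
    by rewrite -e1; field; rewrite c0.
  - apply: quadI; try by field; rewrite ?c0 ?n2.
    by apply: (mulfI n2); apply: (mulfI c0); transitivity (2 * c * d); [ring | rewrite -e2; field; rewrite ?c0 ?n2].
case: p => [[[a b] c] d] pE.
have [c0|c0] := eqVneq c 0; last first.
  by have [k [x [y [k0 C e]]]] := main _ _ _ _ pE c0; exists k, x, y; split=> //; left.
have d0 : d != 0 by apply/eqP => d0; apply: (onE_zt pE).
have [k [x [y [k0 C e]]]] := main _ _ _ _ (qtau_onE pE) d0.
exists k, x, y; split=> //; right.
by have := congr1 (@qtau _) e; rewrite qscale_tau.
Qed.

Lemma red_rowq (f : {mpoly Om[4]}) (c : Om -> Om -> quad Om) :
    (forall j, reducible_to_deg1 (fun x y => rowq (c x y) 0 j)) ->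
  reducible_to_deg1 (fun x y => f.@[rowq (c x y) 0]).
Proof. by move/(red_meval f). Qed.

Lemma affq_red (f : {mpoly Om[4]}) : reducible_to_deg1 (fun x y => f.@[rowq (affq x y) 0]).
Proof.
apply: red_rowq => k; have rX := red_poly 'X; have r2 := red_poly 2%:P.
have ext phi1 phi2 : (forall x y, phi1 x y = phi2 x y) ->
    reducible_to_deg1 phi1 -> reducible_to_deg1 phi2.
  by move=> e; congr reducible_to_deg1; apply/funext => x; apply/funext.
case: k => -[|[|[|[|//]]]] lt.
- by apply: (ext _ _ _ (redM r2 rX)) => x y; rewrite mxE hornerC hornerX.
- by apply: (ext _ _ _ (redM r2 red_y)) => x y; rewrite mxE hornerC.
- by apply: (ext _ _ _ r2) => x y; rewrite mxE hornerC.
- by apply: (ext _ _ _ (redM rX red_y)) => x y; rewrite mxE hornerX.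
Qed.

Lemma affq_tau_red (f : {mpoly Om[4]}) :
  reducible_to_deg1 (fun x y => f.@[rowq (qtau (affq x y)) 0]).
Proof.
apply: red_rowq => k; have rX := red_poly 'X; have r2 := red_poly 2%:P.
have ext phi1 phi2 : (forall x y, phi1 x y = phi2 x y) ->
    reducible_to_deg1 phi1 -> reducible_to_deg1 phi2.
  by move=> e; congr reducible_to_deg1; apply/funext => x; apply/funext.
case: k => -[|[|[|[|//]]]] lt.
- by apply: (ext _ _ _ (redM r2 red_y)) => x y; rewrite mxE hornerC.
- by apply: (ext _ _ _ (redM r2 rX)) => x y; rewrite mxE hornerC hornerX.
- by apply: (ext _ _ _ (redM rX red_y)) => x y; rewrite mxE hornerX.
- by apply: (ext _ _ _ r2) => x y; rewrite mxE hornerC.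
Qed.

Lemma infinite_roots (nu : {poly Om}) :
  (forall x y, aff x y -> x * y != 0 -> root nu x) -> nu = 0.
Proof.
move=> H; apply/eqP; apply: contraT => nu0.
(* Starting at 3 avoids x = 0, the points with y = 0 over x = 1, and x = 2, where 4 - x^2
   vanishes. *)
pose s := [seq n.+3%:R | n <- iota 0 (size nu)] : seq Om.
have natI m n : m%:R = n%:R :> Om -> m = n.
  wlog mn : m n / (m <= n)%N => [W e|].
    by case/orP: (leq_total m n) => h; [apply: W | apply/esym/W].
  move/eqP; rewrite eq_sym -subr_eq0 -natrB //.
  case e : (n - m)%N => [|k]; last by rewrite (negPf (charK j k)).
  by move=> _; apply/eqP; rewrite eqn_leq mn -subn_eq0 e.
have := max_poly_roots nu0 _ _; move/(_ s); rewrite size_map size_iota ltnn; apply.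
  apply/allP => _ /mapP[n _ ->].
  have x4 : 4 - n.+3%:R ^+ 2 != 0 :> Om.
    rewrite subr_eq0 -natrX; apply/eqP => /natI/esym/eqP.
    by rewrite -[4%N]/(2 ^ 2)%N eqn_exp2r.
  have [y C] := aff_ex x4; apply: (H _ y) => //; rewrite mulf_neq0 ?charK //.
  apply: contraTneq (charK j 0) => y0.
  move/affE: C; rewrite y0 expr0n mulr0 => /esym/eqP.
  rewrite -{1}[4]mulr1 -mulrBr mulf_eq0 (negPf n4) subr_eq0 -[1]/(1%:R) -natrX => /eqP/natI/esym/eqP.
  by rewrite -[1%N]/(1 ^ 2)%N eqn_exp2r.
by rewrite map_inj_uniq ?iota_uniq // => m n /natI[].
Qed.

(** On the translated chart [f] again has the form a + b y. It vanishes wherever x y is nonzero,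
    since such a point is also affine, and these zeros are too many for the second alternative of
    [red_dichotomy]. *)
Lemma homog_vanishes_on_curve d (f : {mpoly Om[4]}) : f \is d.-homog ->
    (forall x y, aff x y -> f.@[rowq (affq x y) 0] = 0) ->
  forall p, onE p -> f.@[rowq p 0] = 0.
Proof.
move=> fd f1.
have f2 x y : aff x y -> f.@[rowq (qtau (affq x y)) 0] = 0.
  have [H|[nu nu0 H]] := red_dichotomy (affq_tau_red f); first exact: H.
  case/eqP: nu0; apply: infinite_roots => {}x {}y C; rewrite mulf_eq0 negb_or => /andP[x0 y0].
  apply: (H _ _ C).
  have -> : qtau (affq x y) = qscale (x * y / 2) (affq (2 / x) (2 / y)).
    by apply: quadI; field; rewrite ?x0 ?y0 (charK j 1).
  rewrite rowq_scale (meval_homog fd (c := x * y / 2) (u := rowq (affq (2 / x) (2 / y)) 0)).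
    rewrite f1 ?mulr0 // /aff; apply: (mulfI (expf_neq0 2 (mulf_neq0 x0 y0))).
    have {}C : x ^+ 2 * y ^+ 2 = 4 * x ^+ 2 + 4 * y ^+ 2 - 4 by rewrite -C addrK.
    transitivity (16 + 4 * (x ^+ 2 * y ^+ 2)); first by field; rewrite ?x0 ?y0.
    by rewrite C; field; rewrite ?x0 ?y0.
  by move=> k; rewrite mxE.
move=> p /onE_affq[k [x [y [k0 C [] ->]]]]; rewrite rowq_scale.
  rewrite (meval_homog fd (c := k) (u := rowq (affq x y) 0)) ?f1 ?mulr0 //.
  by move=> l; rewrite mxE.
rewrite (meval_homog fd (c := k) (u := rowq (qtau (affq x y)) 0)) ?f2 ?mulr0 //.
by move=> l; rewrite mxE.
Qed.

End Irreducible.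

(** If neither factor vanished on the affine curve, the abscissa of every affine point would be a
    root of the nonzero polynomial [nu * mu]. *)
Lemma ed_irr : geom_irreducible ed_set.
Proof.
move=> Om j d e f g fd ge fg.
have fgE p : onE p -> f.@[rowq p 0] * g.@[rowq p 0] = 0.
  move=> pE; have [x xp] := ed_pointP j pE; have [xn _] := ed_onE x; have [pn _] := pE.
  have [k k0 ->] := qparP0 pn xn (qpar_sym xp); rewrite rowq_scale quadrK.
  rewrite (meval_homog fd (c := k) (u := val x 0)); last by move=> l; rewrite mxE.
  rewrite (meval_homog ge (c := k) (u := val x 0)); last by move=> l; rewrite mxE.
  by rewrite mulrACA -mevalM fg mulr0.
have [f0|[nu nu0 H]] := red_dichotomy j (affq_red f).
  by left=> x; rewrite -[val x]quadrK; apply: (homog_vanishes_on_curve j fd f0); apply: ed_onE.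
have [g0|[mu mu0 H']] := red_dichotomy j (affq_red g).
  by right=> x; rewrite -[val x]quadrK; apply: (homog_vanishes_on_curve j ge g0); apply: ed_onE.
have /eqP[] : nu * mu != 0 by rewrite mulf_neq0.
apply: (infinite_roots j) => x y C _; rewrite rootM.
have /eqP := fgE _ (affq_onE j C); rewrite mulf_eq0 => /orP[] /eqP h.
  by rewrite (H _ _ C h).
by rewrite (H' _ _ C h) orbT.
Qed.

Definition ed_opp : seq 'rV[{mpoly K[4]}]_4 := [:: rowq (qopp edq)].
Definition ed_add : seq 'rV[{mpoly K[4 + 4]}]_4 := [:: rowq (law1 edL edR); rowq (law2 edL edR)].

Lemma ed_opp_homog c : c \in ed_opp -> exists d, forall k, c 0 k \is d.-homog.
Proof.
rewrite inE => /eqP ->; exists 1%N => k; have X l : edX l \is 1.-homog by rewrite dhomogX /= mdeg1.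
by rewrite mxE; case: k => -[|[|[|[|//]]]] lt /=; rewrite ?rpredN.
Qed.

Lemma ed_add_homog c : c \in ed_add -> exists a b, forall k, bihomog a b (c 0 k).
Proof.
have L l : bihomog 1 0 ('X_(lshift 4 l) : {mpoly K[4 + 4]}) := bihomogXl K l.
have R l : bihomog 0 1 ('X_(rshift 4 l) : {mpoly K[4 + 4]}) := bihomogXr K l.
have LR l m : bihomog 1 1 ('X_(lshift 4 l) * 'X_(rshift 4 m) : {mpoly K[4 + 4]}).
  exact: bihomogM (L l) (R m).
have P (a b c0 d : 'I_4) : bihomog 1 1 ('X_(lshift 4 a) * 'X_(rshift 4 b) + 'X_(lshift 4 c0) * 'X_(rshift 4 d) : {mpoly K[4 + 4]}).
  exact: bihomogD.
have M (a b c0 d : 'I_4) : bihomog 1 1 ('X_(lshift 4 a) * 'X_(rshift 4 b) - 'X_(lshift 4 c0) * 'X_(rshift 4 d) : {mpoly K[4 + 4]}).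
  by apply: bihomogD => //; apply: bihomogN.
have T (p q : {mpoly K[4 + 4]}) : bihomog 1 1 p -> bihomog 1 1 q -> bihomog 2 2 (2 * p * q).
  by move=> pb qb; apply: (bihomogM (bihomogM (bihomog_nat K 4 2) pb) qb).
have T' (p q : {mpoly K[4 + 4]}) : bihomog 1 1 p -> bihomog 1 1 q -> bihomog 2 2 (p * q).
  exact: bihomogM.
rewrite !inE => /orP[] /eqP ->; exists 2%N, 2%N => k; rewrite mxE;
  case: k => -[|[|[|[|//]]]] lt /=; first [exact: T | exact: T'].
Qed.

(** * The regular maps and the group axioms *)

Section Maps.
Variables (F : fieldType) (i : {rmorphism K -> F}).

Lemma tpeval_rowq n (P : quad {mpoly K[n]}) (u : 'rV[F]_n) :
  tpeval i (rowq P) u = rowq (qmap (peval i u) P).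
Proof.
by apply/rowP => k; rewrite !mxE; case: P k => [[[x y] z] t] [[|[|[|[|//]]]] lt].
Qed.

Lemma ed_maps_add (u v : 'rV[F]_4) (z : point ed_set i) :
  @maps_to _ ed_set F i _ ed_add (row_mx u v) z <-> qsum (quadr u) (quadr v) (quadr (val z)).
Proof.
have zE := ed_onE z; have [zn _] := zE.
have EL : qmap (peval i (row_mx u v)) edL = quadr u by rewrite /edL /= !pevalX !row_mxEl.
have ER : qmap (peval i (row_mx u v)) edR = quadr v by rewrite /edR /= !pevalX !row_mxEr.
have E1 : qmap (peval i (row_mx u v)) (law1 edL edR) = law1 (quadr u) (quadr v).
  by rewrite -EL -ER -(qmap_law1 (mmap i ((row_mx u v) 0))).
have E2 : qmap (peval i (row_mx u v)) (law2 edL edR) = law2 (quadr u) (quadr v).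
  by rewrite -EL -ER -(qmap_law2 (mmap i ((row_mx u v) 0))).
rewrite /maps_to /= !tpeval_rowq E1 E2 !rowq_eq0 orbF andbT -{1 2}[val z]quadrK.
split; first by case/andP=> /orP h /andP[/(qpar_sub _ zn) h1 /(qpar_sub _ zn) h2]; split.
by case=> _ /(qpar_sub _ zn) -> /(qpar_sub _ zn) -> h; rewrite !andbT; apply/orP.
Qed.

Lemma ed_maps_opp (u : 'rV[F]_4) (z : point ed_set i) :
  @maps_to _ ed_set F i _ ed_opp u z <-> qpar (qopp (quadr u)) (quadr (val z)) /\ qopp (quadr u) != q0.
Proof.
have zE := ed_onE z; have [zn _] := zE.
have E1 : qmap (peval i u) (qopp edq) = qopp (quadr u).
  by rewrite -(peval_q i) /= !pevalE !rmorphN.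
rewrite /maps_to /= !tpeval_rowq E1 !rowq_eq0 orbF andbT -{1}[val z]quadrK.
split; first by case/andP=> h /(qpar_sub _ zn).
by move=> [h1 h2]; apply/andP; split; [exact: h2 | exact/(qpar_sub _ zn)].
Qed.

Lemma ed_oppP (x : point ed_set i) : exists y : point ed_set i, @maps_to _ ed_set F i _ ed_opp (val x) y.
Proof.
have xE := qopp_onE (ed_onE x); have [y yx] := ed_pointP i xE; exists y.
by apply/ed_maps_opp; split; [apply: qpar_sym | case: xE].
Qed.

Lemma char23 : (2 : F) != 0 /\ (3 : F) != 0.
Proof. by rewrite !(charK i). Qed.

Lemma ed_addP (x y : point ed_set i) :
  exists z : point ed_set i, @maps_to _ ed_set F i _ ed_add (row_mx (val x) (val y)) z.
Proof.
have [n2 n3] := char23; have [r rE] := qsum_ex n2 n3 (ed_onE x) (ed_onE y).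
have [rE' _ _ _] := rE; have [z zr] := ed_pointP i rE'; exists z.
have [[rn _] [zn _]] := (rE', ed_onE z).
by apply/ed_maps_add; have [k k0 ->] := qparP0 zn rn zr; apply/qsum_scaler.
Qed.

End Maps.

Lemma ed_zero_ex : exists x : point ed_set (idfun : {rmorphism K -> K}), quadr (val x) == qO.
Proof.
have P : pointb (X := ed_set) (idfun : {rmorphism K -> K}) (rowq qO).
  apply/andP; split.
    apply/existsP; exists (inord 1); rewrite mxE inordK // eqxx /=.
    apply/forallP => l; apply/implyP; rewrite ltnS leqn0 => /eqP l0.
    by rewrite mxE l0.
  by rewrite /= peval_eqn1 peval_eqn2 rowqK /=; apply/and3P; split=> //; apply/eqP; ring.
by exists (Sub _ P); rewrite SubK rowqK.
Qed.

Definition ed_zero := xchoose ed_zero_ex.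

Definition ed_data : groupData K :=
  @GroupData K ed_set ed_irr ed_zero ed_opp ed_add ed_opp_homog ed_add_homog ed_oppP ed_addP.

Section Law.
Variables (F : fieldType) (i : {rmorphism K -> F}).
Implicit Types x y z : point ed_data i.

Lemma ed_addE x y z : pt_add x y = z <-> qsum (quadr (val x)) (quadr (val y)) (quadr (val z)).
Proof.
split=> [<-|h]; first by apply/ed_maps_add; exact: (@pt_addP K ed_data F i x y).
by apply: maps_to_inj (pt_addP x y) _; apply/ed_maps_add.
Qed.

Lemma ed_addP' x y : qsum (quadr (val x)) (quadr (val y)) (quadr (val (pt_add x y))).
Proof. exact/ed_addE. Qed.

Lemma ed_zeroE : quadr (val (pt_zero ed_data i)) = qO.
Proof.
have /eqP e := xchooseP ed_zero_ex; rewrite -/ed_zero in e.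
rewrite /= -[val _]quadrK e -rowq_map rowqK /=.
by rewrite rmorph0 rmorph1.
Qed.

Lemma ed_oppE x : qpar (quadr (val (pt_opp x))) (qopp (quadr (val x))).
Proof.
have /ed_maps_opp[h _] : @maps_to _ ed_set F i _ ed_opp (val x) (pt_opp x) := xchooseP (ed_oppP x).
exact: qpar_sym.
Qed.

Lemma ed_addC : commutative (@pt_add K ed_data F i).
Proof. by move=> x y; apply/ed_addE/qsumC/ed_addP'. Qed.

Lemma ed_add0 : left_id (pt_zero ed_data i) (@pt_add K ed_data F i).
Proof.
move=> x; apply/ed_addE; rewrite ed_zeroE; have [n2 n3] := char23 i.
exact: (qsumO n2 n3 (ed_onE x)).
Qed.

Lemma ed_addN : left_inverse (pt_zero ed_data i) (@pt_opp K ed_data F i) (@pt_add K ed_data F i).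
Proof.
move=> x; apply/ed_addE; rewrite ed_zeroE; have [n2 n3] := char23 i.
have xE := ed_onE x; have [xn _] := qopp_onE xE; have [yn _] := ed_onE (pt_opp x).
have [k k0 ->] := qparP0 yn xn (ed_oppE x).
rewrite -[quadr (val x) in X in qsum _ X]qscale1; apply/qsum_scale; rewrite ?oner_neq0 //.
exact: qsumN.
Qed.

Lemma ed_addA : associative (@pt_add K ed_data F i).
Proof.
move=> x y z; have [n2 n3] := char23 i.
apply/esym/ed_point_inj.
exact: (qsum_assoc n2 n3 (ed_onE x) (ed_onE y) (ed_onE z) (ed_addP' x y) (ed_addP' _ z)
  (ed_addP' y z) (ed_addP' x _)).
Qed.

End Law.

Definition ed_curve : abelianVariety K := @AbelianVariety K ed_data ed_addA ed_addC ed_add0 ed_addN.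

End EdwardsCurve.

(** * Non-torsion differences of points *)

Section EdMap.
Variables (F F' : fieldType) (h : {rmorphism F -> F'}).
Implicit Types p q r : quad F.

Lemma qmap_eq0 p : (qmap h p == q0) = (p == q0).
Proof.
case: p => [[[x y] z] t]; apply/eqP/eqP => [[]|[-> -> -> ->]]; last by rewrite /= rmorph0.
by move=> /eqP + /eqP + /eqP + /eqP; rewrite !fmorph_eq0 => /eqP-> /eqP-> /eqP-> /eqP->.
Qed.

Lemma qmap_onE p : onE p -> onE (qmap h p).
Proof.
case=> pn pE; split; first by rewrite qmap_eq0.
case: p pE {pn} => [[[x y] z] t] /= [e1 e2]; split.
  by rewrite -!rmorphXn -!rmorphD e1.
by rewrite -rmorphM e2 !rmorphM rmorph_nat.
Qed.

Lemma qmap_par p q : qpar p q -> qpar (qmap h p) (qmap h q).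
Proof.
case: p q => [[[x y] z] t] [[[x' y'] z'] t'] /= [[h1 h2 h3] h4 h5 h6].
by do !split; rewrite -!rmorphM ?h1 ?h2 ?h3 ?h4 ?h5 ?h6.
Qed.

Lemma qmap_sum p q r : qsum p q r -> qsum (qmap h p) (qmap h q) (qmap h r).
Proof.
case=> h1 h2 h3 h4; rewrite /qsum -qmap_law1 -qmap_law2 !qmap_eq0.
by split=> //; [apply: qmap_onE | apply: qmap_par | apply: qmap_par].
Qed.

Lemma quadr_map (u : 'rV[F]_4) : quadr (map_mx h u) = qmap h (quadr u).
Proof. by rewrite /quadr !mxE. Qed.

Variables (K K' : fieldExtType rat) (i : {rmorphism K -> F}) (i' : {rmorphism K' -> F'}).

Lemma ed_map_subproof (x : av_point (ed_curve K) i) :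
  pointb (X := ed_curve K') i' (map_mx h (val x)).
Proof.
have /andP[/existsP[k /andP[/eqP xk /forallP xl]] _] := valP x.
apply/andP; split.
  apply/existsP; exists k; rewrite mxE xk rmorph1 eqxx /=.
  apply/forallP => j; apply/implyP => jk.
  by rewrite mxE (eqP (implyP (xl j) jk)) rmorph0.
rewrite /= peval_eqn1 peval_eqn2 quadr_map.
have [_] := qmap_onE (ed_onE x); case: (qmap _ _) => [[[a b] c] d] [e1 e2].
by rewrite /= e1 e2 !subrr eqxx.
Qed.

(** The equations and laws have rational coefficients, so [h] may move the base field and the two
    base fields may differ. This lets arbitrary permutations of the roots act on points, and lets
    points be compared over [algC]. *)
Definition ed_map (x : av_point (ed_curve K) i) : av_point (ed_curve K') i' :=
  Sub _ (ed_map_subproof x).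

Lemma val_ed_map x : val (ed_map x) = map_mx h (val x).
Proof. exact: SubK. Qed.

Lemma ed_map_is_zmod_morphism : zmod_morphism ed_map.
Proof.
have D x y : ed_map (x + y) = ed_map x + ed_map y.
  apply/esym/ed_addE; rewrite !val_ed_map !quadr_map; apply: qmap_sum.
  exact: ed_addP'.
by move=> x y; apply: (addIr (ed_map y)); rewrite -D !subrK.
Qed.

HB.instance Definition _ := GRing.isZmodMorphism.Build (av_point (ed_curve K) i)
  (av_point (ed_curve K') i') ed_map ed_map_is_zmod_morphism.

End EdMap.

(** * Addition in affine coordinates *)

Section AffinePoints.
Variables (K : fieldExtType rat) (F : fieldType) (i : {rmorphism K -> F}).
Local Notation E := (av_point (ed_curve K) i).

Definition at_aff (P : E) (x y : F) := qpar (quadr (val P)) (affq x y).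

Let n2 : (2 : F) != 0. Proof. exact: (charK i 1). Qed.
Let n4 : (4 : F) != 0. Proof. exact: (charK i 3). Qed.

Lemma affq_neq0 (x y : F) : affq x y != q0.
Proof. by apply/eqP => -[_ _ /eqP]; rewrite (negPf n2). Qed.

Lemma at_affP P x y : at_aff P x y -> exists2 k, k != 0 & quadr (val P) = qscale k (affq x y).
Proof. by have [Pn _] := ed_onE P; move/(qparP0 Pn (affq_neq0 x y)). Qed.

Lemma at_aff_inj P x y x' y' : at_aff P x y -> at_aff P x' y' -> x = x' /\ y = y'.
Proof.
have [Pn _] := ed_onE P; move=> /qpar_sym H1 /(qpar_trans Pn H1) [[_ h2 _] h4 _ _].
by split; [move: h2 | move: h4]; rewrite -!mulrA => /(mulfI n2); rewrite ![_ * 2]mulrC => /(mulfI n2).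
Qed.

Lemma at_aff_eq P x y : at_aff P x y -> x ^+ 2 * y ^+ 2 = 4 * x ^+ 2 + 4 * y ^+ 2 - 4.
Proof.
case/at_affP=> k k0 e; have := ed_onE P; rewrite e => /(onE_scale _ k0)[_ [e1 _]].
transitivity ((2 * x) ^+ 2 + (2 * y) ^+ 2 - 4); last by ring.
by rewrite e1; ring.
Qed.

Lemma at_aff_ex x y : x ^+ 2 * y ^+ 2 = 4 * x ^+ 2 + 4 * y ^+ 2 - 4 -> exists P, at_aff P x y.
Proof.
move=> e; have E : onE (affq x y) by split; [exact: affq_neq0 | split; ring: e].
exact: ed_pointP E.
Qed.

Lemma at_aff0 : at_aff 0 0 1.
Proof.
rewrite /at_aff; have := ed_zeroE i; rewrite -[pt_zero _ _]/(0 : E) => ->.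
by do !split; ring.
Qed.

Lemma at_affN P x y : at_aff P x y -> at_aff (- P) (- x) y.
Proof.
move=> PE; have [n _] := qopp_onE (ed_onE P).
apply: (qpar_trans n (ed_oppE P)).
have [k k0 ->] := at_affP PE; rewrite (_ : qopp _ = qscale k (affq (- x) y)).
  exact: qpar_scaler.
by apply: quadI; ring.
Qed.

Lemma at_affD P Q x y x' y' : at_aff P x y -> at_aff Q x' y' ->
    4 + x * x' * y * y' != 0 -> 4 - x * x' * y * y' != 0 ->
  at_aff (P + Q) (4 * (x * y' + y * x') / (4 + x * x' * y * y'))
                 (4 * (y * y' - x * x') / (4 - x * x' * y * y')).
Proof.
move=> /at_affP[k k0 Pk] /at_affP[l l0 Ql] c0 d0.
have [S0 S1 _ _] : qsum (affq x y) (affq x' y') (quadr (val (P + Q))).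
  by apply/(qsum_scale _ _ _ k0 l0); rewrite -Pk -Ql; apply: ed_addP'.
set x3 := 4 * _ / _; set y3 := 4 * _ / _.
have e : law1 (affq x y) (affq x' y') =
    qscale ((4 + x * x' * y * y') * (4 - x * x' * y * y')) (affq x3 y3).
  by apply: quadI; rewrite /x3 /y3; field; rewrite ?c0 ?d0.
have cd0 : (4 + x * x' * y * y') * (4 - x * x' * y * y') != 0 by rewrite mulf_neq0.
by move: S1; rewrite e => /(qpar_scale _ _ cd0)/qpar_sym.
Qed.

End AffinePoints.

(** * Algebraic numbers integral at 3 *)

Section ThreeIntegral.

(* The localization of Aint at 1 + 3 Aint; its maximal ideals all contain 3. *)
Definition inO (z : algC) := exists a b, [/\ a \in Aint, b \in Aint & z * (1 + 3 * b) = a].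

(** Otherwise -1/3 would be a rational algebraic integer, hence an integer. *)
Lemma one_plus3_neq0 (b : algC) : b \in Aint -> 1 + 3 * b != 0.
Proof.
move=> bA; apply/eqP => e.
have b3 : b = - 3^-1 by apply: (mulfI (_ : 3 != 0)); [rewrite pnatr_eq0 | rewrite mulrN divff ?pnatr_eq0 //; apply/eqP; rewrite -addr_eq0 addrC e].
have /Cint_rat_Aint : b \in Crat by rewrite b3 rpredN rpredV rpred_nat.
move=> /(_ bA) /intrP[m bm]; move: e; rewrite bm.
rewrite (_ : 1 + 3 * m%:~R = (1 + 3 * m)%:~R); last by rewrite intrD intrM.
move/eqP; rewrite intr_eq0 => /eqP e.
have : (3 %| 1)%Z by apply/dvdzP; exists (- m); move: e; rewrite mulNr mulrC => /eqP; rewrite addr_eq0 => /eqP.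
by [].
Qed.

Lemma inO_Aint z : z \in Aint -> inO z.
Proof. by exists z, 0; rewrite mulr0 addr0 mulr1. Qed.

Lemma inO_nat n : inO n%:R.
Proof. by apply: inO_Aint; rewrite rpred_nat. Qed.

Lemma inO_add z t : inO z -> inO t -> inO (z + t).
Proof.
move=> [a [b [aA bA e]]] [c [d [cA dA f]]].
exists (a * (1 + 3 * d) + c * (1 + 3 * b)), (b + d + 3 * b * d).
split; try by rewrite ?(rpredD, rpredM, rpred_nat, rpred1).
by rewrite -e -f; ring.
Qed.

Lemma inO_mul z t : inO z -> inO t -> inO (z * t).
Proof.
move=> [a [b [aA bA e]]] [c [d [cA dA f]]].
exists (a * c), (b + d + 3 * b * d).
split; try by rewrite ?(rpredD, rpredM, rpred_nat, rpred1).
by rewrite -e -f; ring.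
Qed.

Lemma inO_opp z : inO z -> inO (- z).
Proof.
by move=> [a [b [aA bA e]]]; exists (- a), b; rewrite rpredN mulNr e.
Qed.

Lemma inO_exp z n : inO z -> inO (z ^+ n).
Proof. by move=> zO; elim: n => [|n IH]; [apply: (inO_nat 1) | rewrite exprS; apply: inO_mul]. Qed.

Lemma inO_unit s : inO s -> 1 + 3 * s != 0 /\ inO (1 + 3 * s)^-1.
Proof.
move=> [a [b [aA bA e]]]; have b0 := one_plus3_neq0 bA.
have ba0 : 1 + 3 * (b + a) != 0 by rewrite one_plus3_neq0 // rpredD.
have sE : 1 + 3 * s = (1 + 3 * (b + a)) / (1 + 3 * b) by rewrite -e; field; rewrite b0.
split; first by rewrite sE mulf_neq0 ?invr_eq0.
exists (1 + 3 * b), (b + a); rewrite !(rpredD, rpredM, rpred_nat) //; split=> //.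
by rewrite sE; field; rewrite b0 ba0.
Qed.

(** Since 4 is 1 modulo 3, the denominators of the addition law are units; writing 4 / (4 + 9 s) as
    1 + 9 s' removes them from later computations. *)
Lemma inO_unit4 s : inO s -> 4 + 9 * s != 0 /\
  exists2 s', inO s' & 4 / (4 + 9 * s) = 1 + 9 * s'.
Proof.
move=> sO; have O' : inO (1 + 3 * s) by apply: inO_add (inO_nat 1) (inO_mul (inO_nat 3) sO).
have [n iO] := inO_unit O'; have e : 4 + 9 * s = 1 + 3 * (1 + 3 * s) by ring.
rewrite e; split=> //; exists (- (s * (1 + 3 * (1 + 3 * s))^-1)).
  by apply/inO_opp/inO_mul.
by field; rewrite -[X in X != 0]e e.
Qed.

(** If the sum vanished, clearing the denominator of [r] would make [n] divisible by 3 among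
    algebraic integers, hence in Z; cancelling 3 and repeating would give 9. *)
Lemma nat_plus9_neq0 n r : inO r -> ~~ (9 %| n)%N -> n%:R + 9 * r != 0.
Proof.
move=> [a [b [aA bA e]]] n9; apply/eqP => e0.
have b0 := one_plus3_neq0 bA.
have H m (c : algC) : c \in Aint -> m%:R = 3 * c :> algC -> (3 %| m)%N.
  move=> cA mc; have n3 : 3 != 0 :> algC by rewrite pnatr_eq0.
  have cE : c = m%:R / 3 by rewrite mc mulrC mulKf.
  have /Cint_rat_Aint : c \in Crat by rewrite cE rpred_div ?rpred_nat.
  move=> /(_ cA) /intrP[k ck]; move/eqP: mc; rewrite ck -[3]/(3%:~R) -intrM -[m%:R]/((m%:Z)%:~R) eqr_int => /eqP mk.
  have : (3 %| m%:Z)%Z by apply/dvdzP; exists k; rewrite mk mulrC.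
  by [].
have e1 : n%:R * (1 + 3 * b) + 9 * a = 0 by rewrite -e; transitivity ((n%:R + 9 * r) * (1 + 3 * b)); [ring | rewrite e0 mul0r].
have Hn : (3 %| n)%N.
  apply: (H n (- (n%:R * b + 3 * a))); first by rewrite rpredN !(rpredD, rpredM, rpred_nat).
  by apply/eqP; rewrite -subr_eq0 -e1; apply/eqP; ring.
case/dvdnP: Hn => m nm; have Hm : (3 %| m)%N.
  apply: (H m (- (m%:R * b + a))); first by rewrite rpredN !(rpredD, rpredM, rpred_nat).
  apply/eqP; rewrite -subr_eq0; have n3 : 3 != 0 :> algC by rewrite pnatr_eq0.
  apply/eqP/(mulfI n3); rewrite mulr0 -e1 nm natrM; ring.
by case/negP: n9; rewrite nm; case/dvdnP: Hm => l ->; rewrite -mulnA dvdn_mull.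
Qed.

End ThreeIntegral.

Ltac inO_tac := repeat match goal with
  | H : inO ?z |- inO ?z => exact: H
  | |- inO 1%R => exact: (inO_nat 1)
  | |- inO (_%:R)%R => exact: inO_nat
  | |- inO (- _)%R => apply: inO_opp
  | |- inO (_ + _)%R => apply: inO_add
  | |- inO (_ * _)%R => apply: inO_mul
  | |- inO (_ ^+ _)%R => apply: inO_exp
  end.

(** * Torsion and reduction modulo 3 *)

Section Independence.
Variables (K : fieldExtType rat) (i : {rmorphism K -> algC}).
Local Notation E := (av_point (ed_curve K) i).

(* The points in the kernel of reduction modulo 3, with x as formal parameter. *)
Lemma formal_mul (P : E) s e n : inO s -> inO e -> at_aff P (3 * s) (1 + 9 * e) ->
  exists r e', [/\ inO r, inO e' & at_aff (P *+ n) (3 * s * (n%:R + 9 * r)) (1 + 9 * e')].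
Proof.
move=> sO eO PE; elim: n => [|n [r [e' [rO e'O IH]]]].
  exists 0, 0; rewrite !mulr0 !addr0 mulr0n mulr0; split; try exact: (inO_nat 0).
  exact: at_aff0.
have O1 : inO (1 + 9 * e) by inO_tac.
have O2 : inO (1 + 9 * e') by inO_tac.
have O3 : inO (n%:R + 9 * r) by inO_tac.
pose m := s ^+ 2 * (n%:R + 9 * r) * (1 + 9 * e) * (1 + 9 * e').
have mO : inO m by rewrite /m; inO_tac.
have [c0 [c' cO cE]] := inO_unit4 mO.
have [d0 [d' dO dE]] := inO_unit4 (inO_opp mO).
have mE : 9 * m = 3 * s * (3 * s * (n%:R + 9 * r)) * (1 + 9 * e) * (1 + 9 * e') by rewrite /m; ring.
move: c0 cE d0 dE; rewrite (mulrN 9 m) mE => c0 cE d0 dE.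
have := at_affD PE IH c0 d0; rewrite -mulrS.
rewrite mulrAC cE [in X in at_aff _ _ X]mulrAC dE.
(* [r'] and [e1] collect the terms divisible by 9 after the denominators have become 1 + 9 c' and 1
   + 9 d'. *)
pose r' := r + c' * (n%:R + 9 * r) + (n%:R + 9 * r) * e + c' * (n%:R + 9 * r) * (9 * e) + c' + e' + 9 * c' * e'.
pose e1 := d' * (1 + 9 * e) * (1 + 9 * e') + e + e' + 9 * e * e' - (1 + 9 * d') * s ^+ 2 * (n%:R + 9 * r).
move=> H; exists r', e1; split.
- by rewrite /r'; inO_tac.
- by rewrite /e1; inO_tac.
move: H; congr (at_aff _ _ _); rewrite /r' /e1 -?natr1; ring.
Qed.

(** If 9 does not divide [n], the abscissa 3 s (n + 9 r) of the multiple is nonzero. Otherwise pass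
    to 3 P and n / 3: the new parameter s (3 + 9 r) is nonzero, as 9 does not divide 3. *)
Lemma formal_nontorsion (P : E) s e n : inO s -> inO e -> s != 0 ->
  at_aff P (3 * s) (1 + 9 * e) -> (0 < n)%N -> P *+ n != 0.
Proof.
have [N] := ubnP n; elim: N n P s e => // N IH n P s e nN sO eO s0 PE n0.
have [/dvdnP[m nm]|n9] := boolP (9 %| n)%N; last first.
  have [r [e' [rO e'O H]]] := formal_mul n sO eO PE.
  apply: contraNneq (nat_plus9_neq0 rO n9) => P0; move: H; rewrite P0 => H.
  have [/esym/eqP] := at_aff_inj (at_aff0 i) H.
  by rewrite -mulrA !mulf_eq0 pnatr_eq0 (negPf s0) => /eqP ->.
have [r [e' [rO e'O H]]] := formal_mul 3 sO eO PE.
rewrite (_ : n = (3 * (3 * m))%N) ?(mulrnA P 3); last by rewrite nm; ring.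
have m0 : (0 < m)%N by move: n0; rewrite nm muln_gt0 => /andP[].
have lt : (3 * m < N)%N.
  apply: leq_trans (_ : (m * 9 <= N)%N); last by rewrite -ltnS -nm.
  by rewrite mulnC ltn_pmul2l.
have s3 : s * (3 + 9 * r) != 0 by rewrite mulf_neq0 //; apply: nat_plus9_neq0.
have H' : at_aff (P *+ 3) (3 * (s * (3 + 9 * r))) (1 + 9 * e') by rewrite mulrA.
have sO3 : inO (s * (3 + 9 * r)) by inO_tac.
have m03 : (0 < 3 * m)%N by rewrite muln_gt0.
exact: (IH (3 * m)%N (P *+ 3) _ e' lt sO3 e'O s3 H' m03).
Qed.

(** Twice P - Q lies in the kernel of reduction, so being torsion it has abscissa 0, and then so
    does P - Q, that is u y' = y u'. Squaring and eliminating y^2 and y'^2 with the curve equation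
    leaves u^2 - u'^2 times a unit. *)
Lemma torsion_diff (P Q : E) u u' y y' n :
    inO u -> inO u' -> inO y -> inO y' ->
    at_aff P (6 * u) y -> at_aff Q (6 * u') y' -> (0 < n)%N -> (P - Q) *+ n = 0 ->
  u ^+ 2 = u' ^+ 2.
Proof.
move=> uO u'O yO y'O PE QE n0 T.
pose m := - (4 * u * u' * y * y').
have mO : inO m by rewrite /m; inO_tac.
have [c0 [c cO cE]] := inO_unit4 mO.
have [d0 [d dO dE]] := inO_unit4 (inO_opp mO).
have mE : 9 * m = 6 * u * - (6 * u') * y * y' by rewrite /m; ring.
move: c0 cE d0 dE; rewrite (mulrN 9 m) mE => c0 cE d0 dE.
have := at_affD PE (at_affN QE) c0 d0.
rewrite mulrAC cE [in X in at_aff _ _ X]mulrAC dE.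
set X := (1 + 9 * c) * _; set Y := (1 + 9 * d) * _ => SE.
pose s := (1 + 9 * c) * 2 * (u * y' - y * u').
have sO : inO s by rewrite /s; inO_tac.
have XE : X = 3 * s by rewrite /X /s; ring.
have YO : inO Y by rewrite /Y; inO_tac.
have s2O : inO (s ^+ 2) by apply: inO_exp.
have [f0 [f fO fE]] := inO_unit4 (inO_opp s2O).
(* The curve equation determines Y modulo 9 only through its square; doubling P - Q removes the
   sign. *)
have Y2 : Y ^+ 2 = 1 + 9 * (f - s ^+ 2 - 9 * f * s ^+ 2).
  have e := at_aff_eq SE; rewrite XE in e.
  have {}e : (4 + 9 * - s ^+ 2) * Y ^+ 2 = 4 * (1 - 9 * s ^+ 2).
    transitivity (4 * Y ^+ 2 - (3 * s) ^+ 2 * Y ^+ 2); first by ring.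
    by rewrite e; ring.
  transitivity (4 / (4 + 9 * - s ^+ 2) * (1 - 9 * s ^+ 2)); last by rewrite fE; ring.
  by apply: (mulfI f0); rewrite e; field.
have Y2n : Y ^+ 2 != 0.
  rewrite Y2; apply: (nat_plus9_neq0 (n := 1)) => //.
  by inO_tac.
pose m2 := s ^+ 2 * Y ^+ 2.
have m2O : inO m2 by rewrite /m2; inO_tac.
have [g0 [g gO gE]] := inO_unit4 m2O.
have [h0 [h hO hE]] := inO_unit4 (inO_opp m2O).
have m2E : 9 * m2 = X * X * Y * Y by rewrite /m2 XE; ring.
move: g0 gE h0 hE; rewrite (mulrN 9 m2) m2E => g0 gE h0 hE.
have := at_affD SE SE g0 h0.
rewrite mulrAC gE [in X in at_aff _ _ X]mulrAC hE -mulr2n => DE.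
have s0 : s = 0.
  apply/eqP; apply: contraT => sn.
  pose v := (1 + 9 * g) * 2 * s * Y.
  pose e := h * (Y ^+ 2 - X ^+ 2) + (f - s ^+ 2 - 9 * f * s ^+ 2) - s ^+ 2.
  have vO : inO v by rewrite /v; inO_tac.
  have eO : inO e by rewrite /e XE; inO_tac.
  have v0 : v != 0.
    have Yn : Y != 0 by rewrite -sqrf_eq0.
    have gn : (1 + 9 * g) * 2 != 0.
      by apply: mulf_neq0; rewrite ?pnatr_eq0 //; apply: (nat_plus9_neq0 (n := 1)).
    exact: (mulf_neq0 (mulf_neq0 gn sn) Yn).
  have DE' : at_aff ((P - Q) *+ 2) (3 * v) (1 + 9 * e).
    move: DE; congr (at_aff _ _ _); rewrite ?XE /v; first by ring.
    transitivity ((1 + 9 * h) * (Y ^+ 2 - (3 * s) ^+ 2)); first by ring.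
    by rewrite mulrDl mul1r {1}Y2 /e XE; ring.
  have := formal_nontorsion vO eO v0 DE' n0.
  by rewrite (mulrnAC (P - Q) 2 n) T mul0rn eqxx.
have c90 : (1 + 9 * c) * 2 != 0 by rewrite mulf_neq0 ?pnatr_eq0 //; apply: (nat_plus9_neq0 (n := 1)).
have uy : u * y' = y * u'.
  by apply/eqP; rewrite -subr_eq0; move/eqP: s0; rewrite /s mulf_eq0 (negPf c90).
have e1 := at_aff_eq PE; have e2 := at_aff_eq QE.
(* Up to a factor 4, this is the cofactor of u^2 - u'^2 in the equation [e3] below. *)
have k0 : 4 + 9 * - (4 * u ^+ 2 + 4 * u' ^+ 2 - 144 * u ^+ 2 * u' ^+ 2) != 0.
  have [] // := inO_unit4 (s := - (4 * u ^+ 2 + 4 * u' ^+ 2 - 144 * u ^+ 2 * u' ^+ 2)).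
  by inO_tac.
apply/eqP; rewrite -subr_eq0; apply/eqP/(mulfI k0); rewrite mulr0.
have uy2 : u ^+ 2 * y' ^+ 2 = y ^+ 2 * u' ^+ 2 by rewrite -!exprMn uy.
have f1 : (4 - 36 * u ^+ 2) * y ^+ 2 = 4 - 4 * (36 * u ^+ 2).
  transitivity (4 * y ^+ 2 - (6 * u) ^+ 2 * y ^+ 2); first by ring.
  by rewrite e1; ring.
have f2 : (4 - 36 * u' ^+ 2) * y' ^+ 2 = 4 - 4 * (36 * u' ^+ 2).
  transitivity (4 * y' ^+ 2 - (6 * u') ^+ 2 * y' ^+ 2); first by ring.
  by rewrite e2; ring.
have : u ^+ 2 * (4 - 36 * u ^+ 2) * ((4 - 36 * u' ^+ 2) * y' ^+ 2) =
       u' ^+ 2 * (4 - 36 * u' ^+ 2) * ((4 - 36 * u ^+ 2) * y ^+ 2).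
  transitivity ((4 - 36 * u ^+ 2) * (4 - 36 * u' ^+ 2) * (u ^+ 2 * y' ^+ 2)); first by ring.
  by rewrite uy2; ring.
rewrite f1 f2 => e3.
have n4 : 4 != 0 :> algC by rewrite pnatr_eq0.
apply: (mulfI n4); rewrite mulr0; apply/eqP; rewrite -(subr_eq0 _ 0) subr0.
move/eqP: e3; rewrite -subr_eq0; congr (_ == _); ring.
Qed.

End Independence.

(** * A polynomial with symmetric Galois group *)

Lemma hornerCn (R : nzRingType) (x : R) n : (n%:R : {poly R}).[x] = n%:R.
Proof. by rewrite -polyC_natr hornerC. Qed.

Lemma horner_cubic (R : comNzRingType) (a b d w : {poly R}) (x : R) :
  (a * w + 'X * w ^+ 2 + b * 'X - d * 'X^3).[x] =
  a.[x] * w.[x] + x * w.[x] ^+ 2 + b.[x] * x - d.[x] * x ^+ 3.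
Proof. by rewrite !(hornerD, hornerN, hornerM, horner_exp, hornerX). Qed.

Lemma horner_quartic (R : comNzRingType) (a b x : R) (q := 1 - a%:P * 'X^2 + b%:P * 'X^4) :
  [/\ q.[x] = 1 - a * x ^+ 2 + b * x ^+ 4, q^`().[x] = - (a * x *+ 2) + b * x ^+ 3 *+ 4 &
      q^`()^`().[x] = - (a *+ 2) + b * x ^+ 2 *+ 12].
Proof.
have d1 : q^`() = - (a%:P * 'X *+ 2) + b%:P * 'X^3 *+ 4.
  rewrite /q -polyC1 derivD derivB !deriv_mulC derivC !derivXn sub0r /=.
  by rewrite -!mulrnAr expr1.
have d2 : q^`()^`() = - (a%:P *+ 2) + b%:P * 'X^2 *+ 12.
  rewrite d1 derivD derivN !derivMn !deriv_mulC derivX derivXn mulr1 /=.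
  by rewrite mulrnAr -mulrnA.
rewrite d2 d1 /q -polyC1.
by rewrite !(hornerD, hornerN, hornerMn, hornerM, hornerC, hornerXn, hornerX).
Qed.

Lemma horner_deriv_sqrB (R : comNzRingType) (g q : {poly R}) (x : R) (F := g ^+ 2 - q) :
  [/\ F.[x] = g.[x] ^+ 2 - q.[x], F^`().[x] = 2 * g.[x] * g^`().[x] - q^`().[x] &
  F^`()^`().[x] = 2 * (g^`().[x] ^+ 2 + g.[x] * g^`()^`().[x]) - q^`()^`().[x]].
Proof.
have d1 : F^`() = g * g^`() + g * g^`() - q^`().
  by rewrite /F expr2 derivB derivM [g^`() * g]mulrC.
rewrite d1 derivB derivD derivM /F expr2 !(hornerD, hornerN, hornerM).
by split; ring.
Qed.

(** With p a value of [sp_prod], the right side is the square of [sp_g]; the left side is 324 x^4,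
    the leading term of [sp_quartic]. *)
Lemma sqr_sum_ge (x p q : int) : 1 <= x -> 18 * x + 2 <= q -> q <= `|p| ->
  (18 * x ^+ 2) ^+ 2 <= (1 + x * (1 - p)) ^+ 2.
Proof.
move=> x1 cx pc; have x0 : 0 < x by lia.
have w0 : 0 <= 18 * x ^+ 2 by rewrite mulr_ge0 // exprn_ge0 // ltW.
have [p0|p0] := lerP 0 p.
  have h : 18 * x + 1 <= p - 1 by rewrite ger0_norm // in pc; lia.
  have {}h : x * (18 * x + 1) <= x * (p - 1) by rewrite ler_pM2l.
  have {}h : 18 * x ^+ 2 <= - (1 + x * (1 - p)).
    move: h; rewrite !mulrDr !mulrN !mulr1 mulrCA -expr2.
    move: (x * p) (x ^+ 2) => a b; lia.
  by rewrite -[X in _ <= X]sqrrN lerXn2r // nnegrE // (le_trans w0).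
have h : 18 * x + 1 <= 1 - p by rewrite ltr0_norm // in pc; lia.
have {}h : x * (18 * x + 1) <= x * (1 - p) by rewrite ler_pM2l.
have {}h : 18 * x ^+ 2 <= 1 + x * (1 - p).
  move: h; rewrite !mulrDr !mulrN !mulr1 mulrCA -expr2.
  move: (x * p) (x ^+ 2) => a b; lia.
by rewrite lerXn2r // nnegrE // (le_trans w0).
Qed.

(** Here F is about -324 z^4 and F' about -1296 z^3, while R >= z makes F'' at most -4 z^3. So F F''
    is at least of order z^7 and beats F'^2, of order z^6. *)
Lemma laguerre_violation (D : realDomainType) (z R : D) : 8000 <= z -> z <= R ->
  (2 * (1 + z) * 1 - (- (45 * z *+ 2) + 324 * z ^+ 3 *+ 4)) ^+ 2 -
  ((1 + z) ^+ 2 - (1 - 45 * z ^+ 2 + 324 * z ^+ 4)) *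
  (2 * (1 ^+ 2 + (1 + z) * (- z * (2 * R))) - (- (45 *+ 2) + 324 * z ^+ 2 *+ 12)) < 0.
Proof.
move=> C1 R1.
have z0 : 0 < z by lra.
have zz : 8000 * z <= z * z by rewrite ler_pM2r.
have w1 : 48 <= z ^+ 2 by rewrite expr2; lra.
have zw : z <= z ^+ 2 by rewrite expr2; lra.
have w4 : 48 * z ^+ 2 <= z ^+ 4 by rewrite -[4%N]/(2 + 2)%N exprD ler_pM2r ?exprn_gt0.
have w3 : 8000 * z ^+ 2 <= z ^+ 3 by rewrite (exprS z 2) ler_pM2r ?exprn_gt0.
set F0 := _ - (1 - _ + _); set F1 := 2 * _ * 1 - _; set F2 := 2 * (_ + _) - _.
have e0 : - F0 = 324 * z ^+ 4 - 46 * z ^+ 2 - 2 * z by rewrite /F0; ring.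
have e1 : - F1 = 1296 * z ^+ 3 - (92 * z + 2) by rewrite /F1; ring.
have e2 : - F2 = 4 * (z ^+ 2 * R) + 4 * (z * R) + 3888 * z ^+ 2 - 92 by rewrite /F2; ring.
have a0 : 323 * z ^+ 4 <= - F0.
  by rewrite e0; clear -w4 zw z0; move: (z ^+ 4) (z ^+ 2) w4 zw => a b w4 zw; lra.
have a2 : 4 * z ^+ 3 <= - F2.
  have h : z ^+ 3 <= z ^+ 2 * R by rewrite exprSr ler_pM2l ?exprn_gt0.
  have h' : 0 <= z * R by apply: mulr_ge0; [exact: ltW | apply: le_trans R1; exact: ltW].
  rewrite e2; clear -h h' w1.
  by move: (z ^+ 2 * R) (z * R) (z ^+ 3) (z ^+ 2) h h' w1 => a b d e h h' w1; lra.
have a1 : - F1 <= 1296 * z ^+ 3 by rewrite e1 gerBl; clear -z0; lra.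
have a1' : 0 <= - F1.
  rewrite e1 subr_ge0; clear -w3 zw w1 z0.
  by move: (z ^+ 3) (z ^+ 2) w3 zw w1 => a b w3 zw w1; lra.
clear e0 e1 e2.
move: F0 F1 F2 a0 a1 a1' a2 => F0 F1 F2 a0 a1 a1' a2.
have b1 : F1 ^+ 2 <= (1296 * z ^+ 3) ^+ 2.
  by rewrite -[F1 ^+ 2]sqrrN; apply: lerXn2r => //; rewrite nnegrE; apply: le_trans a1.
have b2 : 323 * z ^+ 4 * (4 * z ^+ 3) <= F0 * F2.
  have zn n : 0 <= z ^+ n by rewrite exprn_ge0 // ltW.
  by rewrite -[F0 * F2]mulrNN; apply: ler_pM; [rewrite mulr_ge0 ?ler0n | rewrite mulr_ge0 ?ler0n | exact: a0 | exact: a2].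
rewrite subr_lt0; apply: le_lt_trans b1 _; apply: lt_le_trans b2.
rewrite (_ : (1296 * z ^+ 3) ^+ 2 = 324 * (1296 * z ^+ 3) * (4 * z ^+ 3)); last by ring.
have z3 : 0 < z ^+ 3 by rewrite exprn_gt0.
have z4 : 8000 * z ^+ 3 <= z ^+ 4 by rewrite (exprS z 3) ler_pM2r.
rewrite ltr_pM2r ?mulr_gt0 ?ltr0n //; clear -z3 z4.
by move: (z ^+ 3) (z ^+ 4) z3 z4 => a b z3 z4; lra.
Qed.

(** * The polynomial: irreducibility, signs, failure of Laguerre's inequality *)

Section SpecialPolynomial.
Variable k : nat.
Hypothesis k4 : (4 <= k)%N.

Let c : nat := 1000 * k.
Let C : nat := 2 * c.

(* For a root u of sp_f the point (6 u, sp_g(u) / (1 - 9 u^2)) is on the      *)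
(* curve, by sp_fE and sp_quarticE. Modulo 2 the polynomial sp_f is a power   *)
(* of X; its sign alternates at the multiples of c; and the double root C of  *)
(* sp_prod makes it violate Laguerre's inequality, so not all roots are real. *)
Definition sp_tail : {poly int} := \prod_(l <- iota 2 (k - 3)) ((l * C)%N%:R%:P - 'X).
Definition sp_prod : {poly int} := (C%:R%:P - 'X) ^+ 2 * sp_tail.
Definition sp_g : {poly int} := 1 + 'X * (1 - sp_prod).
Definition sp_quartic : {poly int} := 1 - 45 * 'X^2 + 324 * 'X^4.
Definition sp_f : {poly int} :=
  2 * (1 - sp_prod) + 'X * (1 - sp_prod) ^+ 2 + 45 * 'X - 324 * 'X^3.

Lemma sp_fE : sp_f * 'X = sp_g ^+ 2 - sp_quartic.
Proof. by rewrite /sp_f /sp_g /sp_quartic; ring. Qed.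

Lemma sp_quarticE : sp_quartic = (1 - 36 * 'X^2) * (1 - 9 * 'X^2).
Proof. by rewrite /sp_quartic; ring. Qed.

Lemma sp_prod_mod2 : exists h : {poly int}, sp_prod = (- 'X) ^+ (k - 1) + 2 * h.
Proof.
have step (p : {poly int}) n (t : nat) : (exists h, p = (- 'X) ^+ n + 2 * h) ->
    exists h, ((t * C)%N%:R%:P - 'X) * p = (- 'X) ^+ n.+1 + 2 * h.
  case=> h ->; exists ((t * c)%N%:R%:P * ((- 'X) ^+ n + 2 * h) - 'X * h).
  by rewrite !polyC_natr /C !natrM exprS; ring.
have tail n m : exists h, \prod_(l <- iota m n) ((l * C)%N%:R%:P - 'X) = (- 'X) ^+ n + 2 * h :> {poly int}.
  elim: n m => [|n IH] m; first by exists 0; rewrite big_nil mulr0 addr0.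
  by rewrite big_cons; apply: step.
have := step _ _ 1%N (step _ _ 1%N (tail (k - 3)%N 2%N)); rewrite mul1n mulrA -expr2.
by rewrite (_ : (k - 3).+2 = (k - 1)%N) //; lia.
Qed.

(** Modulo 2, X (1 - [sp_prod])^2 is X + X [sp_prod]^2, and the odd coefficient 45 cancels the X. *)
Lemma sp_f_mod2 : exists h : {poly int}, sp_f = 'X^(k.*2.-1) + 2 * h.
Proof.
have [h hE] := sp_prod_mod2.
exists (1 - sp_prod - 'X * sp_prod + 'X * ((- 'X) ^+ (k - 1) * h * 2 + 2 * h ^+ 2) + 23 * 'X - 162 * 'X^3).
have e1 : 'X^(k.*2.-1) = 'X * (- 'X) ^+ (k - 1) ^+ 2 :> {poly int}.
  by rewrite -exprM mulnC exprM sqrrN -exprM -exprS; congr ('X^ _); lia.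
have e2 : sp_prod ^+ 2 = (- 'X) ^+ (k - 1) ^+ 2 + 2 * ((- 'X) ^+ (k - 1) * h * 2 + 2 * h ^+ 2).
  by rewrite hE; ring.
rewrite e1 /sp_f (_ : (1 - sp_prod) ^+ 2 = 1 - 2 * sp_prod + sp_prod ^+ 2); last by ring.
by rewrite e2; ring.
Qed.

Lemma size_CsubX (t : int) : size (t%:P - 'X) = 2%N /\ lead_coef (t%:P - 'X) = -1.
Proof.
rewrite -opprB size_polyN size_XsubC lead_coefN lead_coefXsubC.
by [].
Qed.

Lemma sp_prod_size : size sp_prod = k /\ lead_coef sp_prod ^+ 2 = 1.
Proof.
have tail n m : size (\prod_(l <- iota m n) ((l * C)%N%:R%:P - 'X) : {poly int}) = n.+1 /\
    lead_coef (\prod_(l <- iota m n) ((l * C)%N%:R%:P - 'X) : {poly int}) ^+ 2 = 1.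
  elim: n m => [|n IH] m; first by rewrite big_nil size_poly1 lead_coef1 expr1n.
  rewrite big_cons; have [s1 l1] := size_CsubX ((m * C)%N%:R).
  have [s2 l2] := IH m.+1.
  rewrite size_mul -?size_poly_eq0 ?s1 ?s2 //; split=> //.
  by rewrite lead_coefM exprMn l1 l2.
have [s1 l1] := size_CsubX C%:R; have [s2 l2] := tail (k - 3)%N 2%N.
have n1 : C%:R%:P - 'X != 0 :> {poly int} by rewrite -size_poly_eq0 s1.
have n2 : sp_tail != 0 by rewrite -size_poly_eq0 s2.
rewrite /sp_prod size_mul ?expf_neq0 // expr2 size_mul // s1 s2; split; first by lia.
rewrite -expr2.
by rewrite lead_coefM lead_coef_exp exprMn l2 l1.
Qed.

Lemma sp_f_size : size sp_f = k.*2 /\ sp_f \is monic.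
Proof.
have [sp lp] := sp_prod_size.
have sW : size (1 - sp_prod) = k.
  by rewrite addrC size_polyDl size_polyN // sp size_poly1; lia.
have lW : lead_coef (1 - sp_prod) ^+ 2 = 1.
  rewrite addrC lead_coefDl ?lead_coefN ?sqrrN // size_polyN sp size_poly1; lia.
have sM : size ('X * (1 - sp_prod) ^+ 2) = k.*2.
  have nW : 1 - sp_prod != 0 by rewrite -size_poly_eq0 sW; lia.
  by rewrite mulrC size_mulX ?expf_neq0 // expr2 size_mul // sW; lia.
have lM : lead_coef ('X * (1 - sp_prod) ^+ 2) = 1.
  by rewrite lead_coefM lead_coefX mul1r lead_coef_exp lW.
have sR : (size ((2 * (1 - sp_prod) + (45 * 'X - 324 * 'X^3))%R : {poly int}) < k.*2)%N.
  apply: leq_ltn_trans (size_polyD _ _) _; rewrite gtn_max; apply/andP; split.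
    by rewrite -polyC_natr mul_polyC size_scale // sW; lia.
  apply: leq_ltn_trans (size_polyD _ _) _; rewrite gtn_max size_polyN; apply/andP; split.
    by rewrite -polyC_natr mul_polyC size_scale // size_polyX; lia.
  by rewrite -polyC_natr mul_polyC size_scale // size_polyXn; lia.
have fE : sp_f = 'X * (1 - sp_prod) ^+ 2 + (2 * (1 - sp_prod) + (45 * 'X - 324 * 'X^3)).
  by rewrite /sp_f; ring.
by rewrite fE size_polyDl ?sM // monicE lead_coefDl ?sM // lM.
Qed.

Lemma sp_prod0 : sp_prod.[0] = C%:R ^+ 2 * \prod_(l <- iota 2 (k - 3)) (l * C)%N%:R.
Proof.
rewrite /sp_prod /sp_tail hornerM horner_exp horner_prod !hornerE; congr (_ * _).
by apply: eq_bigr => l _; rewrite !hornerE.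
Qed.

Lemma sp_f0 : sp_f.[0] = 2 * (1 - sp_prod.[0]).
Proof.
by rewrite /sp_f horner_cubic hornerCn hornerD hornerN -polyC1 hornerC expr0n /= !mul0r !mulr0 subr0 !addr0.
Qed.

Lemma sp_quartic_horner x : [/\ sp_quartic.[x] = 1 - 45 * x ^+ 2 + 324 * x ^+ 4,
  sp_quartic^`().[x] = - (45 * x *+ 2) + 324 * x ^+ 3 *+ 4 &
  sp_quartic^`()^`().[x] = - (45 *+ 2) + 324 * x ^+ 2 *+ 12].
Proof. by have := horner_quartic 45 324 x; rewrite !polyC_natr. Qed.

Lemma sp_irr : irreducible_poly (map_poly (intr : int -> rat) sp_f).
Proof.
have [sf lf] := sp_f_size; have [h hE] := sp_f_mod2.
apply/irreducible_rat_int/(@eisenstein_crit 2) => //.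
- by rewrite sf; lia.
- by rewrite (monicP lf).
(* The constant term is twice an odd number because [C] is even. *)
- rewrite -horner_coef0 sp_f0 sp_prod0; set q := \prod_(l <- _) _.
  rewrite /C natrM; lia.
- move=> i; rewrite sf hE coefD coefXn -polyC_natr coefCM => ilt.
  by rewrite (_ : (i == _) = false) ?add0r ?dvdz_mulr //; apply/negbTE; lia.
Qed.

Lemma tail_ge (x : int) (n m : nat) : (forall l, (m <= l < m + n)%N -> 1 <= `|(l * C)%N%:R - x|) ->
  1 <= `|\prod_(l <- iota m n) ((l * C)%N%:R - x)|.
Proof.
elim: n m => [|n IH] m H; first by rewrite big_nil normr1.
rewrite big_cons normrM; have h1 := H m; have h2 := IH m.+1.
have {}h2 : 1 <= `|\prod_(l <- iota m.+1 n) ((l * C)%N%:R - x)|.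
  by apply: h2 => l lt; apply: H; lia.
have {}h1 : 1 <= `|(m * C)%N%:R - x| by apply: h1; lia.
by rewrite -[1]mulr1 ler_pM.
Qed.

Lemma sp_prodE (x : int) : sp_prod.[x] = (C%:R - x) ^+ 2 * \prod_(l <- iota 2 (k - 3)) ((l * C)%N%:R - x).
Proof.
rewrite /sp_prod /sp_tail hornerM horner_exp horner_prod !hornerE; congr (_ * _).
by apply: eq_bigr => l _; rewrite !hornerE.
Qed.

Lemma sp_gE (x : int) : sp_g.[x] = 1 + x * (1 - sp_prod.[x]).
Proof. by rewrite /sp_g !hornerE. Qed.

Lemma sp_fxE (x : int) : sp_f.[x] * x = sp_g.[x] ^+ 2 - (1 - 45 * x ^+ 2 + 324 * x ^+ 4).
Proof.
have [q0 _ _] := sp_quartic_horner x.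
by have := congr1 (horner^~ x) sp_fE; rewrite hornerM hornerX => ->; rewrite hornerD hornerN horner_exp q0.
Qed.

(** An even j > 0 gives a zero of [sp_prod], where x f(x) = (1 + x)^2 - q(x) is negative, q being
    [sp_quartic]; at j = 0 the value f(0) is estimated directly. For odd j each factor of [sp_prod]
    is nonzero and the double one contributes at least c^2, so the square of [sp_g] dominates. *)
Lemma sp_f_sign (j : nat) : (j < k.*2.-2)%N ->
  if odd j then 0 < sp_f.[(j * c)%N%:R] else sp_f.[(j * c)%N%:R] < 0.
Proof.
move=> jk; have c0 : (4000 <= c)%N by rewrite /c; lia.
have [->|j0] := eqVneq j 0%N.
  rewrite mul0n /= sp_f0 sp_prod0; set T := \prod_(l <- _) _.
  have T0 : 0 < T.
    rewrite /T big_seq; apply: prodr_gt0 => l; rewrite mem_iota => lk.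
    by rewrite ltr0n muln_gt0 /C; lia.
  have C2 : 2 <= C%:R :> int by rewrite ler_nat /C; lia.
  nia.
set x : int := (j * c)%N%:R; have x1 : 1 <= x by rewrite /x ler1n; lia.
have x0 : 0 < x by lia.
have := sp_fxE x; rewrite sp_gE; case: ifPn => oj fE; last first.
  have p0 : sp_prod.[x] = 0.
    rewrite sp_prodE; have jE : j = (j./2).*2 by rewrite -[LHS]odd_double_half (negPf oj).
    have xE : x = (j./2 * C)%N%:R by rewrite /x {1}jE /C; congr (_%:R); lia.
    have [j1|j1] := eqVneq j./2 1%N; first by rewrite xE j1 mul1n subrr expr0n mul0r.
    rewrite (big_rem j./2) /=; last by rewrite mem_iota; lia.
    by rewrite -xE subrr mul0r mulr0.
  by move: fE; rewrite p0 subr0 mulr1 => fE; rewrite -(pmulr_llt0 _ x0) fE; nia.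
have dist l : c%:R <= `|(l * C)%N%:R - x|.
  have -> : (l * C)%N%:R - x = (2 * l%:Z - j%:Z) * c%:R.
    by rewrite /x /C !natz !PoszM; ring.
  rewrite normrM (ger0_norm (ler0n _ c)) ler_peMl ?ler0n //.
  by have := oj; lia.
have c1 : 1 <= c%:R :> int by rewrite ler1n; lia.
have pc : c%:R ^+ 2 <= `|sp_prod.[x]|.
  rewrite sp_prodE normrM -[c%:R ^+ 2]mulr1; apply: ler_pM => //; first by rewrite exprn_ge0 ?ler0n.
    by rewrite normrX lerXn2r // ?nnegrE ?ler0n // -[C]mul1n.
  by apply: tail_ge => l _; apply: le_trans c1 (dist l).
have xk : x <= (k.*2 * c)%N%:R by rewrite /x ler_nat leq_mul2r; lia.
(* The factor 1000 in [c] is ample here: x <= 2 k c and c = 1000 k. *)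
have cx : 18 * x + 2 <= c%:R ^+ 2.
  rewrite -natrX; move: xk; rewrite /c; set y := k.*2; nia.
rewrite -(pmulr_lgt0 _ x0) fE; set p := sp_prod.[x] in pc *.
have w1 : 1 <= x ^+ 2 by rewrite exprn_ege1.
have h := sqr_sum_ge x1 cx pc; rewrite subr_gt0; apply: lt_le_trans h.
rewrite (_ : (18 * x ^+ 2) ^+ 2 = 324 * x ^+ 4); last by ring.
by rewrite gtrDr; move: (x ^+ 2) w1 => w {}w1; lia.
Qed.

Lemma deriv_double_root (R : {poly int}) (a : int) (p := (a%:P - 'X) ^+ 2 * R) :
  [/\ p.[a] = 0, p^`().[a] = 0 & p^`()^`().[a] = 2 * R.[a]].
Proof.
have d : (a%:P - 'X)^`() = -1 :> {poly int} by rewrite derivB derivC derivX sub0r.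
have p1 : p^`() = (a%:P - 'X) * (- 2 * R + (a%:P - 'X) * R^`()).
  by rewrite /p expr2 !derivM d; ring.
have p2 : p^`()^`() = - (- 2 * R + (a%:P - 'X) * R^`()) + (a%:P - 'X) * (- 2 * R + (a%:P - 'X) * R^`())^`().
  by rewrite p1 derivM d mulN1r.
have h0 : (a%:P - 'X).[a] = 0 by rewrite hornerD hornerN hornerC hornerX subrr.
split; first by rewrite /p expr2 !hornerM h0 !mul0r.
  by rewrite p1 hornerM h0 mul0r.
rewrite p2 hornerD hornerN hornerD !hornerM h0 !mul0r !addr0 hornerN hornerCn; ring.
Qed.

(** At the double root the values of [sp_g] and its slope stay small, but its second derivative is
    -2 C R with R = [sp_tail.[C]]. The factor 2 C - X of [sp_tail], present since k >= 4, gives R >=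
    C. *)
Lemma sp_laguerre (F := sp_f * 'X) :
  F^`().[C%:R] ^+ 2 - F.[C%:R] * F^`()^`().[C%:R] < 0.
Proof.
have [p0 p1 p2] := deriv_double_root sp_tail C%:R; rewrite -/sp_prod in p0 p1 p2.
have R1 : C%:R <= sp_tail.[C%:R].
  rewrite /sp_tail (_ : (k - 3)%N = (k - 4).+1); last by lia.
  rewrite /= big_cons hornerM horner_prod hornerD hornerN hornerC hornerX.
  set T := \prod_(l <- _) _; have T0 : 0 < T.
    rewrite /T big_seq; apply: prodr_gt0 => l; rewrite mem_iota => lk.
    rewrite hornerD hornerN hornerC hornerX subr_gt0 ltr_nat.
    by rewrite ltn_Pmull /C /c; lia.
  have Cp : 0 <= C%:R :> int by rewrite ler0n.
  by rewrite natrM; nia.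
have C1 : 8000 <= C%:R :> int by rewrite ler_nat /C /c; lia.
have dg : sp_g^`() = (1 - sp_prod) - 'X * sp_prod^`().
  by rewrite /sp_g derivD derivM derivX -polyC1 derivC add0r mul1r derivB derivC sub0r mulrN.
have ddg : sp_g^`()^`() = - (sp_prod^`() + sp_prod^`()) - 'X * sp_prod^`()^`().
  by rewrite dg derivB derivM derivX derivB -polyC1 derivC; ring.
have g0 : sp_g.[C%:R] = 1 + C%:R by rewrite sp_gE p0 subr0 mulr1.
have g1 : sp_g^`().[C%:R] = 1.
  by rewrite dg hornerD hornerN hornerM p1 mulr0 hornerD hornerN p0 -polyC1 hornerC !subr0.
have g2 : sp_g^`()^`().[C%:R] = - C%:R * (2 * sp_tail.[C%:R]).
  by rewrite ddg hornerD !hornerN hornerD hornerM hornerX p1 p2; ring.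
have [q0 q1 q2] := sp_quartic_horner C%:R.
have [f0 f1 f2] := horner_deriv_sqrB sp_g sp_quartic C%:R.
rewrite /F sp_fE f0 f1 f2 g0 g1 g2 q0 q1 q2.
move: (sp_tail.[_]) R1 => R R1; move: (C%:R : int) C1 R1 => z C1 R1.
exact: laguerre_violation.
Qed.

End SpecialPolynomial.

(** The intermediate value theorem is applied in the real closed field [algR]; strict sign changes
    put the roots in disjoint open intervals, so they are distinct. *)
Lemma sign_change_roots (f : {poly int}) (t : nat -> int) (n : nat) :
    (forall j, (j < n)%N -> t j < t j.+1) ->
    (forall j, (j < n)%N -> f.[t j] * f.[t j.+1] < 0) ->
  exists s : seq algC, [/\ uniq s, size s = n &
    all (fun z => (z \is Num.real) && root (map_poly intr f) z) s].
Proof.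
move=> tlt tsgn; pose p : {poly algR} := map_poly intr f.
have pE a : p.[a%:~R] = (f.[a])%:~R by rewrite /p horner_map.
have ex (j : 'I_n) : exists x : algR, [/\ (t j)%:~R < x, x < (t j.+1)%:~R & root p x].
  have tj := tlt _ (ltn_ord j); have sj := tsgn _ (ltn_ord j).
  have le_t : (t j)%:~R <= (t j.+1)%:~R :> algR by rewrite ler_int ltW.
  have [x xt px] : exists2 x : algR, (t j)%:~R <= x <= (t j.+1)%:~R & root p x.
    case: (ltrgtP f.[t j] 0) => [h|h|h]; last by rewrite h mul0r ltxx in sj.
      apply: poly_ivt => //; rewrite !pE lerz0 ler0z; move: sj; rewrite nmulr_rlt0 // => h'.
      by rewrite (ltW h) (ltW h').
    have [|x xt] := poly_ivt (p := - p) le_t; last by rewrite rootN => px; exists x.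
    rewrite !hornerN !pE oppr_le0 oppr_ge0 ler0z lerz0; move: sj; rewrite pmulr_rlt0 // => h'.
    by rewrite (ltW h) (ltW h').
  exists x; split=> //.
    case/andP: xt => xt _; rewrite lt_neqAle xt andbT; apply: contraTneq px => <-.
    rewrite /root pE intr_eq0; apply: contraTneq sj => ->; by rewrite mul0r ltxx.
  case/andP: xt => _ xt; rewrite lt_neqAle xt andbT; apply: contraTneq px => ->.
  rewrite /root pE intr_eq0; apply: contraTneq sj => ->; by rewrite mulr0 ltxx.
have [x xP] := fin_all_exists ex.
have x_lt (i j : 'I_n) : (i < j)%N -> x i < x j.
  move=> ij; have [_ xi _] := xP i; have [xj _ _] := xP j.
  apply: lt_trans xi (le_lt_trans _ xj); rewrite ler_int.
  elim: {j xj}(j : nat) (ltn_ord j) ij => // j IH jn; rewrite ltnS leq_eqVlt => /orP[/eqP <- //|ij].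
  by apply: le_trans (IH _ ij) (ltW (tlt _ _)); rewrite ltnW.
exists [seq algRval (x i) | i : 'I_n]; split.
- rewrite map_inj_uniq ?enum_uniq // => i j /(@fmorph_inj _ _ _) xij; apply: ord_inj.
  by case: (ltngtP i j) => // /x_lt; rewrite xij ltxx.
- by rewrite size_map size_enum_ord.
- apply/allP => _ /mapP[i _ ->]; rewrite algRvalP /=.
  have [_ _] := xP i; rewrite -(fmorph_root algRval) -map_poly_comp.
  by congr (root _ _); apply: eq_map_poly => a /=; rewrite rmorph_int.
Qed.

Section SpecialRoots.
Variable k : nat.
Hypothesis k4 : (4 <= k)%N.

Lemma sp_real_roots : exists s : seq algC, [/\ uniq s, size s = (k.*2 - 3)%N &
    all (fun z => (z \is Num.real) && root (map_poly intr (sp_f k)) z) s].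
Proof.
apply: (@sign_change_roots _ (fun j => (j * (1000 * k))%N%:R)) => j jk.
  by rewrite ltr_nat ltn_pmul2r // muln_gt0; lia.
have := @sp_f_sign k k4 j; have := @sp_f_sign k k4 j.+1.
rewrite /= if_neg; case: ifP => _ h1 h2.
  by rewrite pmulr_rlt0 ?h1 ?h2 //; lia.
by rewrite nmulr_rlt0 ?h1 ?h2 //; lia.
Qed.

(** If all roots were real, so would be those of [sp_f k * 'X], and [laguerre] would contradict
    [sp_laguerre]. *)
Lemma sp_nonreal : exists2 z : algC, root (map_poly intr (sp_f k)) z & z \isn't Num.real.
Proof.
have [_ f_monic] := sp_f_size k4.
have fC_monic : map_poly (intr : int -> algC) (sp_f k) \is monic by rewrite monic_map.
have [rs] := closed_field_poly_normal (map_poly (intr : int -> algC) (sp_f k)).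
rewrite (monicP fC_monic) scale1r => fCE.
have [/allP rs_real|] := boolP (all (fun z => z \is Num.real) rs); last first.
  by case/allPn => z zrs zN; exists z => //; rewrite fCE root_prod_XsubC.
pose x : int := (2 * (1000 * k))%N%:R.
have := @laguerre (0 :: rs) (x%:~R) _ _; rewrite big_cons /= -fCE.
have -> : ('X - 0%:P) * map_poly intr (sp_f k) = map_poly intr (sp_f k * 'X) :> {poly algC}.
  by rewrite subr0 rmorphM /= map_polyX mulrC.
rewrite !deriv_map !horner_map -rmorphXn -rmorphM -rmorphB /= ler0z => H.
have lt0 := sp_laguerre k4; cbv zeta in lt0; move: lt0; rewrite ltNge H ?realz //.
by rewrite rpred0; apply/allP.
Qed.

End SpecialRoots.

Lemma galois_pchar0 (F : fieldType) (L : splittingFieldType F) (K : {subfield L}) :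
  [pchar L] =i pred0 -> galois K {:L}.
Proof.
move=> L0; apply/and3P; split; [exact: subvf | | exact: normalFieldf].
apply/separableP => x _; apply: contraT => /separablePn_pchar[p].
by rewrite L0.
Qed.

(** An endomorphism fixing [K] is automatically linear. This turns ring morphisms obtained over
    another base field, or by restriction from [algC], into Galois elements. *)
Lemma gal_rmorphism (F : fieldType) (L : splittingFieldType F) (K : {subfield L})
    (phi : {rmorphism L -> L}) :
    (forall x, x \in K -> phi x = x) ->
  exists2 s, s \in 'Gal({:L} / K)%g & forall x, s x = phi x.
Proof.
move=> phiK; have phi_lin : scalable phi.
  move=> a x; rewrite -mulr_algl rmorphM phiK ?mulr_algl //.
  by apply: (subvP (sub1v K)); rewrite rpredZ ?mem1v.
pose phiL := GRing.isScalable.Build F L L *:%R phi phi_lin.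
pose phi' : {linear L -> L} := HB.pack (phi : L -> L) (GRing.RMorphism.class phi) phiL.
have hom : kHom K {:L} (linfun phi').
  apply/kHomP_tmp; split=> [x xK|x y _ _]; rewrite !lfunE /=; first exact: phiK.
  exact: rmorphM.
have [|s sG sE] := @kHom_to_gal _ L K {:L} {:L} _ _ (normalFieldf K) hom.
  by rewrite subvf subvv.
by exists s => // x; rewrite -sE ?memvf // lfunE.
Qed.

(** * Galois groups of prime degree with two nonreal roots *)

Section SymmetricGaloisGroup.
Variables (f : {poly int}) (m : nat).
Hypotheses (m_prime : prime m) (f_size : size f = m.+1) (f_monic : f \is monic).
Hypothesis f_irr : irreducible_poly (map_poly (intr : int -> rat) f).
Variables (real_roots : seq algC).
Hypotheses (rr_uniq : uniq real_roots) (rr_size : (m <= (size real_roots).+2)%N).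
Hypothesis rr_real : all (fun z => (z \is Num.real) && root (map_poly intr f) z) real_roots.
Hypothesis nonreal : exists2 z : algC, root (map_poly intr f) z & z \isn't Num.real.

(** Irreducibility gives transitivity; complex conjugation fixes at least m - 2 roots and moves a
    nonreal one, so it acts as a transposition. Then [transitive_prime_tperm] applies. *)
Lemma symmetric_galois_group :
  exists (L : splittingFieldType rat) (LC : {rmorphism L -> algC}) (r : 'I_m -> L),
    [/\ injective r, (forall i, root (map_poly intr f) (r i)),
        (forall s : gal_of {:L}, (forall i, s (r i) = r i) -> s = 1%g) &
        forall p : 'S_m, exists2 s : gal_of {:L}, s \in 'Gal({:L} / 1)%g & forall i, s (r i) = r (p i)].
Proof.
pose fQ : {poly rat} := map_poly intr f.
have fC_monic : map_poly (intr : int -> algC) f \is monic by rewrite monic_map.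
have [rs] := closed_field_poly_normal (map_poly (intr : int -> algC) f).
rewrite (monicP fC_monic) scale1r => fCE.
have rs_size : size rs = m.
  have := congr1 (fun p : {poly algC} => size p) fCE.
  by rewrite size_prod_XsubC size_map_poly_id0 ?intr_eq0 ?lead_coef_eq0 -?size_poly_eq0 f_size // => -[].
have [L [LC [s1 [s1E genL]]]] : exists (L : splittingFieldType rat) (LC : {rmorphism L -> algC})
    (s1 : seq L), map LC s1 = rs /\ <<1 & s1>>%VS = {:L}%VS.
  have [L0 [LC0 [s1 s1E genL]]] := num_field_exists rs.
  have fL0E : map_poly (in_alg L0) fQ = \prod_(b <- s1) ('X - b%:P).
    apply: (map_poly_inj LC0); rewrite rmorph_prod /= -map_poly_comp.
    transitivity (map_poly (intr : int -> algC) f).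
      rewrite /fQ -map_poly_comp; apply: eq_map_poly => a /=.
      by rewrite scaler_int !rmorph_int.
    rewrite fCE -s1E big_map; apply: eq_bigr => b _.
    by rewrite map_polyXsubC.
  have L_ax : FieldExt_isSplittingField rat L0.
    constructor; exists (map_poly (in_alg L0) fQ); first exact: alg_polyOver.
    by exists s1 => //; rewrite fL0E eqpxx.
  by exists (HB.pack_for (splittingFieldType rat) L0 L_ax), LC0, s1.
have fLE' : map_poly (in_alg L) fQ = map_poly intr f.
  by rewrite /fQ -map_poly_comp; apply: eq_map_poly => a /=; rewrite scaler_int.
have fLE : map_poly (in_alg L) fQ = \prod_(b <- s1) ('X - b%:P).
  apply: (map_poly_inj LC); rewrite rmorph_prod /= fLE' -map_poly_comp.
  transitivity (map_poly (intr : int -> algC) f).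
    by apply: eq_map_poly => a /=; rewrite rmorph_int.
  by rewrite fCE -s1E big_map; apply: eq_bigr => b _; rewrite map_polyXsubC.
have s1_size : size s1 = m by rewrite -rs_size -s1E size_map.
have L_0 : [pchar L] =i pred0 by move=> p; rewrite -(fmorph_pchar LC) pchar_num.
have galL : galois 1 {:L} by apply: galois_pchar0.
have fQ_monic : fQ \is monic by rewrite monic_map.
have minP x : x \in s1 -> minPoly 1 x = map_poly (in_alg L) fQ.
  move=> xs; have /polyOver1P[q qE] := minPolyOver 1%AS x.
  have : minPoly 1 x %| map_poly (in_alg L) fQ.
    by apply: minPoly_dvdp; [exact: alg_polyOver | rewrite fLE root_prod_XsubC].
  rewrite qE dvdp_map => qf.
  have q_size : size q != 1 by rewrite -(size_map_poly (in_alg L)) -qE size_minPoly.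
  have q_monic : q \is monic by rewrite -(map_monic (in_alg L)) -qE monic_minPoly.
  by have := f_irr.2 q q_size qf; rewrite eqp_monic // => /eqP ->.
have m_gt0 := prime_gt0 m_prime.
(* The conjugates of any root exhaust all roots without repetition; this yields both distinctness of
   the roots and transitivity. *)
have factors x : x \in s1 -> exists r : seq (gal_of {:L}),
    [/\ r \subset 'Gal({:L} / 1)%g, uniq [seq s x | s : gal_of {:L} <- r] &
      perm_eq s1 [seq s x | s : gal_of {:L} <- r]].
  move=> xs; have /(galois_factors (subvf _))/(_ x (memvf x))[r [rG ru rE]] := galL.
  by exists r; split=> //; apply: prod_XsubC_eq; rewrite -rE minP.
have s1_uniq : uniq s1.
  have [|r [_ ru /perm_uniq->]] := factors (nth 0 s1 0); last by [].
  by rewrite mem_nth ?s1_size.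
have r_in (i : 'I_m) : nth 0 s1 i \in s1 by rewrite mem_nth ?s1_size.
pose r (i : 'I_m) := nth 0 s1 i.
have r_inj : injective r.
  by move=> i j /eqP; rewrite nth_uniq ?s1_size // => /eqP/ord_inj.
have rP x : x \in s1 -> exists i, x = r i.
  move=> xs; have lt : (index x s1 < m)%N by rewrite -s1_size index_mem.
  by exists (Ordinal lt); rewrite /r nth_index.
have r_root i : root (map_poly intr f) (r i) by rewrite -fLE' fLE root_prod_XsubC; exact: r_in.
exists L, LC, r; split=> //.
  move=> s sr; apply/eqP/gal_eqP => a _; rewrite gal_id.
  suff /subvP/(_ a (memvf a)) : ({:L} <= fixedField [set s])%VS.
    by move/mem_fixedFieldP=> [_ ->] //; rewrite inE.
  apply: (subv_trans (_ : {:L} <= <<1 & s1>>)%VS); first by rewrite genL.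
  apply/Fadjoin_seqP; split; first exact: sub1v.
  move=> _ /rP[i ->]; apply/fixedFieldP; first exact: memvf.
  by move=> t; rewrite inE => /eqP ->.
have gal_perm (s : gal_of {:L}) : exists p : 'S_m, forall i, s (r i) = r (p i).
  have H i : exists j, s (r i) = r j.
    apply: rP; rewrite -root_prod_XsubC -fLE fLE'.
    have -> : map_poly intr f = map_poly s (map_poly intr f) :> {poly L}.
      by rewrite -map_poly_comp; apply: eq_map_poly => a /=; rewrite rmorph_int.
    by rewrite fmorph_root.
  have [p pP] := fin_all_exists H.
  have p_inj : injective p.
    by move=> i j pij; have := pP i; rewrite pij -pP => /fmorph_inj/r_inj.
  by exists (perm p_inj) => i; rewrite permE.
pose Gs := [set p : 'S_m | [exists s : gal_of {:L}, (s \in 'Gal({:L} / 1)%g) && [forall i, s (r i) == r (p i)]]].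
have GsP (p : 'S_m) : reflect (exists2 s : gal_of {:L}, s \in 'Gal({:L} / 1)%g & forall i, s (r i) = r (p i)) (p \in Gs).
  rewrite inE; apply: (iffP existsP) => [[s /andP[sG /forallP sE]]|[s sG sE]]; exists s => //.
    by move=> i; apply/eqP.
  by rewrite sG; apply/forallP => i; rewrite sE.
have Gs_group : group_set Gs.
  apply/group_setP; split.
    by apply/GsP; exists 1%g; [exact: group1 | move=> i; rewrite perm1 gal_id].
  move=> p q /GsP[s sG sE] /GsP[t tG tE]; apply/GsP; exists (s * t)%g; first exact: groupM.
  by move=> i; rewrite galM ?memvf // sE tE permM.
pose G := Group Gs_group.
suff H p : p \in G by move=> p; apply/GsP; apply: (H p).
apply: transitive_prime_tperm => //.
  move=> i j; have [q [/subsetP qG _ qE]] := factors _ (r_in i).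
  have : r j \in s1 by exact: r_in.
  rewrite (perm_mem qE) => /mapP[s sq sE]; have [t tE] := gal_perm s.
  exists t; first by apply/GsP; exists s => //; apply: qG.
  by apply: r_inj; rewrite -tE sE.
(* [nu] is complex conjugation restricted to [L]. *)
have [nu nuE] := restrict_aut_to_normal_num_field LC (Num.conj_op : {rmorphism algC -> algC}).
have [|s sG sE] := @gal_rmorphism _ L 1%AS nu.
  by move=> x /vlineP[a ->]; apply: (rmorph_alg nu).
have [{}p pE] := gal_perm s.
have LCp i : LC (r (p i)) = (LC (r i))^* by rewrite -pE sE nuE.
have [z zf zN] := nonreal.
have [i0 i0z] : exists i, z = LC (r i).
  have : z \in rs by rewrite -root_prod_XsubC -fCE.
  by rewrite -s1E => /mapP[x /rP[i ->] ->]; exists i.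
have p1 : p != 1%g.
  apply: contraNneq zN => p1; rewrite i0z; apply/CrealP.
  by rewrite -LCp p1 perm1.
have psupp : (#|[set i | p i != i]| <= 2)%N.
  pose A := [set i | p i == i].
  have -> : [set i | p i != i] = ~: A by apply/setP => i; rewrite !inE.
  have : (size real_roots <= #|A|)%N.
    rewrite -(size_image (fun i => LC (r i)) A); apply: uniq_leq_size => // y yr.
    have /andP[yR yf] := allP rr_real _ yr.
    have : y \in rs by rewrite -root_prod_XsubC -fCE.
    rewrite -s1E => /mapP[x /rP[i ->] yE]; apply/imageP; exists i => //.
    by rewrite inE; apply/eqP/r_inj/(fmorph_inj LC); rewrite LCp -yE; apply/CrealP.
  move=> le; rewrite -(leq_add2l #|A|) cardsC card_ord.
  by apply: leq_trans rr_size _; rewrite -addn2 leq_add2r.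
have [a [b [ab pab]]] := tperm_of_support p1 psupp.
exists a, b; split=> //; rewrite -pab.
by apply/GsP; exists s.
Qed.

End SymmetricGaloisGroup.

(** * The Galois module *)

Section TensorIndependence.
Variable M : zmodType.

Definition tens1 (x : M) : tensQ M := fracQ x 1.

Lemma tens1_is_zmod_morphism : zmod_morphism tens1.
Proof.
have D x y : tens1 (x + y) = tens1 x + tens1 y by rewrite [RHS]addQE.
by move=> x y; apply: (addIr (tens1 y)); rewrite -D !subrK.
Qed.

HB.instance Definition _ :=
  GRing.isZmodMorphism.Build M (tensQ M) tens1 tens1_is_zmod_morphism.

Lemma scale_tens1 (a : int) (x : M) : a%:~R *: tens1 x = tens1 (x *~ a).
Proof. by rewrite [LHS](@scaleQE _ _ a 1) ?divr1. Qed.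

Lemma tens1_eq0 (x : M) : tens1 x = 0 -> exists2 k, (0 < k)%N & x *+ k = 0.
Proof.
move=> x0; have [||/(_ x0)[k k0 e] _] := @fracQP M x 0 1 1 => //.
by exists k => //; rewrite -[x]mulr1n e mul0rn.
Qed.

(** The common denominator [D] makes the relation integral; it then holds in [M] up to torsion,
    which a further factor [k] kills. *)
Lemma tensQ_free (I : finType) (P : I -> M) (q : I -> rat) :
    (forall N : I -> int, \sum_i P i *~ N i = 0 -> forall i, N i = 0) ->
  \sum_i q i *: tens1 (P i) = 0 -> forall i, q i = 0.
Proof.
move=> indep e.
pose N i := numq (q i) * \prod_(j | j != i) denq (q j).
pose D := \prod_j denq (q j).
have qD i : D%:~R * q i = (N i)%:~R.
  rewrite /D /N (bigD1 i) //= !intrM -[X in _ * X]divq_num_den.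
  by rewrite mulrAC mulrC [X in _ * X]mulrC divfK ?intr_eq0 ?denq_neq0 // mulrC.
have {e} : tens1 (\sum_i P i *~ N i) = 0.
  rewrite raddf_sum /=.
  transitivity (D%:~R *: \sum_i q i *: tens1 (P i)); last by rewrite e scaler0.
  by rewrite scaler_sumr; apply: eq_bigr => i _; rewrite scalerA qD scale_tens1.
case/tens1_eq0 => k k0 e i.
have /indep/(_ i)/eqP : \sum_i P i *~ (N i * k%:Z) = 0.
  by rewrite -[RHS]e -sumrMnl; apply: eq_bigr => j _; rewrite mulrzA.
rewrite mulf_eq0 (_ : (k%:Z == 0) = false) ?orbF => [/eqP Ni|]; last by case: (k) k0.
have D0 : D%:~R != 0 :> rat by rewrite intr_eq0; apply/prodf_neq0 => j _; apply: denq_neq0.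
by apply: (mulfI D0); rewrite qD Ni mulr0.
Qed.

End TensorIndependence.

Section RegularOrbit.
Variables (gT : finGroupType) (G : {group gT}) (n : nat).
Variable rG : mx_representation rat G n.
Variables (M : zmodType) (P : gT * 'I_n -> M).

(* The embedding v |-> (v g^-1)_g of V in Q[G]^n, with (g, j) sent to P (g, j). *)
Definition orbit_map (v : 'rV[rat]_n) : tensQ M :=
  \sum_(x | x.1 \in G) (v *m rG (x.1)^-1%g) 0 x.2 *: tens1 (P x).

Lemma orbit_map_is_linear : linear orbit_map.
Proof.
move=> a u v; rewrite /orbit_map scaler_sumr -big_split /=; apply: eq_bigr => x _.
by rewrite mulmxDl -scalemxAl !mxE scalerDl scalerA.
Qed.

HB.instance Definition _ := GRing.isLinear.Build rat 'rV[rat]_n (tensQ M) *:%R orbit_map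
  orbit_map_is_linear.

(** The coefficients at the identity of the group are the coordinates of v. *)
Lemma orbit_map_inj :
    (forall N : gT * 'I_n -> int, \sum_x P x *~ N x = 0 -> forall x, N x = 0) ->
  injective orbit_map.
Proof.
move=> indep; apply: raddf_inj => v; rewrite /= /orbit_map big_mkcond /=.
pose q x := if x.1 \in G then (v *m rG (x.1)^-1%g) 0 x.2 else 0.
rewrite (eq_bigr (fun x => q x *: tens1 (P x))) => [|x _]; last first.
  by rewrite /q; case: ifP => // _; rewrite scale0r.
move/(tensQ_free indep) => q0; apply/rowP => j; have := q0 (1%g, j).
by rewrite /q /= group1 invg1 repr_mx1 mulmx1 mxE.
Qed.

(** The coefficient of v g at (x g, j) is that of v at (x, j), because g (x g)^-1 = x^-1. *)
Lemma orbit_map_equivariant (h : {additive M -> M}) (g : gT) : g \in G ->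
    (forall x, h (P x) = P (x.1 * g, x.2)%g) ->
  forall v, orbit_map (v *m rG g) = tensQ_map h (orbit_map v).
Proof.
move=> gG hP v; rewrite [X in tensQ_map h X]/orbit_map linear_sum /= /orbit_map.
rewrite (reindex_inj (h := fun x : gT * 'I_n => (x.1 * g, x.2)%g)); last first.
  by move=> [x i] [y j] [/mulIg -> ->].
apply: eq_big => [x|x xG] /=; first by rewrite groupMr.
rewrite linearZ /= tensQ_mapE // hP; congr (_ *: _).
have xG' : x.1 \in G by rewrite groupMr in xG.
by rewrite -mulmxA -repr_mxM ?groupV ?groupM // invMg mulKVg.
Qed.

End RegularOrbit.

(** * Automorphisms over a fixed field *)

Section FixedFieldExtension.
Variables (M : splittingFieldType rat) (H : {group gal_of {:M}}).
Definition fixed_subfield : {subfield M} := [aspace of fixedField H].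
Definition over_fixed : splittingFieldType (subvs_of fixed_subfield) := fieldOver fixed_subfield.

Lemma over_fixed_gal (s : gal_of {:over_fixed}) : s \in 'Gal({:over_fixed} / 1)%g ->
  exists2 t : gal_of {:M}, t \in H & forall x, t x = s x.
Proof.
move=> sG; pose phi : {rmorphism M -> M} := (s : {rmorphism over_fixed -> over_fixed}).
have [|t tG tE] := @gal_rmorphism _ M fixed_subfield phi; last first.
  by exists t => //; move: tG; rewrite gal_fixedField.
move=> x xK; apply: (fixed_gal (sub1v _) sG).
by rewrite trivial_fieldOver.
Qed.

Lemma gal_over_fixed (t : gal_of {:M}) : t \in H ->
  exists2 s : gal_of {:over_fixed}, s \in 'Gal({:over_fixed} / 1)%g & forall x, s x = t x.
Proof.
move=> tH; pose phi : {rmorphism over_fixed -> over_fixed} := (t : {rmorphism M -> M}).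
have [|s sG sE] := @gal_rmorphism _ over_fixed 1%AS phi; last by exists s.
move=> x; rewrite trivial_fieldOver => xK.
by have /mem_fixedFieldP[_] := xK; apply.
Qed.

End FixedFieldExtension.

Lemma horner_intr_quad (R : comNzRingType) n (x : R) :
  (map_poly (intr : int -> R) (1 - n%:R * 'X^2)).[x] = 1 - n%:R * x ^+ 2.
Proof.
rewrite rmorphB rmorph1 rmorphM rmorph_nat /= map_polyXn.
by rewrite hornerD hornerN -polyC1 hornerC hornerM hornerCn hornerXn.
Qed.

Lemma qmap_affq (F F' : fieldType) (h : {rmorphism F -> F'}) (x y : F) :
  qmap h (affq x y) = affq (h x) (h y).
Proof. by rewrite /affq /= !rmorphM rmorph_nat. Qed.

Lemma sum_sub_tperm (V : zmodType) (I : finType) (P : I -> V) (N : I -> int) a b : a != b ->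
  \sum_j P j *~ N j - \sum_j P j *~ N (tperm a b j) = (P a - P b) *~ (N a - N b).
Proof.
move=> ab; rewrite -sumrB (bigD1 a) //= (bigD1 b) 1?eq_sym //= big1 => [|j /andP[ja jb]].
  by rewrite tpermL tpermR addr0 -!mulrzBr -[N b - N a]opprB mulrNz -mulrzBl.
by rewrite tpermD 1?eq_sym // subrr.
Qed.

Lemma mulrn_absz_eq0 (V : zmodType) (x : V) (z : int) : x *~ z = 0 -> x *+ `|z| = 0.
Proof. by case: z => n //; rewrite NegzE mulrNz => /eqP; rewrite oppr_eq0 abszN => /eqP. Qed.

Definition sp_y (k : nat) (L : fieldType) (x : L) : L :=
  (map_poly intr (sp_g k)).[x] / (1 - 9 * x ^+ 2).

Lemma sp_y_map (k : nat) (L L' : fieldType) (h : {rmorphism L -> L'}) (x : L) :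
  h (sp_y k x) = sp_y k (h x).
Proof.
rewrite fmorph_div rmorphB rmorphM rmorphXn rmorph1 rmorph_nat -horner_map -map_poly_comp.
by congr (_.[_] / _); apply: eq_map_poly => c /=; rewrite rmorph_int.
Qed.

(** * Independence of the points attached to the roots *)

Section Points.
Variables (K : fieldExtType rat) (L : fieldType) (i : {rmorphism K -> L}) (LC : {rmorphism L -> algC}).
Variable k : nat.
Hypothesis k4 : (4 <= k)%N.
Variables (m : nat) (r : 'I_m -> L).
Hypotheses (m3 : (2 < m)%N) (r_inj : injective r).
Hypothesis r_root : forall j, root (map_poly intr (sp_f k)) (r j).

Lemma sp_root_Aint j : LC (r j) \in Aint.
Proof.
have [_ f_monic] := sp_f_size k4.
apply: (@root_monic_Aint (map_poly intr (sp_f k))).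
- have := r_root j; rewrite -(fmorph_root LC) -map_poly_comp.
  by congr (root _ _); apply: eq_map_poly => a /=; rewrite rmorph_int.
- by rewrite monic_map.
- by apply/polyOverP => l; rewrite coef_map intr_int.
Qed.

Lemma denom_neq0 j : 1 - 9 * r j ^+ 2 != 0.
Proof.
rewrite -(fmorph_eq0 LC) rmorphB rmorphM rmorphXn rmorph1 rmorph_nat.
have -> : 1 - 9 * LC (r j) ^+ 2 = 1 + 3 * (- (3 * LC (r j) ^+ 2)) by ring.
by apply: one_plus3_neq0; rewrite rpredN rpredM ?rpred_nat // rpredX // sp_root_Aint.
Qed.

Lemma sp_on_curve j : (6 * r j) ^+ 2 * sp_y k (r j) ^+ 2 = 4 * (6 * r j) ^+ 2 + 4 * sp_y k (r j) ^+ 2 - 4.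
Proof.
have d0 := denom_neq0 j.
have e : (map_poly intr (sp_g k)).[r j] ^+ 2 = (1 - 36 * r j ^+ 2) * (1 - 9 * r j ^+ 2).
  have := congr1 (fun p => (map_poly (intr : int -> L) p).[r j]) (sp_fE k).
  rewrite sp_quarticE /= rmorphM hornerM (eqP (r_root j)) mul0r.
  rewrite rmorphB hornerD hornerN rmorphXn horner_exp rmorphM hornerM /= !horner_intr_quad.
  by move/esym/eqP; rewrite subr_eq0 => /eqP.
rewrite /sp_y expr_div_n e.
by field.
Qed.

Lemma sp_points : exists P : 'I_m -> av_point (ed_curve K) i,
  forall j, at_aff (P j) (6 * r j) (sp_y k (r j)).
Proof.
have H j : exists P : av_point (ed_curve K) i, at_aff P (6 * r j) (sp_y k (r j)).
  exact/at_aff_ex/sp_on_curve.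
have [P PE] := choice H.
by exists P.
Qed.

Lemma inO_sp_y j : inO (LC (sp_y k (r j))).
Proof.
have d0 := denom_neq0 j; have xA := sp_root_Aint j.
exists (LC (map_poly intr (sp_g k)).[r j]), (- (3 * LC (r j) ^+ 2)); split.
- rewrite -horner_map -map_poly_comp /= rpred_horner //.
  by apply/polyOverP => l; rewrite coef_map /= rmorph_int rpred_int.
- by rewrite rpredN rpredM ?rpred_nat // rpredX.
- have e : 1 + 3 * - (3 * LC (r j) ^+ 2) = LC (1 - 9 * r j ^+ 2).
    by rewrite rmorphB rmorphM rmorphXn rmorph1 rmorph_nat; ring.
  by rewrite e -rmorphM /sp_y divfK.
Qed.

Lemma at_aff_uniq (P Q : av_point (ed_curve K) i) x y : at_aff P x y -> at_aff Q x y -> P = Q.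
Proof.
move=> PE QE; apply: ed_point_inj.
exact: qpar_trans (affq_neq0 i x y) PE (qpar_sym QE).
Qed.

Hypothesis swaps : forall a b : 'I_m, exists h : {rmorphism L -> L},
  forall j, h (r j) = r (tperm a b j).
Variable P : 'I_m -> av_point (ed_curve K) i.
Hypothesis PE : forall j, at_aff (P j) (6 * r j) (sp_y k (r j)).

Lemma relation_swap (N : 'I_m -> int) a b : \sum_j P j *~ N j = 0 -> a != b -> N a != N b ->
  r a = - r b.
Proof.
move=> rel ab Nab; have [h hE] := swaps a b.
have hP j : ed_map h i (P j) = P (tperm a b j).
  apply: at_aff_uniq (PE _); rewrite /at_aff val_ed_map quadr_map.
  by have := qmap_par h (PE j); rewrite qmap_affq sp_y_map rmorphM rmorph_nat hE.
have rel' : \sum_j P j *~ N (tperm a b j) = 0.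
  transitivity (@ed_map _ _ h K K i i (\sum_j P j *~ N j)); last by rewrite rel raddf0.
  rewrite raddf_sum (reindex_inj (@perm_inj _ (tperm a b))) /=.
  by apply: eq_bigr => j _; rewrite raddfMz -hP tpermK.
have rab : (P a - P b) *~ (N a - N b) = 0.
  by rewrite -sum_sub_tperm // rel rel' subr0.
pose iC : {rmorphism K -> algC} := LC \o i.
pose n := `|N a - N b|%N.
have n0 : (0 < n)%N by rewrite absz_gt0 subr_eq0.
have PEC j : at_aff (ed_map LC iC (P j)) (6 * LC (r j)) (LC (sp_y k (r j))).
  rewrite /at_aff val_ed_map quadr_map.
  by have := qmap_par LC (PE j); rewrite qmap_affq (rmorphM LC 6) rmorph_nat.
have T : (ed_map LC iC (P a) - ed_map LC iC (P b)) *+ n = 0.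
  rewrite -raddfB -raddfMn -[RHS](raddf0 (@ed_map _ _ LC K K i iC)); congr (ed_map _ _ _).
  exact: mulrn_absz_eq0.
have := torsion_diff (inO_Aint (sp_root_Aint a)) (inO_Aint (sp_root_Aint b)) (inO_sp_y a) (inO_sp_y b)
  (PEC a) (PEC b) n0 T.
move/eqP; rewrite eqf_sqr -rmorphN => /orP[] /eqP /fmorph_inj // /r_inj e.
by rewrite e eqxx in ab.
Qed.

(** By [relation_swap], a zero and a nonzero coefficient belong to opposite roots. A third root
    would be opposite to one of the two, hence equal to the other. *)
Lemma points_free (N : 'I_m -> int) j0 : \sum_j P j *~ N j = 0 -> N j0 = 0 -> forall j, N j = 0.
Proof.
move=> rel N0 j; apply/eqP; apply: contraT => Nj.
have jj0 : j != j0 by apply: contraNneq Nj => ->; rewrite N0.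
have r1 : r j = - r j0 by apply: (relation_swap rel); rewrite // N0.
have [l lj lj0] : exists2 l : 'I_m, l != j & l != j0.
  have : (0 < #|~: [set j; j0]|)%N.
    by rewrite -(ltn_add2l #|[set j; j0]|) cardsC card_ord cards2 jj0 addn0.
  by case/card_gt0P => l; rewrite !inE negb_or => /andP[]; exists l.
have [Nl|Nl] := eqVneq (N l) 0.
  have : r l = - r j by apply: (relation_swap rel); rewrite // Nl eq_sym.
  by rewrite r1 opprK => /r_inj e; rewrite e eqxx in lj0.
have : r l = - r j0 by apply: (relation_swap rel); rewrite // N0.
by rewrite -r1 => /r_inj e; rewrite e eqxx in lj.
Qed.

End Points.

(** * Translations acting on the indices of the roots *)

Section TransportedTranslation.
Variables (gT : finGroupType) (I : Type) (T : eqType) (J : finType) (e : gT * J -> T).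
Hypothesis e_inj : injective e.

(** Indices outside the image of [e] are fixed, to get a permutation of all roots. Translation is on
    the right because products of Galois elements compose from left to right. *)
Definition transl (g : gT) (i : T) : T :=
  if [pick x | e x == i] is Some x then e (x.1 * g, x.2)%g else i.

Lemma translE g x : transl g (e x) = e (x.1 * g, x.2)%g.
Proof.
rewrite /transl; case: pickP => [y /eqP /e_inj -> //|/(_ x)].
by rewrite eqxx.
Qed.

Lemma transl_out g i : (forall x, e x != i) -> transl g i = i.
Proof. by rewrite /transl; case: pickP => // x /eqP <- /(_ x); rewrite eqxx. Qed.

Variant in_codom_spec i : Type :=
  | InCodom x of i = e x
  | NotInCodom of forall x, e x != i.

Lemma in_codomP i : in_codom_spec i.
Proof.
case: (pickP (fun x => e x == i)) => [x /eqP <-|nx]; first by left with x.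
by right=> x; rewrite nx.
Qed.

Lemma transl1 i : transl 1%g i = i.
Proof.
case: (in_codomP i) => [[g j] -> |/transl_out -> //].
by rewrite translE mulg1.
Qed.

Lemma translM g h i : transl (g * h)%g i = transl h (transl g i).
Proof.
case: (in_codomP i) => [[g' j] -> |/transl_out out]; last by rewrite !out.
by rewrite !translE mulgA.
Qed.

Lemma transl_inj g : injective (transl g).
Proof. by apply: (can_inj (g := transl g^-1%g)) => i; rewrite -translM mulgV transl1. Qed.

Lemma transl_faithful (j : J) g h : transl g =1 transl h -> g = h.
Proof. by move/(_ (e (1%g, j))); rewrite !translE => /e_inj []; rewrite !mul1g. Qed.

End TransportedTranslation.

Lemma extend_by_zero (V : zmodType) (X I : finType) (P : I -> V) (e : X -> I) (N : X -> int) :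
    injective e ->
  exists N' : I -> int, [/\ forall x, N' (e x) = N x,
    forall i, (forall x, e x != i) -> N' i = 0 &
    \sum_i P i *~ N' i = \sum_x P (e x) *~ N x].
Proof.
move=> e_inj; pose N' i := if [pick x | e x == i] is Some x then N x else 0.
have N'e x : N' (e x) = N x.
  by rewrite /N'; case: pickP => [y /eqP /e_inj -> //|/(_ x)]; rewrite eqxx.
have N'0 i : (forall x, e x != i) -> N' i = 0.
  by rewrite /N'; case: pickP => // x /eqP <- /(_ x); rewrite eqxx.
exists N'; split=> //; rewrite (bigID (fun i => i \in e @: setT)) /= [X in _ + X]big1 ?addr0.
  rewrite big_imset => [|x y _ _]; last exact: e_inj.
  by apply: eq_big => [x|x _]; rewrite ?inE ?N'e.
move=> i ni; rewrite N'0 ?mulr0z // => x.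
by apply: contraNneq ni => <-; rewrite imset_f ?inE.
Qed.

(** * Realization of the representation *)

Section Realization.
Variables (gT : finGroupType) (G : {group gT}) (n : nat) (rG : mx_representation rat G n).
Variables (k m : nat) (M : splittingFieldType rat) (MC : {rmorphism M -> algC}) (r : 'I_m -> M).
Hypotheses (k4 : (4 <= k)%N) (m3 : (2 < m)%N) (r_inj : injective r).
Hypothesis r_root : forall j, root (map_poly intr (sp_f k)) (r j).
Hypothesis r_det : forall s : gal_of {:M}, (forall j, s (r j) = r j) -> s = 1%g.
Hypothesis r_sym : forall p : 'S_m,
  exists2 s : gal_of {:M}, s \in 'Gal({:M} / 1)%g & forall j, s (r j) = r (p j).
(** The additional column [ord_max] keeps translation faithful even for n = 0, and provides the
    index with zero coefficient from which [points_free] starts. *)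
Variable e : gT * 'I_n.+1 -> 'I_m.
Hypothesis e_inj : injective e.

Definition transl_gal : {set gal_of {:M}} :=
  [set s : gal_of {:M} | [exists (g | g \in G), [forall j, s (r j) == r (transl e g j)]]].

Lemma transl_galP (s : gal_of {:M}) :
  reflect (exists2 g, g \in G & forall j, s (r j) = r (transl e g j)) (s \in transl_gal).
Proof.
rewrite inE; apply: (iffP exists_inP) => -[g gG /=].
  by move/forallP => sE; exists g => // j; apply/eqP.
by move=> sE; exists g => //; apply/forallP => j; apply/eqP.
Qed.

Lemma transl_gal_group_set : group_set transl_gal.
Proof.
apply/group_setP; split.
  by apply/transl_galP; exists 1%g => // j; rewrite gal_id (transl1 e_inj).
move=> s t /transl_galP[g gG sE] /transl_galP[h hG tE]; apply/transl_galP.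
by exists (g * h)%g; rewrite ?groupM // => j; rewrite galM ?memvf // sE tE (translM e_inj).
Qed.

Definition transl_gal_group : {group gal_of {:M}} := Group transl_gal_group_set.
Definition transl_base : fieldExtType rat := subvs_of (fixed_subfield transl_gal_group).
Definition transl_ext : splittingFieldType transl_base := over_fixed transl_gal_group.
Definition ext_root (j : 'I_m) : transl_ext := r j.
Local Notation Gal := ('Gal({:transl_ext} / 1)%g).
Local Notation pt := (av_point (ed_curve transl_base) (in_alg transl_ext)).

Lemma transl_ext_gal (s : gal_of {:transl_ext}) : s \in Gal ->
  exists2 g, g \in G & forall j, s (ext_root j) = ext_root (transl e g j).
Proof.
move=> sG; have [t /transl_galP[g gG tE] ts] := over_fixed_gal sG.
by exists g => // j; have := tE j; rewrite ts.
Qed.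

(** On [Gal] the default [1] is never reached, by [transl_ext_gal]. *)
Definition gal_label (s : gal_of {:transl_ext}) : gT :=
  odflt 1%g [pick g in G | [forall j, s (ext_root j) == ext_root (transl e g j)]].

Lemma gal_labelP (s : gal_of {:transl_ext}) : s \in Gal ->
  gal_label s \in G /\ forall j, s (ext_root j) = ext_root (transl e (gal_label s) j).
Proof.
move=> sG; rewrite /gal_label; case: pickP => [g /andP[gG /forallP sE]|nog].
  by split=> // j; apply/eqP.
have [g gG sE] := transl_ext_gal sG; move/(_ g): nog; rewrite gG /=.
by move/negbT/forallPn => [j]; rewrite sE eqxx.
Qed.

Lemma gal_label_uniq (s : gal_of {:transl_ext}) g : s \in Gal -> 
  (forall j, s (ext_root j) = ext_root (transl e g j)) -> gal_label s = g.
Proof.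
move=> sG sE; have [_ sE'] := gal_labelP sG; apply: (transl_faithful e_inj ord0) => j.
by apply: r_inj; have := sE j; rewrite sE'.
Qed.

Lemma gal_labelM : {in Gal &, {morph gal_label : s t / (s * t)%g}}.
Proof.
move=> s t sG tG; apply: gal_label_uniq; rewrite ?groupM // => j.
have [_ sE] := gal_labelP sG; have [_ tE] := gal_labelP tG.
by rewrite galM ?memvf // sE tE (translM e_inj).
Qed.

Definition gal_label_morphism : {morphism Gal >-> gT} := Morphism gal_labelM.

(** Injective because an automorphism is determined by its action on the roots. Surjective because
    every permutation of the roots is realized: the automorphism inducing translation by g in [G]
    lies in [transl_gal], hence fixes the base field. *)
Lemma gal_label_isom : isom Gal G gal_label_morphism.
Proof.
apply/isomP; split.
  apply/injmP => s t sG tG st; apply/eqP/gal_eqP => x _.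
  have [s' s'H s'E] := over_fixed_gal sG; have [t' t'H t'E] := over_fixed_gal tG.
  have [_ sE] := gal_labelP sG; have [_ tE] := gal_labelP tG.
  have e1 : (s' * t'^-1)%g = 1%g.
    apply: r_det => j; rewrite galM ?memvf // s'E.
    have -> : s (r j) = t' (r j) by rewrite t'E; have := sE j; rewrite [gal_label s]st -tE.
    by rewrite -galM ?memvf // mulgV gal_id.
  rewrite -s'E -t'E; suff -> : s' = t' by [].
  by apply/eqP; rewrite eq_mulgV1 e1.
apply/setP => g; apply/morphimP/idP => [[s _ sG ->]|gG]; first by case: (gal_labelP sG).
have [s _ sE] := r_sym (perm (@transl_inj _ _ _ _ e_inj g)).
have [|t tG tE] := @gal_over_fixed M transl_gal_group s.
  by apply/transl_galP; exists g => // j; rewrite sE permE.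
exists t => //; apply/esym/gal_label_uniq => // j.
by rewrite /ext_root tE sE permE.
Qed.

Lemma transl_ext_galois : galois 1 {:transl_ext}.
Proof.
apply: galois_pchar0 => p.
by rewrite -(fmorph_pchar (MC : {rmorphism transl_ext -> algC})) pchar_num.
Qed.

Definition ext_algC : {rmorphism transl_ext -> algC} := MC.

(** A swap usually moves [transl_base], so it is only a ring morphism here and not an element of
    [Gal]. *)
Lemma ext_root_swap (a b : 'I_m) : exists h : {rmorphism transl_ext -> transl_ext},
  forall j, h (ext_root j) = ext_root (tperm a b j).
Proof.
have [s _ sE] := r_sym (tperm a b).
by exists (s : {rmorphism M -> M}) => j; rewrite [LHS]sE.
Qed.

Lemma ext_root_root j : root (map_poly intr (sp_f k)) (ext_root j).
Proof. exact: r_root. Qed.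

Lemma gal_point_transl (P : 'I_m -> mordell_weil transl_ext (ed_curve transl_base)) :
  (forall j, at_aff (P j : pt) (6 * ext_root j) (sp_y k (ext_root j))) ->
  forall (s : gal_of {:transl_ext}), s \in Gal -> forall j,
  gal_point s (P j) = P (transl e (gal_label s) j).
Proof.
move=> PE s sG j; have [_ sE] := gal_labelP sG.
apply: at_aff_uniq (PE _).
rewrite /at_aff SubK quadr_map -sE.
have := qmap_par s (PE j); rewrite qmap_affq rmorphM rmorph_nat.
by rewrite sp_y_map.
Qed.

Lemma galois_module_realization :
  exists (A : abelianVariety transl_base)
         (f : {morphism Gal >-> gT})
         (W : {pred tensQ (mordell_weil transl_ext A)})
         (phi : {linear 'rV[rat]_n -> tensQ (mordell_weil transl_ext A)}),
    [/\ galois 1 {:transl_ext},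
        isom Gal G f,
        submod_closed W,
        (forall s w, s \in Gal -> w \in W -> gal_tensQ s w \in W) &
        [/\ injective phi,
            (forall w, w \in W <-> exists v, phi v = w) &
            (forall s v, s \in Gal ->
               phi (v *m rG (f s)) = gal_tensQ s (phi v))]].
Proof.
have [P PE] := sp_points (in_alg transl_ext) ext_algC k4 ext_root_root.
pose P' (x : gT * 'I_n) : mordell_weil transl_ext (ed_curve transl_base) := P (e (x.1, lift ord_max x.2)).
have P'_free (N : gT * 'I_n -> int) : \sum_x P' x *~ N x = 0 -> forall x, N x = 0.
  have e'_inj : injective (fun x : gT * 'I_n => e (x.1, lift ord_max x.2)).
    case=> g i [h j] /e_inj /eqP; rewrite xpair_eqE (inj_eq lift_inj) => /andP[/= /eqP -> /eqP ->].
    by [].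
  move=> rel; have [N' [N'E N'0 sumE]] := extend_by_zero P N e'_inj.
  have j0 : N' (e (1%g, ord_max)) = 0.
    by apply: N'0 => x; rewrite (inj_eq e_inj) xpair_eqE negb_and orbC eq_sym neq_lift.
  move=> x; rewrite -N'E.
  by apply: (points_free ext_algC k4 m3 r_inj ext_root_root ext_root_swap PE _ j0); rewrite sumE.
have phi_equiv s v : s \in Gal ->
    orbit_map rG P' (v *m rG (gal_label s)) = gal_tensQ s (orbit_map rG P' v).
  move=> sG; have [fG _] := gal_labelP sG.
  apply: orbit_map_equivariant => // x.
  by rewrite [LHS](gal_point_transl PE sG) translE.
pose W : {pred tensQ (mordell_weil transl_ext (ed_curve transl_base))} :=
  fun w => `[< exists v, orbit_map rG P' v = w >].
have WP w : w \in W <-> exists v, orbit_map rG P' v = w by split => /asboolP.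
exists (ed_curve transl_base), gal_label_morphism, W, (orbit_map rG P'); split.
- exact: transl_ext_galois.
- exact: gal_label_isom.
- split; first by apply/WP; exists 0; rewrite linear0.
  by move=> a _ _ /WP[v <-] /WP[w <-]; apply/WP; exists (a *: v + w); rewrite linearP.
- by move=> s _ sG /WP[v <-]; apply/WP; exists (v *m rG (gal_label s)); rewrite phi_equiv.
- by split=> //; apply: orbit_map_inj.
Qed.

End Realization.

Theorem theorem1p1 (gT : finGroupType) (G : {group gT}) (n : nat)
    (rG : mx_representation rat G n)
    (rG_faithful : mx_faithful rG) (rG_irr : mx_irreducible rG) :
  exists (K : fieldExtType rat) (L : splittingFieldType K)
         (A : abelianVariety K)
         (f : {morphism 'Gal({:L} / 1)%g >-> gT})
         (W : {pred tensQ (mordell_weil L A)})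
         (phi : {linear 'rV[rat]_n -> tensQ (mordell_weil L A)}),
    [/\ galois 1 {:L},
        isom 'Gal({:L} / 1)%g G f,
        submod_closed W,
        (forall s w, s \in 'Gal({:L} / 1)%g -> w \in W -> gal_tensQ s w \in W) &
        [/\ injective phi,
            (forall w, w \in W <-> exists v, phi v = w) &
            (forall s v, s \in 'Gal({:L} / 1)%g ->
               phi (v *m rG (f s)) = gal_tensQ s (phi v))]].
Proof.
(* All pairs of a group element and a column must embed into the m roots; the 8 makes [m] odd and
   gives k >= 4. *)
have [m m_gt m_prime] := prime_above (8 + #|{: gT * 'I_n.+1}|).
have m8 : (8 < m)%N := leq_ltn_trans (leq_addr _ _) m_gt.
have m_odd : odd m by case: (even_prime m_prime) m8 => [-> //|].
(* The degree 2 k - 1 of [sp_f k] is then [m]. *)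
pose k := m.+1./2.
have k2 : k.*2 = m.+1 by rewrite /k -[RHS](odd_double_half m.+1) /= m_odd.
have k4 : (4 <= k)%N by rewrite -leq_double k2 (leq_trans _ (leqW m8)).
have [f_size f_monic] := sp_f_size k4.
have [real_roots [rr_uniq rr_size rr_real]] := sp_real_roots k4.
have [||M [MC [r [r_inj r_root r_det r_sym]]]] :=
  symmetric_galois_group m_prime _ f_monic (sp_irr k4) rr_uniq _ rr_real (sp_nonreal k4).
- by rewrite f_size k2.
- by rewrite rr_size k2; move: m8; clear; lia.
have cm : (#|{: gT * 'I_n.+1}| <= m)%N by apply: leq_trans (ltnW m_gt); rewrite leq_addl.
have e_inj : injective (fun x : gT * 'I_n.+1 => widen_ord cm (enum_rank x)).
  by move=> x y /(congr1 val) /= /ord_inj /enum_rank_inj.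
have m3 : (2 < m)%N by rewrite (leq_trans _ m8).
do 2!eexists.
exact: (galois_module_realization rG MC k4 m3 r_inj r_root r_det r_sym e_inj).
Qed.
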